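(* Let $C$ be a conilpotent coalgebra over a field $k$ and let $n\ge1$ be the minimal integer for which the vector space $\operatorname{Ext}^n_C(k,k)$ is infinite-dimensional. Let $T$ be an infinite-dimensional $k$-vector space endowed with the trivial left $C$-contramodule structure (provided by the coaugmentation $\gamma\colon k\to C$). Then the map $\operatorname{Ext}^{C,n}(T,k)\to\operatorname{Ext}_{C^*}^n(T,k)$ induced by the contramodule forgetful functor $\Theta$ from left $C$-contramodules to left $C^*$-modules is not injective. Consequently, there exists a projective left $C$-contramodule $P$ such that the map $\operatorname{Ext}^{C,n-1}(P,k)\to\operatorname{Ext}_{C^*}^{n-1}(P,k)$ induced by $\Theta$ is (injective, but) not surjective.
   Context: Coalgebras over $k$ are coassociative and counital, with comultiplication $\mu\colon C\to C\otimes_kC$ and counit $\epsilon\colon C\to k$. Left $C$-comodules are $k$-vector spaces with a coassociative counital coaction $M\to C\otimes_kM$. The dual space $C^*=\operatorname{Hom}_k(C,k)$ is an associative unital algebra with $(fg)(c)=f(c_{(2)})g(c_{(1)})$, where $\mu(c)=c_{(1)}\otimes c_{(2)}$, and unit $\epsilon$. A left $C$-contramodule is a $k$-vector space $P$ with a linear map $\pi\colon\operatorname{Hom}_k(C,P)\to P$ such that (contraassociativity) the two maps $\operatorname{Hom}(C,\pi)$ and $\operatorname{Hom}(\mu,P)\colon\operatorname{Hom}_k(C\otimes_kC,P)\simeq\operatorname{Hom}_k(C,\operatorname{Hom}_k(C,P))\to\operatorname{Hom}_k(C,P)$ have equal compositions with $\pi$, the identification being the case of $\operatorname{Hom}_k(U\otimes_kV,W)\simeq\operatorname{Hom}_k(V,\operatorname{Hom}_k(U,W))$;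 and (contraunitality) the composition of $\operatorname{Hom}(\epsilon,P)\colon P\to\operatorname{Hom}_k(C,P)$ with $\pi$ is the identity. Left $C$-contramodules form an abelian category with enough projectives. The composition $C^*\otimes_kP\to\operatorname{Hom}_k(C,P)\xrightarrow{\pi}P$ makes $P$ a left $C^*$-module, defining the exact forgetful functor $\Theta$. $\operatorname{Ext}_C^*$ and $\operatorname{Ext}^{C,*}$ denote the Yoneda Ext in the categories of left $C$-comodules and left $C$-contramodules, $\operatorname{Ext}_{C^*}^*$ the Ext over left $C^*$-modules; $\operatorname{Ext}^0=\operatorname{Hom}$. A coaugmentation of $C$ is a coalgebra homomorphism $\gamma\colon k\to C$. A noncounital coalgebra $D$ is conilpotent if for each $d\in D$ some iterated comultiplication $\mu^{(m)}(d)\in D^{\otimes m+1}$, $m\ge1$, vanishes. A coaugmented coalgebra $(C,\gamma)$ is conilpotent if the noncounital coalgebra $C/\gamma(k)$ is conilpotent; then $\gamma$ is the unique coaugmentation. The trivial left $C$-contramodule structure on a vector space $T$ is $\operatorname{Hom}_k(C,T)\to\operatorname{Hom}_k(k,T)\simeq T$, the restriction along $\gamma$. The one-dimensional space $k$ carries the trivial $C$-comodule and $C$-contramodule structures defined by $\gamma$. *)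

(* Defs.v *)
From HB Require Import structures.
From Stdlib Require Import Relations.
From mathcomp Require Import all_boot all_algebra.
From mathcomp Require Import boolp.

Set Implicit Arguments.
Unset Strict Implicit.
Unset Printing Implicit Defensive.

Import GRing.Theory.

Local Open Scope ring_scope.
Local Open Scope quotient_scope.

Section LinearMaps.
Variables (R : pzRingType) (U V : lmodType R).

Lemma linear_ext (f g : {linear U -> V}) : f =1 g -> f = g.
Proof.
case: f => f cf; case: g => g cg /= /funext E; subst g; congr GRing.Linear.Pack.
case: cf => [[a] [b]]; case: cg => [[a'] [b']].
by rewrite (Prop_irrelevance a a') (Prop_irrelevance b b').
Qed.

Definition lin_of (f : U -> V) of linear f := f.
HB.instance Definition _ f (fP : linear f) :=
  GRing.isLinear.Build R U V *:%R (lin_of fP) fP.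
Definition mklin f (fP : linear f) : {linear U -> V} := lin_of fP.

End LinearMaps.

Section LinearMapsSpace.
Variables (R : comPzRingType) (U V : lmodType R).

HB.instance Definition _ := gen_eqMixin {linear U -> V}.
HB.instance Definition _ := gen_choiceMixin {linear U -> V}.

Implicit Types f g h : {linear U -> V}.

Definition lin_zero : {linear U -> V} := \0.
Definition lin_add f g : {linear U -> V} := f \+ g.
Definition lin_opp f : {linear U -> V} := \- f.
Lemma lin_scale_subproof (a : R) f : linear (fun x => a *: f x).
Proof. by move=> b u v; rewrite linearP scalerDr !scalerA mulrC. Qed.
Definition lin_scale a f : {linear U -> V} := mklin (lin_scale_subproof a f).

Lemma lin_addA : associative lin_add.
Proof. by move=> f g h; apply: linear_ext => x /=; rewrite addrA. Qed.
Lemma lin_addC : commutative lin_add.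
Proof. by move=> f g; apply: linear_ext => x /=; rewrite addrC. Qed.
Lemma lin_add0 : left_id lin_zero lin_add.
Proof. by move=> f; apply: linear_ext => x /=; rewrite add0r. Qed.
Lemma lin_addN : left_inverse lin_zero lin_opp lin_add.
Proof. by move=> f; apply: linear_ext => x /=; rewrite addNr. Qed.
HB.instance Definition _ :=
  GRing.isZmodule.Build {linear U -> V} lin_addA lin_addC lin_add0 lin_addN.

Lemma lin_scaleA a b f : lin_scale a (lin_scale b f) = lin_scale (a * b) f.
Proof. by apply: linear_ext => x; apply: scalerA. Qed.
Lemma lin_scale1 : left_id 1 lin_scale.
Proof. by move=> f; apply: linear_ext => x; apply: scale1r. Qed.
Lemma lin_scaleDr : right_distributive lin_scale +%R.
Proof. by move=> a f g; apply: linear_ext => x; apply: scalerDr. Qed.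
Lemma lin_scaleDl f : {morph lin_scale^~ f : a b / a + b}.
Proof. by move=> a b; apply: linear_ext => x; apply: scalerDl. Qed.
HB.instance Definition _ := GRing.Zmodule_isLmodule.Build R {linear U -> V}
  lin_scaleA lin_scale1 lin_scaleDr lin_scaleDl.

Lemma linDE f g x : (f + g) x = f x + g x. Proof. by []. Qed.
Lemma linZE a f x : (a *: f) x = a *: f x. Proof. by []. Qed.

End LinearMapsSpace.

(* The space [tensor U V] consists of finite formal sums of pairs, two sums being
identified when no bilinear map tells them apart; [tensor_universal] is the
universal property. *)

Section Tensor.
Variable k : fieldType.
Implicit Types U V W : lmodType k.

Section Bilinear.
Variables (U V W : lmodType k) (f : U -> V -> W).
Hypothesis fl : forall v, linear (f ^~ v).
Hypothesis fr : forall u, linear (f u).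

Definition bil_of of (forall v, linear (f ^~ v)) & (forall u, linear (f u)) := f.
HB.instance Definition _ := bilinear_isBilinear.Build k U V W *:%R *:%R
  (bil_of fl fr) (fl, fr).
Definition mkbil : {bilinear U -> V -> W} := bil_of fl fr.

End Bilinear.

Section TensorSpace.
Variables U V : lmodType k.

Definition tsum W (f : {bilinear U -> V -> W}) (s : seq (U * V)) : W :=
  \sum_(p <- s) f p.1 p.2.

Definition tensor_equiv : rel (seq (U * V)) := fun s t =>
  `[< forall W (f : {bilinear U -> V -> W}), tsum f s = tsum f t >].

Lemma tensor_equiv_class : equiv_class_of tensor_equiv.
Proof.
split=> [s|s t|t s r]; first exact/asboolP.
  by apply/asboolP/asboolP => E W f; rewrite E.
by move=> /asboolP E1 /asboolP E2; apply/asboolP => W f; rewrite E1 E2.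
Qed.

Canonical tensor_equiv_rel := EquivRelPack tensor_equiv_class.
Canonical tensor_enc_rel := defaultEncModRel tensor_equiv.
Definition tensor := {eq_quot tensor_equiv}.
HB.instance Definition _ : EqQuotient _ tensor_equiv tensor := EqQuotient.on tensor.
HB.instance Definition _ := Choice.on tensor.

Implicit Types (x y z : tensor) (s t : seq (U * V)).

Definition tpi s : tensor := \pi_tensor s.
Definition tlift W (f : {bilinear U -> V -> W}) x : W := tsum f (repr x).

Lemma tpiP s t :
  tpi s = tpi t <-> forall W (f : {bilinear U -> V -> W}), tsum f s = tsum f t.
Proof.
split=> [/eqP | E]; first by rewrite eqmodE => /asboolP.
by apply/eqP; rewrite eqmodE; apply/asboolP.
Qed.

Lemma tlift_pi W (f : {bilinear U -> V -> W}) s : tlift f (tpi s) = tsum f s.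
Proof. by apply: (tpiP _ _).1; rewrite /tpi reprK. Qed.

Lemma tensorP x y :
  (forall W (f : {bilinear U -> V -> W}), tlift f x = tlift f y) -> x = y.
Proof. by rewrite -[x]reprK -[y]reprK => E; apply/tpiP => W f; rewrite -!tlift_pi E. Qed.

Definition tzero : tensor := tpi [::].
Definition tadd x y : tensor := tpi (repr x ++ repr y).
Definition tscale (a : k) x : tensor :=
  tpi [seq (a *: p.1, p.2) | p <- repr x].
Definition topp x : tensor := tscale (-1) x.

Lemma tlift_zero W (f : {bilinear U -> V -> W}) : tlift f tzero = 0.
Proof. by rewrite tlift_pi /tsum big_nil. Qed.
Lemma tlift_add W (f : {bilinear U -> V -> W}) x y :
  tlift f (tadd x y) = tlift f x + tlift f y.
Proof. by rewrite tlift_pi /tsum big_cat. Qed.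
Lemma tlift_scale W (f : {bilinear U -> V -> W}) a x :
  tlift f (tscale a x) = a *: tlift f x.
Proof.
rewrite tlift_pi /tlift /tsum big_map scaler_sumr; apply: eq_bigr => p _ /=.
by rewrite linearZl_LR.
Qed.
Lemma tlift_opp W (f : {bilinear U -> V -> W}) x : tlift f (topp x) = - tlift f x.
Proof. by rewrite tlift_scale scaleN1r. Qed.

Lemma taddA : associative tadd.
Proof. by move=> x y z; apply: tensorP => W f; rewrite !tlift_add addrA. Qed.
Lemma taddC : commutative tadd.
Proof. by move=> x y; apply: tensorP => W f; rewrite !tlift_add addrC. Qed.
Lemma tadd0 : left_id tzero tadd.
Proof. by move=> x; apply: tensorP => W f; rewrite tlift_add tlift_zero add0r. Qed.
Lemma taddN : left_inverse tzero topp tadd.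
Proof.
by move=> x; apply: tensorP => W f; rewrite tlift_add tlift_opp tlift_zero addNr.
Qed.
HB.instance Definition _ := GRing.isZmodule.Build tensor taddA taddC tadd0 taddN.

Lemma tscaleA a b x : tscale a (tscale b x) = tscale (a * b) x.
Proof. by apply: tensorP => W f; rewrite !tlift_scale scalerA. Qed.
Lemma tscale1 : left_id 1 tscale.
Proof. by move=> x; apply: tensorP => W f; rewrite tlift_scale scale1r. Qed.
Lemma tscaleDr : right_distributive tscale +%R.
Proof.
move=> a x y; apply: tensorP => W f.
by rewrite tlift_add !tlift_scale tlift_add scalerDr.
Qed.
Lemma tscaleDl x : {morph tscale^~ x : a b / a + b}.
Proof.
move=> a b; apply: tensorP => W f.
by rewrite tlift_add !tlift_scale scalerDl.
Qed.
HB.instance Definition _ := GRing.Zmodule_isLmodule.Build k tensor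
  tscaleA tscale1 tscaleDr tscaleDl.

Definition tpure (u : U) (v : V) : tensor := tpi [:: (u, v)].

Lemma tlift_linear W (f : {bilinear U -> V -> W}) : linear (tlift f).
Proof. by move=> a x y; rewrite tlift_add tlift_scale. Qed.
HB.instance Definition _ W (f : {bilinear U -> V -> W}) :=
  GRing.isLinear.Build k tensor W *:%R (tlift f) (tlift_linear f).

Lemma tliftE W (f : {bilinear U -> V -> W}) u v : tlift f (tpure u v) = f u v.
Proof. by rewrite [LHS]tlift_pi /tsum big_seq1. Qed.

Lemma tpure_linearl v : linear (tpure ^~ v).
Proof.
move=> a u u'; apply: tensorP => W f; rewrite tlift_linear !tlift_pi /tsum !big_seq1 /=.
by rewrite linearPl.
Qed.
Lemma tpure_linearr u : linear (tpure u).
Proof.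
move=> a v v'; apply: tensorP => W f; rewrite tlift_linear !tlift_pi /tsum !big_seq1 /=.
by rewrite linearPr.
Qed.
HB.instance Definition _ := bilinear_isBilinear.Build k U V tensor *:%R *:%R
  tpure (tpure_linearl, tpure_linearr).

Lemma tensor_span x : exists s : seq (U * V), x = \sum_(p <- s) tpure p.1 p.2.
Proof.
exists (repr x); apply: tensorP => W f.
rewrite (linear_sum (tlift f)).
by apply: eq_bigr => p _; rewrite /= tliftE.
Qed.

End TensorSpace.

Lemma tensor_ext U V W (f g : {linear tensor U V -> W}) :
  (forall u v, f (tpure u v) = g (tpure u v)) -> f =1 g.
Proof.
move=> E x; have [s ->] := tensor_span x.
by rewrite !linear_sum; apply: eq_bigr => p _.
Qed.

Lemma tensor_universal U V W (f : {bilinear U -> V -> W}) :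
  exists! g : {linear tensor U V -> W}, forall u v, g (tpure u v) = f u v.
Proof.
exists (tlift f); split=> [u v|g gE]; first exact: tliftE.
by apply/linear_ext/tensor_ext => u v; rewrite /= tliftE gE.
Qed.

Section TensorMap.
Variables (U U' V V' : lmodType k) (f : {linear U -> U'}) (g : {linear V -> V'}).

Lemma tmap_linearl (v : V) : linear (fun u => tpure (f u) (g v)).
Proof. by move=> a u u'; rewrite linearP linearPl. Qed.
Lemma tmap_linearr (u : U) : linear (fun v => tpure (f u) (g v)).
Proof. by move=> a v v'; rewrite linearP linearPr. Qed.
Definition tmap : tensor U V -> tensor U' V' :=
  tlift (mkbil tmap_linearl tmap_linearr).
HB.instance Definition _ := GRing.Linear.copy tmap (tlift _).

Lemma tmapE u v : tmap (tpure u v) = tpure (f u) (g v).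
Proof. exact: tliftE. Qed.

End TensorMap.

Section TensorAssoc.
Variables U V W : lmodType k.

Section Fixw.
Variable w : W.
Lemma tassocw_linearl (v : V) : linear (fun u : U => tpure u (tpure v w)).
Proof. by move=> a u u'; rewrite linearPl. Qed.
Lemma tassocw_linearr (u : U) : linear (fun v : V => tpure u (tpure v w)).
Proof. by move=> a v v'; rewrite linearPl linearPr. Qed.
Definition tassocw : tensor U V -> tensor U (tensor V W) :=
  tlift (mkbil tassocw_linearl tassocw_linearr).
HB.instance Definition _ := GRing.Linear.copy tassocw (tlift _).
Lemma tassocwE u v : tassocw (tpure u v) = tpure u (tpure v w).
Proof. exact: tliftE. Qed.
End Fixw.

Lemma tassoc_linearl w : linear (fun x => tassocw w x).
Proof. exact: linearP. Qed.
Lemma tassoc_linearr x : linear (fun w => tassocw w x).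
Proof.
move=> a w w'; have [s ->] := tensor_span x.
rewrite !(linear_sum (tassocw _)) scaler_sumr -big_split; apply: eq_bigr => p _ /=.
by rewrite !tassocwE !linearPr.
Qed.
Definition tassoc : tensor (tensor U V) W -> tensor U (tensor V W) :=
  tlift (mkbil tassoc_linearl tassoc_linearr).
HB.instance Definition _ := GRing.Linear.copy tassoc (tlift _).

Lemma tassocE u v w : tassoc (tpure (tpure u v) w) = tpure u (tpure v w).
Proof. by rewrite /tassoc tliftE; apply: tassocwE. Qed.

End TensorAssoc.

Section TensorUnit.
Variable V : lmodType k.

Lemma tunit_linear1 (v : V) : linear (fun a : k^o => a *: v).
Proof. by move=> b a a'; rewrite scalerDl scalerA. Qed.
Lemma tunit_linear2 (a : k^o) : linear (fun v : V => a *: v).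
Proof. by move=> b v v'; rewrite scalerDr !scalerA mulrC. Qed.

Definition lin_scalar v : {linear k^o -> V} := mklin (tunit_linear1 v).

(* The canonical isomorphisms from k (x) V and V (x) k to V. *)
Definition tunitl : tensor k^o V -> V :=
  tlift (mkbil tunit_linear1 tunit_linear2).
HB.instance Definition _ := GRing.Linear.copy tunitl (tlift _).
Definition tunitr : tensor V k^o -> V :=
  tlift (mkbil (f := fun v (a : k^o) => a *: v) tunit_linear2 tunit_linear1).
HB.instance Definition _ := GRing.Linear.copy tunitr (tlift _).

Lemma tunitlE a v : tunitl (tpure a v) = a *: v.
Proof. exact: tliftE. Qed.
Lemma tunitrE a v : tunitr (tpure v a) = a *: v.
Proof. exact: tliftE. Qed.

End TensorUnit.

Section TensorTheory.

Lemma tmap_id U V (x : tensor U V) : tmap idfun idfun x = x.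
Proof. by apply: (tensor_ext (g := idfun)) => u v /=; rewrite tmapE. Qed.

Lemma tmap_ext U U' V V' (f f' : {linear U -> U'}) (g g' : {linear V -> V'}) :
  f =1 f' -> g =1 g' -> tmap f g =1 tmap f' g'.
Proof. by move=> /linear_ext -> /linear_ext ->. Qed.

Lemma tunitl_nat V V' (f : {linear V -> V'}) (x : tensor k^o V) :
  tunitl (tmap idfun f x) = f (tunitl x).
Proof.
apply: (tensor_ext (f := @tunitl V' \o tmap idfun f) (g := f \o @tunitl V)) => a v /=.
by rewrite tmapE !tunitlE linearZ.
Qed.

Lemma tmap_comp U U' U'' V V' V'' (f' : {linear U' -> U''}) (f : {linear U -> U'})
    (g' : {linear V' -> V''}) (g : {linear V -> V'}) x :
  tmap f' g' (tmap f g x) = tmap (f' \o f) (g' \o g) x.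
Proof.
apply: (tensor_ext (f := tmap f' g' \o tmap f g)) => u v /=.
by rewrite !tmapE.
Qed.

Lemma tmap_addr U U' V V' (f : {linear U -> U'}) (g h : {linear V -> V'}) x :
  tmap f (g + h) x = tmap f g x + tmap f h x.
Proof.
apply: (tensor_ext (f := tmap f (g + h)) (g := tmap f g \+ tmap f h)) => u v /=.
by rewrite !tmapE linDE linearDr.
Qed.

Lemma tensor_ext3 U V W (X : lmodType k) (f g : {linear tensor (tensor U V) W -> X}) :
  (forall u v w, f (tpure (tpure u v) w) = g (tpure (tpure u v) w)) -> f =1 g.
Proof.
move=> E; apply: tensor_ext => x w.
have lin (h : {linear tensor (tensor U V) W -> X}) :
    linear (fun y : tensor U V => h (tpure y w)).
  by move=> a y y'; rewrite linearPl linearP.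
by apply: (tensor_ext (f := mklin (lin f)) (g := mklin (lin g))) => u v; apply: E.
Qed.

Lemma tassoc_nat U U' V V' W W' (f : {linear U -> U'}) (g : {linear V -> V'})
    (h : {linear W -> W'}) x :
  tassoc (tmap (tmap f g) h x) = tmap f (tmap g h) (tassoc x).
Proof.
apply: (tensor_ext3 (f := @tassoc _ _ _ \o tmap (tmap f g) h)
                    (g := tmap f (tmap g h) \o @tassoc _ _ _)) => u v w /=.
by rewrite tassocE !tmapE /= !tmapE tassocE.
Qed.

End TensorTheory.

End Tensor.

Notation "u ⊗ v" := (tpure u v) (at level 38) : ring_scope.

Section Coker.
Variables (k : fieldType) (U V : lmodType k) (f : {linear U -> V}).

Definition coker_equiv : rel V := fun x y => `[< exists u, x - y = f u >].

Lemma coker_equiv_class : equiv_class_of coker_equiv.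
Proof.
have S x y : coker_equiv x y -> coker_equiv y x.
  move=> /asboolP[u E]; apply/asboolP; exists (- u).
  by rewrite linearN -E opprB.
split=> [x|x y|y x z]; first by apply/asboolP; exists 0; rewrite subrr linear0.
  by apply/idP/idP; apply: S.
move=> /asboolP[u E] /asboolP[v F]; apply/asboolP; exists (u + v).
by rewrite linearD -E -F addrA subrK.
Qed.

Canonical coker_equiv_rel := EquivRelPack coker_equiv_class.
Canonical coker_enc_rel := defaultEncModRel coker_equiv.
Definition coker := {eq_quot coker_equiv}.
HB.instance Definition _ : EqQuotient _ coker_equiv coker := EqQuotient.on coker.
HB.instance Definition _ := Choice.on coker.

Let pi (x : V) : coker := \pi_coker x.

Lemma coker_eqP x y : pi x = pi y <-> exists u, x - y = f u.
Proof.
split=> [/eqP | E]; first by rewrite eqmodE => /asboolP.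
by apply/eqP; rewrite eqmodE; apply/asboolP.
Qed.

Let repr_pi x : exists u, repr (pi x) - x = f u.
Proof. by apply: (coker_eqP _ _).1; rewrite /pi reprK. Qed.

Definition coker_add (p q : coker) : coker := pi (repr p + repr q).
Definition coker_scale (a : k) (p : coker) : coker := pi (a *: repr p).
Definition coker_opp := coker_scale (-1).

Let addE x y : coker_add (pi x) (pi y) = pi (x + y).
Proof.
have [u E] := repr_pi x; have [v F] := repr_pi y.
by apply/coker_eqP; exists (u + v); rewrite linearD -E -F opprD addrACA.
Qed.
Let scaleE a x : coker_scale a (pi x) = pi (a *: x).
Proof.
have [u E] := repr_pi x.
by apply/coker_eqP; exists (a *: u); rewrite -scalerBr E linearZ.
Qed.

Let coker_ind (P : coker -> Prop) : (forall x, P (pi x)) -> forall q, P q.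
Proof. by move=> H q; rewrite -[q]reprK; apply: H. Qed.

Lemma coker_addA : associative coker_add.
Proof.
elim/coker_ind=> x; elim/coker_ind=> y; elim/coker_ind=> z.
by rewrite !addE addrA.
Qed.
Lemma coker_addC : commutative coker_add.
Proof. by elim/coker_ind=> x; elim/coker_ind=> y; rewrite !addE addrC. Qed.
Lemma coker_add0 : left_id (pi 0) coker_add.
Proof. by elim/coker_ind=> x; rewrite addE add0r. Qed.
Lemma coker_addN : left_inverse (pi 0) coker_opp coker_add.
Proof. by elim/coker_ind=> x; rewrite /coker_opp scaleE addE scaleN1r addNr. Qed.
HB.instance Definition _ :=
  GRing.isZmodule.Build coker coker_addA coker_addC coker_add0 coker_addN.

Lemma coker_scaleA a b x : coker_scale a (coker_scale b x) = coker_scale (a * b) x.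
Proof. by elim/coker_ind: x => x; rewrite !scaleE scalerA. Qed.
Lemma coker_scale1 : left_id 1 coker_scale.
Proof. by elim/coker_ind=> x; rewrite scaleE scale1r. Qed.
Lemma coker_scaleDr : right_distributive coker_scale +%R.
Proof.
move=> a; elim/coker_ind=> x; elim/coker_ind=> y.
by rewrite [_ + _]addE !scaleE [RHS]addE scalerDr.
Qed.
Lemma coker_scaleDl x : {morph coker_scale^~ x : a b / a + b}.
Proof.
by elim/coker_ind: x => x a b; rewrite !scaleE [RHS]addE scalerDl.
Qed.
HB.instance Definition _ := GRing.Zmodule_isLmodule.Build k coker
  coker_scaleA coker_scale1 coker_scaleDr coker_scaleDl.

Let pi_linear : linear pi.
Proof. by move=> a x y; rewrite [a *: pi x]scaleE [RHS]addE. Qed.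
Definition coker_pi : V -> coker := lin_of pi_linear.
HB.instance Definition _ := GRing.Linear.on coker_pi.

Lemma coker_pi_surj q : exists x, coker_pi x = q.
Proof. by elim/coker_ind: q => x; exists x. Qed.

Lemma coker_pi_eq x y : coker_pi x = coker_pi y <-> exists u, x - y = f u.
Proof. exact: coker_eqP. Qed.

Section Lift.
Variables (W : lmodType k) (h : {linear V -> W}).
Hypothesis hf : forall u, h (f u) = 0.

Let hlift (q : coker) : W := h (repr q).
Let hliftE x : hlift (pi x) = h x.
Proof.
have [u E] := repr_pi x.
by apply/eqP; rewrite -subr_eq0 -linearB E hf.
Qed.
Let hlift_linear : linear hlift.
Proof.
move=> a; elim/coker_ind=> x; elim/coker_ind=> y.
by rewrite -[a *: pi x + pi y]pi_linear !hliftE linearP.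
Qed.
Definition coker_lift : coker -> W := lin_of hlift_linear.
HB.instance Definition _ := GRing.Linear.on coker_lift.
Lemma coker_liftE x : coker_lift (coker_pi x) = h x.
Proof. exact: hliftE. Qed.

End Lift.

End Coker.

Record ncoalgebra (k : fieldType) := NCoalgebra {
  ncoalg_space :> lmodType k;
  comul : {linear ncoalg_space -> tensor ncoalg_space ncoalg_space};
  comulA : forall c,
    tassoc (tmap comul idfun (comul c)) = tmap idfun comul (comul c)
}.
Arguments comul {k n} : rename.

Record coalgebra (k : fieldType) := Coalgebra {
  coalg_base :> ncoalgebra k;
  counit : {linear coalg_base -> k^o};
  counitl : forall c, tunitl (tmap counit idfun (comul c)) = c;
  counitr : forall c, tunitr (tmap idfun counit (comul c)) = c
}.
Arguments counit {k c} : rename.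

Record coalg_hom (k : fieldType) (C D : coalgebra k) := CoalgHom {
  coalg_fun :> {linear C -> D};
  coalg_comul : forall c, comul (coalg_fun c) = tmap coalg_fun coalg_fun (comul c);
  coalg_counit : forall c, counit (coalg_fun c) = counit c
}.

Section UnitCoalgebra.
Variable k : fieldType.

Lemma unit_comul_linear : linear (fun a : k^o => a ⊗ (1 : k^o)).
Proof. by move=> a x y; rewrite linearPl. Qed.
Definition unit_comul : k^o -> tensor k^o k^o := lin_of unit_comul_linear.
HB.instance Definition _ := GRing.Linear.on unit_comul.

Lemma unit_comulA (c : k^o) :
  tassoc (tmap unit_comul idfun (unit_comul c)) =
  tmap idfun unit_comul (unit_comul c).
Proof. by rewrite !tmapE tassocE. Qed.
Lemma unit_counitl (c : k^o) : tunitl (tmap idfun idfun (unit_comul c)) = c.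
Proof. by rewrite tmapE tunitlE; apply: mulr1. Qed.
Lemma unit_counitr (c : k^o) : tunitr (tmap idfun idfun (unit_comul c)) = c.
Proof. by rewrite tmapE tunitrE; apply: mul1r. Qed.

Definition unit_ncoalgebra := NCoalgebra unit_comulA.
Definition unit_coalgebra :=
  @Coalgebra k unit_ncoalgebra idfun unit_counitl unit_counitr.

End UnitCoalgebra.

Definition coaugmentation k (C : coalgebra k) := coalg_hom (unit_coalgebra k) C.

Section Conilpotent.
Variable k : fieldType.

(* [tpow D m] is the tensor power of D with m + 1 factors. *)
Fixpoint tpow (D : lmodType k) (m : nat) : lmodType k :=
  if m is m'.+1 then tensor D (tpow D m') else D.

Fixpoint iter_comul (D : ncoalgebra k) (m : nat) : {linear D -> tpow D m} :=
  if m is m'.+1 return {linear D -> tpow D m}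
  then tmap idfun (iter_comul D m') \o comul else idfun.

Definition nconilpotent (D : ncoalgebra k) :=
  forall d : D, exists m, (1 <= m)%N /\ iter_comul D m d = 0.

Variables (C : coalgebra k) (gamma : coaugmentation C).

Let D := coker gamma.
Let q : {linear C -> D} := coker_pi gamma.

Lemma coaug_comul (a : k^o) : comul (gamma a) = gamma a ⊗ gamma 1.
Proof. by rewrite coalg_comul tmapE. Qed.

Lemma quot_comul_subproof (a : k^o) : (tmap q q \o comul) (gamma a) = 0.
Proof.
have q0 : q (gamma a) = 0.
  by rewrite -(linear0 q); apply/coker_pi_eq; exists a; rewrite subr0.
by rewrite /= coaug_comul tmapE q0 linear0l.
Qed.
Definition quot_comul : {linear D -> tensor D D} := coker_lift quot_comul_subproof.

Lemma quot_comulE c : quot_comul (q c) = tmap q q (comul c).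
Proof. exact: coker_liftE. Qed.

Lemma quot_comulA d :
  tassoc (tmap quot_comul idfun (quot_comul d)) =
  tmap idfun quot_comul (quot_comul d).
Proof.
have [c <-] : exists c, q c = d by apply: coker_pi_surj.
have E : (quot_comul \o q : {linear C -> _}) = tmap q q \o comul.
  by apply: linear_ext => x; apply: quot_comulE.
rewrite quot_comulE !tmap_comp E.
have -> : (idfun \o q : {linear C -> D}) = q \o idfun by apply: linear_ext.
rewrite -(tmap_comp (tmap q q) _ q) -(tmap_comp q _ (tmap q q)) tassoc_nat.
by rewrite comulA.
Qed.

(* The noncounital coalgebra C / gamma(k). *)
Definition coaug_quotient : ncoalgebra k := NCoalgebra quot_comulA.

Definition conilpotent := nconilpotent coaug_quotient.

End Conilpotent.

Section FunctionalPairing.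
Variable k : fieldType.
Implicit Types U V W : lmodType k.

Section Def.
Variables (U V : lmodType k) (f : {linear V -> k^o}) (g : {linear U -> k^o}).

Lemma fpair_linearl (v : V) : linear (fun u : U => f v * g u : k^o).
Proof. by move=> a u u'; rewrite linearP mulrDr mulrCA. Qed.
Lemma fpair_linearr (u : U) : linear (fun v : V => f v * g u : k^o).
Proof. by move=> a v v'; rewrite linearP mulrDl -mulrA. Qed.
Definition fpair : tensor U V -> k^o := tlift (mkbil fpair_linearl fpair_linearr).
HB.instance Definition _ := GRing.Linear.copy fpair (tlift _).

Lemma fpairE u v : fpair (u ⊗ v) = f v * g u.
Proof. exact: tliftE. Qed.

End Def.

Lemma fpair_tmapl U U' V (f : {linear V -> k^o}) (g : {linear U' -> k^o})
    (a : {linear U -> U'}) x : fpair f (g \o a) x = fpair f g (tmap a idfun x).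
Proof.
apply: (tensor_ext (f := fpair f (g \o a)) (g := fpair f g \o tmap a idfun)) => u v /=.
by rewrite tmapE !fpairE.
Qed.
Lemma fpair_tmapr U V V' (f : {linear V' -> k^o}) (g : {linear U -> k^o})
    (b : {linear V -> V'}) x : fpair (f \o b) g x = fpair f g (tmap idfun b x).
Proof.
apply: (tensor_ext (f := fpair (f \o b) g) (g := fpair f g \o tmap idfun b)) => u v /=.
by rewrite tmapE !fpairE.
Qed.

Lemma fpair_assoc U V W (f : {linear W -> k^o}) (g : {linear V -> k^o})
    (h : {linear U -> k^o}) x :
  fpair f (fpair g h) x = fpair (fpair f g) h (tassoc x).
Proof.
apply: (tensor_ext3 (f := fpair f (fpair g h))
                    (g := fpair (fpair f g) h \o @tassoc _ _ _ _)) => u v w /=.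
by rewrite tassocE !fpairE /= !fpairE mulrA.
Qed.

End FunctionalPairing.

Definition dual (k : fieldType) (C : coalgebra k) := {linear C -> k^o}.

Section DualAlgebra.
Variables (k : fieldType) (C : coalgebra k).

HB.instance Definition _ := GRing.Lmodule.on (dual C).

Implicit Types f g h : dual C.

(* (f g)(c) = f(c_(2)) g(c_(1)) *)
Definition dual_mul f g : dual C := fpair f g \o comul.
Definition dual_one : dual C := counit.

Lemma dual_mulA : associative dual_mul.
Proof.
move=> f g h; apply: linear_ext => c /=.
by rewrite fpair_tmapl fpair_tmapr fpair_assoc comulA.
Qed.
Lemma dual_mul1l : left_id dual_one dual_mul.
Proof.
move=> f; apply: linear_ext => c /=; rewrite -[RHS](congr1 f (counitr c)).
apply: (tensor_ext (f := fpair counit f)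
  (g := f \o (@tunitr _ _ \o tmap idfun counit))) => x y /=.
by rewrite tmapE fpairE tunitrE linearZ.
Qed.
Lemma dual_mul1r : right_id dual_one dual_mul.
Proof.
move=> f; apply: linear_ext => c /=; rewrite -[RHS](congr1 f (counitl c)).
apply: (tensor_ext (f := fpair f counit)
  (g := f \o (@tunitl _ _ \o tmap counit idfun))) => x y /=.
by rewrite tmapE fpairE tunitlE linearZ mulrC.
Qed.
Lemma dual_mulDl : left_distributive dual_mul +%R.
Proof.
move=> f g h; apply: linear_ext => c /=.
apply: (tensor_ext (f := fpair (f + g) h) (g := fpair f h \+ fpair g h)) => x y /=.
by rewrite !fpairE mulrDl.
Qed.
Lemma dual_mulDr : right_distributive dual_mul +%R.
Proof.
move=> f g h; apply: linear_ext => c /=.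
apply: (tensor_ext (f := fpair f (g + h)) (g := fpair f g \+ fpair f h)) => x y /=.
by rewrite !fpairE mulrDr.
Qed.
HB.instance Definition _ := GRing.Zmodule_isPzRing.Build (dual C)
  dual_mulA dual_mul1l dual_mul1r dual_mulDl dual_mulDr.

End DualAlgebra.

Record comodule (k : fieldType) (C : coalgebra k) := Comodule {
  comod_space :> lmodType k;
  coact : {linear comod_space -> tensor C comod_space};
  coactA : forall m, tassoc (tmap comul idfun (coact m)) = tmap idfun coact (coact m);
  coact_counit : forall m, tunitl (tmap counit idfun (coact m)) = m
}.

Arguments coact {k C c} : rename.

(* For g : C (x) C -> P, the corresponding map C -> Hom(C, P) sends v to the map
   u |-> g (u (x) v). *)
Section Curry.
Variables (k : fieldType) (U V W : lmodType k) (g : {linear tensor U V -> W}).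

Lemma tcurry1_linear (v : V) : linear (fun u : U => g (u ⊗ v)).
Proof. by move=> a u u'; rewrite linearPl linearP. Qed.
Definition tcurry1 v : {linear U -> W} := mklin (tcurry1_linear v).
Lemma tcurry_linear : linear tcurry1.
Proof.
by move=> a v v'; apply: linear_ext => u /=; rewrite /lin_of linearPr linearP.
Qed.
Definition tcurry : {linear V -> {linear U -> W}} := mklin tcurry_linear.

Lemma tcurryE u v : tcurry v u = g (u ⊗ v). Proof. by []. Qed.

End Curry.

Record contramodule (k : fieldType) (C : coalgebra k) := Contramodule {
  contra_space :> lmodType k;
  contract : {linear {linear C -> contra_space} -> contra_space};
  contractA : forall g : {linear tensor C C -> contra_space},
    contract (contract \o tcurry g) = contract (g \o comul);
  contract_counit : forall p : contra_space, contract (lin_scalar p \o counit) = p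
}.
Arguments contract {k C c} : rename.

(* An additive category of abelian groups with structure, whose morphisms are
   determined by the underlying additive maps. It is used for modules, comodules
   and contramodules over a coalgebra over a field, where kernels and cokernels
   are computed on the underlying groups: exactness is therefore stated there. *)
Record addcat := AddCat {
  obj :> Type;
  car : obj -> zmodType;
  hom : obj -> obj -> Type;
  app : forall {A B}, hom A B -> {additive car A -> car B};
  app_inj : forall A B (f g : hom A B), app f =1 app g -> f = g;
  idm : forall A, hom A A;
  app_idm : forall A, app (idm A) =1 id;
  comp : forall {A B C}, hom B C -> hom A B -> hom A C;
  app_comp : forall A B C (g : hom B C) (f : hom A B), app (comp g f) =1 app g \o app f;
  addm : forall {A B}, hom A B -> hom A B -> hom A B;
  app_addm : forall A B (f g : hom A B), app (addm f g) =1 app f \+ app g;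
  dsum : obj -> obj -> obj;
  inlm : forall A B, hom A (dsum A B);
  inrm : forall A B, hom B (dsum A B);
  prlm : forall A B, hom (dsum A B) A;
  prrm : forall A B, hom (dsum A B) B;
  prl_inl : forall A B, comp (prlm A B) (inlm A B) = idm A;
  prr_inr : forall A B, comp (prrm A B) (inrm A B) = idm B;
  dsum_id : forall A B,
    addm (comp (inlm A B) (prlm A B)) (comp (inrm A B) (prrm A B)) = idm (dsum A B)
}.
Arguments app {a A B} : rename.
Arguments idm {a} A : rename.
Arguments comp {a A B C} : rename.
Arguments addm {a A B} : rename.
Arguments dsum {a} : rename.
Arguments inlm {a A B} : rename.
Arguments inrm {a A B} : rename.
Arguments prlm {a A B} : rename.
Arguments prrm {a A B} : rename.

Section Yoneda.
Variable K : addcat.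
Implicit Types A B X Z : K.

Definition is_ses B X A (i : hom B X) (p : hom X A) : Prop :=
  [/\ injective (app i), (forall a, exists x, app p x = a) &
      forall x, app p x = 0 <-> exists b, app i b = x].

(* A short exact sequence 0 -> B -> ses_mid -> A -> 0 *)
Record ses A B := Ses {
  ses_mid : K;
  ses_inj : hom B ses_mid;
  ses_sur : hom ses_mid A;
  ses_exact : is_ses ses_inj ses_sur
}.

(* An exact sequence 0 -> B -> X_(n+1) -> ... -> X_1 -> A -> 0, cut into n + 1
   short exact sequences at the images of its maps. *)
Fixpoint exseq (n : nat) A B : Type :=
  if n is n'.+1 then {Z : K & (ses A Z * exseq n' Z B)%type} else ses A B.

Definition yext (n : nat) A B : Type :=
  if n is n'.+1 then exseq n' A B else hom A B.

(* There is a morphism of extensions inducing g : A -> A' and f : B -> B'. *)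
Definition ses_mor A B A' B' (S : ses A B) (S' : ses A' B')
    (g : hom A A') (f : hom B B') : Prop :=
  exists h : hom (ses_mid S) (ses_mid S'),
    comp h (ses_inj S) = comp (ses_inj S') f /\
    comp (ses_sur S') h = comp g (ses_sur S).

Fixpoint exseq_mor n A B A' B' :
    exseq n A B -> exseq n A' B' -> hom A A' -> hom B B' -> Prop :=
  match n with
  | 0 => fun S S' g f => ses_mor S S' g f
  | n'.+1 => fun E E' g f =>
      exists z : hom (projT1 E) (projT1 E'),
        ses_mor (projT2 E).1 (projT2 E').1 g z /\
        exseq_mor (projT2 E).2 (projT2 E').2 z f
  end.

Definition yext_mor n A B A' B' :
    yext n A B -> yext n A' B' -> hom A A' -> hom B B' -> Prop :=
  match n with
  | 0 => fun u u' g f => comp f u = comp u' g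
  | n'.+1 => fun E E' g f => exseq_mor E E' g f
  end.

Definition yext_equiv n A B : relation (yext n A B) :=
  clos_refl_sym_trans _ (fun E E' => yext_mor E E' (idm A) (idm B)).

Definition Ext n A B :=
  {S : yext n A B -> Prop | exists E, S = yext_equiv E}.

Definition Ext_class n A B (E : yext n A B) : Ext n A B :=
  exist _ (yext_equiv E) (ex_intro _ E erefl).

Definition dmap A B A' B' (f : hom A A') (g : hom B B') : hom (dsum A B) (dsum A' B') :=
  addm (comp inlm (comp f prlm)) (comp inrm (comp g prrm)).

Lemma app_dsum_id A B (x : car (dsum A B)) :
  app inlm (app prlm x) + app inrm (app prrm x) = x.
Proof.
by rewrite -[RHS](app_idm (a := K)) -dsum_id app_addm /= !app_comp.
Qed.
Lemma app_prl_inl A B (x : car A) : app (prlm (B := B)) (app inlm x) = x.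
Proof. by have := app_comp (prlm (B := B)) inlm x; rewrite prl_inl app_idm. Qed.
Lemma app_prr_inr A B (x : car B) : app (prrm (A := A)) (app inrm x) = x.
Proof. by have := app_comp (prrm (A := A)) inrm x; rewrite prr_inr app_idm. Qed.
Lemma app_prl_inr A B (x : car B) : app (prlm (A := A)) (app inrm x) = 0.
Proof.
have := app_dsum_id (app (inrm (A := A)) x); rewrite app_prr_inr.
move=> /(congr1 (app prlm)); rewrite raddfD app_prl_inl => /eqP.
by rewrite -subr_eq0 addrK => /eqP.
Qed.
Lemma app_prr_inl A B (x : car A) : app (prrm (B := B)) (app inlm x) = 0.
Proof.
have := app_dsum_id (app (inlm (B := B)) x); rewrite app_prl_inl.
move=> /(congr1 (app prrm)); rewrite raddfD app_prr_inr => /eqP.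
by rewrite addrC -subr_eq0 addrK => /eqP.
Qed.

Lemma app_dsum_inj A B (x y : car (dsum A B)) :
  app prlm x = app prlm y -> app prrm x = app prrm y -> x = y.
Proof. by move=> E F; rewrite -[x]app_dsum_id -[y]app_dsum_id E F. Qed.

Lemma app_prl_dmap A B A' B' (f : hom A A') (g : hom B B') x :
  app prlm (app (dmap f g) x) = app f (app prlm x).
Proof.
by rewrite app_addm /= !app_comp /= !app_comp /= raddfD app_prl_inl app_prl_inr addr0.
Qed.
Lemma app_prr_dmap A B A' B' (f : hom A A') (g : hom B B') x :
  app prrm (app (dmap f g) x) = app g (app prrm x).
Proof.
by rewrite app_addm /= !app_comp /= !app_comp /= raddfD app_prr_inl app_prr_inr add0r.
Qed.

Lemma dsum_is_ses A B A' B' (S : ses A B) (S' : ses A' B') :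
  is_ses (dmap (ses_inj S) (ses_inj S')) (dmap (ses_sur S) (ses_sur S')).
Proof.
case: S S' => [X i p [iI pS ex]] [X' i' p' [iI' pS' ex']] /=; split.
- move=> x y E; apply: app_dsum_inj.
    by apply: iI; rewrite -!(app_prl_dmap i i') E.
  by apply: iI'; rewrite -!(app_prr_dmap i i') E.
- move=> a; have [x E] := pS (app prlm a); have [x' E'] := pS' (app prrm a).
  exists (app inlm x + app inrm x'); apply: app_dsum_inj.
    by rewrite app_prl_dmap raddfD app_prl_inl app_prl_inr addr0.
  by rewrite app_prr_dmap raddfD app_prr_inl app_prr_inr add0r.
- move=> x; split=> [E | [b <-]].
    have [b F] : exists b, app i b = app prlm x.
      by apply/ex; rewrite -(app_prl_dmap p p') E raddf0.
    have [b' F'] : exists b, app i' b = app prrm x.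
      by apply/ex'; rewrite -(app_prr_dmap p p') E raddf0.
    exists (app inlm b + app inrm b'); apply: app_dsum_inj.
      by rewrite app_prl_dmap raddfD app_prl_inl app_prl_inr addr0.
    by rewrite app_prr_dmap raddfD app_prr_inl app_prr_inr add0r.
  apply: app_dsum_inj; rewrite raddf0.
    by rewrite !app_prl_dmap; apply/ex; eexists.
  by rewrite !app_prr_dmap; apply/ex'; eexists.
Qed.
Definition ses_dsum A B A' B' (S : ses A B) (S' : ses A' B') :=
  Ses (dsum_is_ses S S').

Fixpoint exseq_dsum n A B A' B' :
    exseq n A B -> exseq n A' B' -> exseq n (dsum A A') (dsum B B') :=
  match n with
  | 0 => fun S S' => ses_dsum S S'
  | n'.+1 => fun E E' => existT _ (dsum (projT1 E) (projT1 E'))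
      (ses_dsum (projT2 E).1 (projT2 E').1, exseq_dsum (projT2 E).2 (projT2 E').2)
  end.

Definition yext_dsum n A B A' B' :
    yext n A B -> yext n A' B' -> yext n (dsum A A') (dsum B B') :=
  match n with
  | 0 => fun u u' => dmap u u'
  | n'.+1 => fun E E' => exseq_dsum E E'
  end.

(* The vector space operations on Ext are relations between representatives.
   Here [E'] = f_* [E]. *)
Definition yext_push n A B B' (f : hom B B') (E : yext n A B) (E' : yext n A B') :=
  exists F, yext_mor E F (idm A) f /\ yext_equiv F E'.

(* [E'] = g^* [E] *)
Definition yext_pull n A A' B (g : hom A' A) (E : yext n A B) (E' : yext n A' B) :=
  exists F, yext_mor F E g (idm B) /\ yext_equiv F E'.

(* Baer sum: [E] = [E1] + [E2] is the pushforward along the codiagonal of the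
   pullback along the diagonal of the direct sum of E1 and E2 *)
Definition yext_add n A B (E1 E2 E : yext n A B) :=
  exists F : yext n A (dsum B B),
    yext_pull (addm inlm inrm) (yext_dsum E1 E2) F /\ yext_push (addm prlm prrm) F E.

(* [E] is the linear combination of the classes in s, the scalar c acting on Ext
   through the endomorphism [mu c] of B *)
Fixpoint yext_lincomb (k : fieldType) n A B (mu : k -> hom B B)
    (s : seq (k * yext n A B)) (E : yext n A B) : Prop :=
  match s with
  | [::] => yext_push (mu 0) E E
  | (c, E0) :: s' => exists F G,
      [/\ yext_push (mu c) E0 F, yext_lincomb mu s' G & yext_add F G E]
  end.

Definition Ext_finite_dim (k : fieldType) n A B (mu : k -> hom B B) : Prop :=
  exists es : seq (yext n A B), forall E, exists cs : seq k,
    size cs = size es /\ yext_lincomb mu (zip cs es) E.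

Definition projective (P : K) : Prop :=
  forall A B (p : hom A B) (f : hom P B), (forall b, exists a, app p a = b) ->
    exists g : hom P A, comp p g = f.

End Yoneda.

Record exact_functor (K L : addcat) := ExactFunctor {
  fobj :> K -> L;
  fmap : forall A B, hom A B -> hom (fobj A) (fobj B);
  fmap_idm : forall A, fmap (idm A) = idm (fobj A);
  fmap_comp : forall A B C (g : hom B C) (f : hom A B),
    fmap (comp g f) = comp (fmap g) (fmap f);
  fmap_addm : forall A B (f g : hom A B), fmap (addm f g) = addm (fmap f) (fmap g);
  fmap_ses : forall A X B (i : hom B X) (p : hom X A),
    is_ses i p -> is_ses (fmap i) (fmap p)
}.
Arguments fmap {K L} e {A B} : rename.

Section ExtMap.
Variables (K L : addcat) (F : exact_functor K L).
Implicit Types A B : K.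

Definition ses_map A B (S : ses A B) : ses (F A) (F B) :=
  Ses (fmap_ses F (ses_exact S)).

Fixpoint exseq_map n A B : exseq n A B -> exseq n (F A) (F B) :=
  match n with
  | 0 => fun S => ses_map S
  | n'.+1 => fun E =>
      existT _ (F (projT1 E)) (ses_map (projT2 E).1, exseq_map (projT2 E).2)
  end.

Definition yext_map n A B : yext n A B -> yext n (F A) (F B) :=
  match n with
  | 0 => fun u => fmap F u
  | n'.+1 => fun E => exseq_map E
  end.

Lemma exseq_map_mor n A B A' B' (E : exseq n A B) (E' : exseq n A' B') g f :
  exseq_mor E E' g f -> exseq_mor (exseq_map E) (exseq_map E') (fmap F g) (fmap F f).
Proof.
have M A1 B1 A2 B2 (S : ses A1 B1) (S' : ses A2 B2) u v :
    ses_mor S S' u v -> ses_mor (ses_map S) (ses_map S') (fmap F u) (fmap F v).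
  by move=> [h [E1 E2]]; exists (fmap F h); rewrite /= -!fmap_comp E1 E2.
elim: n A B A' B' E E' g f => [|n IH] A B A' B' E E' g f /=; first exact: M.
by move=> [z [H1 H2]]; exists (fmap F z); split; [apply: M | apply: IH].
Qed.

Lemma yext_map_equiv n A B (E E' : yext n A B) :
  yext_equiv E E' -> yext_equiv (yext_map E) (yext_map E').
Proof.
elim=> [{}E {}E'|{}E|{}E {}E' _|E1 E2 E3 _ H1 _ H2]; last first.
- exact: rst_trans H1 H2.
- exact: rst_sym.
- exact: rst_refl.
case: n E E' => [|n] E E' H; apply: rst_step; rewrite -!fmap_idm.
  by rewrite /= -!fmap_comp; congr fmap.
exact: exseq_map_mor.
Qed.

Lemma Ext_map_subproof n A B (S : Ext n A B) : exists E0,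
  (fun E' => exists E, sval S E /\ yext_equiv (yext_map E) E') = yext_equiv E0.
Proof.
case: S => S [E0 SE] /=; subst S; exists (yext_map E0); apply/funext => E'; apply/propext.
split=> [[E [H1 H2]]|H]; last by exists E0; split=> //; apply: rst_refl.
by apply: rst_trans H2; apply: yext_map_equiv.
Qed.

(* The class of E goes to the class of F(E), see [Ext_map_class]. *)
Definition Ext_map n A B (S : Ext n A B) : Ext n (F A) (F B) :=
  exist _ _ (Ext_map_subproof S).

Lemma Ext_map_class n A B (E : yext n A B) :
  Ext_map (Ext_class E) = Ext_class (yext_map E).
Proof.
apply: eq_exist; apply/funext => E'; apply/propext => /=.
split=> [[E0 [H1 H2]]|H]; last by exists E; split=> //; apply: rst_refl.
by apply: rst_trans H2; apply: yext_map_equiv.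
Qed.

End ExtMap.

Section ProductMaps.
Variables (R : pzRingType) (U V : lmodType R).

Lemma lin_inl_linear : linear (fun u : U => (u, 0) : (U * V)%type).
Proof. by move=> a u u'; congr pair; rewrite /= scaler0 addr0. Qed.
Definition lin_inl : {linear U -> (U * V)%type} := mklin lin_inl_linear.
Lemma lin_inr_linear : linear (fun v : V => (0, v) : (U * V)%type).
Proof. by move=> a u u'; congr pair; rewrite /= scaler0 addr0. Qed.
Definition lin_inr : {linear V -> (U * V)%type} := mklin lin_inr_linear.

Lemma lin_inlE u : lin_inl u = (u, 0). Proof. by []. Qed.
Lemma lin_inrE v : lin_inr v = (0, v). Proof. by []. Qed.

Lemma pair_decomp (x : U * V) : (x.1, 0) + (0, x.2) = x.
Proof. by case: x => u v; congr pair; rewrite /= ?addr0 ?add0r. Qed.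

Lemma pair_linear_ext (W : lmodType R) (f g : {linear (U * V)%type -> W}) :
  (forall u, f (lin_inl u) = g (lin_inl u)) ->
  (forall v, f (lin_inr v) = g (lin_inr v)) -> f =1 g.
Proof.
move=> E F x; rewrite -[x]pair_decomp -[(x.1, 0)]/(lin_inl x.1).
by rewrite -[(0, x.2)]/(lin_inr x.2) !linearD E F.
Qed.

End ProductMaps.

Section ModuleCategory.
Variable R : pzRingType.

Definition modcat : addcat.
Proof.
refine (@AddCat (lmodType R) (fun M => M) (fun M N => {linear M -> N})
  (fun M N f => f) (fun M N f g => @linear_ext R M N f g)
  (fun M => idfun) _ (fun M N P g f => g \o f) _ (fun M N f g => f \+ g) _
  (fun M N => M * N : lmodType R)%type (@lin_inl R) (@lin_inr R)
  (fun M N => fst) (fun M N => snd) _ _ _) => //=.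
- by move=> M N; apply: linear_ext.
- by move=> M N; apply: linear_ext.
- by move=> M N; apply: linear_ext => x; apply: pair_decomp.
Defined.

End ModuleCategory.

Section ComoduleCategory.
Variables (k : fieldType) (C : coalgebra k).

Record comod_hom (M N : comodule C) := ComodHom {
  comod_fun :> {linear M -> N};
  comod_funE : forall m, coact (comod_fun m) = tmap idfun comod_fun (coact m)
}.

Lemma comod_hom_inj M N (f g : comod_hom M N) : f =1 g -> f = g.
Proof.
case: f => f cf; case: g => g cg /= /linear_ext E; subst g.
by rewrite (Prop_irrelevance cf cg).
Qed.

Lemma comod_id_subproof (M : comodule C) m :
  coact (idfun m) = tmap idfun (idfun : {linear M -> M}) (coact m).
Proof. by rewrite tmap_id. Qed.
Definition comod_id M := ComodHom (@comod_id_subproof M).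

Lemma comod_comp_subproof M N P (g : comod_hom N P) (f : comod_hom M N) m :
  coact ((g \o f) m) = tmap idfun (g \o f) (coact m).
Proof. by rewrite /= !comod_funE tmap_comp. Qed.
Definition comod_comp M N P g f := ComodHom (@comod_comp_subproof M N P g f).

Lemma comod_add_subproof M N (f g : comod_hom M N) m :
  coact ((f \+ g) m) = tmap idfun (f \+ g) (coact m).
Proof.
by rewrite /= linearD !comod_funE -[RHS]/(tmap idfun ((f : {linear _ -> _}) + g) _)
  tmap_addr.
Qed.
Definition comod_add M N f g := ComodHom (@comod_add_subproof M N f g).

Section CoactionOnImage.
Variables (M : comodule C) (X : lmodType k).
Variables (rho : {linear X -> tensor C X}) (j : {linear M -> X}).
Hypothesis rho_j : forall m, rho (j m) = tmap idfun j (coact m).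

Lemma coactA_image m :
  tassoc (tmap comul idfun (rho (j m))) = tmap idfun rho (rho (j m)).
Proof.
rewrite !rho_j !tmap_comp.
rewrite (@tmap_ext _ _ _ _ _ _ (tmap idfun idfun \o comul) _ (j \o idfun)) //; last first.
  by move=> c; rewrite /= tmap_id.
rewrite -(tmap_comp (tmap idfun idfun) comul j idfun) tassoc_nat coactA tmap_comp.
by apply: tmap_ext => // m'; rewrite /= rho_j.
Qed.

Lemma coact_counit_image m : tunitl (tmap counit idfun (rho (j m))) = j m.
Proof.
rewrite rho_j tmap_comp -[in RHS](coact_counit m) -tunitl_nat tmap_comp.
by congr tunitl; apply: tmap_ext.
Qed.

End CoactionOnImage.

Section DirectSum.
Variables M N : comodule C.

Definition comod_dsum_coact : M * N -> tensor C (M * N)%type :=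
  (tmap idfun (lin_inl M N) \o (coact \o fst)) \+
  (tmap idfun (lin_inr M N) \o (coact \o snd)).
HB.instance Definition _ := GRing.Linear.on comod_dsum_coact.

Lemma comod_dsum_coactl (m : M) :
  comod_dsum_coact (lin_inl M N m) = tmap idfun (lin_inl M N) (coact m).
Proof. by rewrite /comod_dsum_coact /= !linear0 addr0. Qed.
Lemma comod_dsum_coactr (n : N) :
  comod_dsum_coact (lin_inr M N n) = tmap idfun (lin_inr M N) (coact n).
Proof. by rewrite /comod_dsum_coact /= !linear0 add0r. Qed.

Lemma comod_dsum_coactA (x : M * N) :
  tassoc (tmap comul idfun (comod_dsum_coact x)) =
  tmap idfun comod_dsum_coact (comod_dsum_coact x).
Proof.
apply: (pair_linear_ext
    (f := @tassoc _ C C (M * N)%type \o (tmap comul idfun \o comod_dsum_coact))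
    (g := tmap idfun comod_dsum_coact \o comod_dsum_coact)).
  exact: (coactA_image (rho := comod_dsum_coact) comod_dsum_coactl).
exact: (coactA_image (rho := comod_dsum_coact) comod_dsum_coactr).
Qed.

Lemma comod_dsum_counit (x : M * N) :
  tunitl (tmap counit idfun (comod_dsum_coact x)) = x.
Proof.
apply: (pair_linear_ext (g := idfun)
    (f := @tunitl _ (M * N)%type \o (tmap counit idfun \o comod_dsum_coact))).
  exact: (coact_counit_image (rho := comod_dsum_coact) comod_dsum_coactl).
exact: (coact_counit_image (rho := comod_dsum_coact) comod_dsum_coactr).
Qed.

Definition comod_dsum : comodule C :=
  Comodule comod_dsum_coactA comod_dsum_counit.

Definition comod_inl : comod_hom M comod_dsum := 
  @ComodHom M comod_dsum (lin_inl M N) comod_dsum_coactl.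
Definition comod_inr : comod_hom N comod_dsum := 
  @ComodHom N comod_dsum (lin_inr M N) comod_dsum_coactr.

Lemma tmap_zero (U U' V V' : lmodType k) (f : {linear U -> U'}) (g : {linear V -> V'}) x :
  g =1 \0 -> tmap f g x = 0.
Proof.
move=> g0; apply: (tensor_ext (f := tmap f g) (g := \0)) => u v.
by rewrite /= tmapE g0 linear0r.
Qed.

Lemma comod_prl_subproof (x : comod_dsum) :
  coact x.1 = tmap idfun (fst : {linear comod_dsum -> M}) (coact x).
Proof.
apply: (pair_linear_ext (f := coact \o fst)
  (g := tmap idfun (fst : {linear (M * N)%type -> M}) \o comod_dsum_coact)) => y.
  rewrite [RHS](congr1 (tmap _ _) (comod_dsum_coactl y)) tmap_comp /=.
  by rewrite (@tmap_ext _ _ _ _ _ _ idfun _ idfun) // tmap_id.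
rewrite [RHS](congr1 (tmap _ _) (comod_dsum_coactr y)) tmap_comp tmap_zero //=.
by rewrite linear0.
Qed.
Definition comod_prl : comod_hom comod_dsum M :=
  @ComodHom comod_dsum M fst comod_prl_subproof.

Lemma comod_prr_subproof (x : comod_dsum) :
  coact x.2 = tmap idfun (snd : {linear comod_dsum -> N}) (coact x).
Proof.
apply: (pair_linear_ext (f := coact \o snd)
  (g := tmap idfun (snd : {linear (M * N)%type -> N}) \o comod_dsum_coact)) => y.
  rewrite [RHS](congr1 (tmap _ _) (comod_dsum_coactl y)) tmap_comp tmap_zero //=.
  by rewrite linear0.
rewrite [RHS](congr1 (tmap _ _) (comod_dsum_coactr y)) tmap_comp /=.
by rewrite (@tmap_ext _ _ _ _ _ _ idfun _ idfun) // tmap_id.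
Qed.
Definition comod_prr : comod_hom comod_dsum N :=
  @ComodHom comod_dsum N snd comod_prr_subproof.

End DirectSum.

Definition comodcat : addcat.
Proof.
refine (@AddCat (comodule C) (fun M => M) comod_hom (fun M N f => f)
  comod_hom_inj comod_id _ comod_comp _ comod_add _
  comod_dsum comod_inl comod_inr comod_prl comod_prr _ _ _) => //=.
- by move=> M N; apply: comod_hom_inj.
- by move=> M N; apply: comod_hom_inj.
- by move=> M N; apply: comod_hom_inj => x; apply: pair_decomp.
Defined.

Lemma comod_scale_subproof (M : comodule C) (a : k) (m : M) :
  coact (lin_scale a (@idfun M) m) = tmap idfun (lin_scale a (@idfun M)) (coact m).
Proof.
have -> : coact (lin_scale a (@idfun M) m) = a *: coact m by rewrite -linearZ.
apply: (tensor_ext (f := lin_scale a (@idfun (tensor C M)))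
  (g := tmap idfun (lin_scale a (@idfun M)))) => u v.
by rewrite /= tmapE [RHS]linearZr_LR.
Qed.
Definition comod_scale (M : comodule C) (a : k) : comod_hom M M :=
  ComodHom (comod_scale_subproof a).

End ComoduleCategory.

Section ContramoduleCategory.
Variables (k : fieldType) (C : coalgebra k).

Record contra_hom (P Q : contramodule C) := ContraHom {
  contra_fun :> {linear P -> Q};
  contra_funE : forall g : {linear C -> P},
    contra_fun (contract g) = contract (contra_fun \o g)
}.

Lemma contra_hom_inj P Q (f g : contra_hom P Q) : f =1 g -> f = g.
Proof.
case: f => f cf; case: g => g cg /= /linear_ext E; subst g.
by rewrite (Prop_irrelevance cf cg).
Qed.

Lemma contra_id_subproof (P : contramodule C) (g : {linear C -> P}) :
  idfun (contract g) = contract (idfun \o g).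
Proof. by rewrite /=; congr (contract _); apply: linear_ext. Qed.
Definition contra_id P := ContraHom (@contra_id_subproof P).

Lemma contra_comp_subproof P Q S (g : contra_hom Q S) (f : contra_hom P Q)
    (h : {linear C -> P}) :
  (g \o f) (contract h) = contract ((g \o f) \o h).
Proof. by rewrite /= !contra_funE; congr (contract _); apply: linear_ext. Qed.
Definition contra_comp P Q S g f := ContraHom (@contra_comp_subproof P Q S g f).

Lemma contra_add_subproof P Q (f g : contra_hom P Q) (h : {linear C -> P}) :
  (f \+ g) (contract h) = contract ((f \+ g) \o h).
Proof. by rewrite /= !contra_funE -linearD; congr (contract _); apply: linear_ext. Qed.
Definition contra_add P Q f g := ContraHom (@contra_add_subproof P Q f g).

Section DirectSum.
Variables P Q : contramodule C.

Definition contra_dsum_fun (g : {linear C -> (P * Q)%type}) : P * Q :=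
  (contract (fst \o g), contract (snd \o g)).
Lemma contra_dsum_linear : linear contra_dsum_fun.
Proof.
move=> a g h; rewrite /contra_dsum_fun; congr pair; rewrite /= -linearP;
  by congr (contract _); apply: linear_ext.
Qed.
Definition contra_dsum_contract : {linear {linear C -> (P * Q)%type} -> (P * Q)%type} :=
  mklin contra_dsum_linear.

Lemma contra_dsum_contractA (g : {linear tensor C C -> (P * Q)%type}) :
  contra_dsum_contract (contra_dsum_contract \o tcurry g) =
  contra_dsum_contract (g \o comul).
Proof.
rewrite /= /lin_of /contra_dsum_fun; congr pair.
  transitivity (contract ((fst \o g) \o comul : {linear C -> P})); last first.
    by congr (contract _); apply: linear_ext.
  rewrite -(contractA (fst \o g)).
  by congr (contract _); apply: linear_ext => c /=; congr (contract _); apply: linear_ext.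
transitivity (contract ((snd \o g) \o comul : {linear C -> Q})); last first.
  by congr (contract _); apply: linear_ext.
rewrite -(contractA (snd \o g)).
by congr (contract _); apply: linear_ext => c /=; congr (contract _); apply: linear_ext.
Qed.

Lemma contra_dsum_counit (x : (P * Q)%type) :
  contra_dsum_contract (lin_scalar x \o counit) = x.
Proof.
case: x => p q; rewrite /= /lin_of /contra_dsum_fun; congr pair.
  by rewrite -[RHS]contract_counit; congr (contract _); apply: linear_ext.
by rewrite -[RHS]contract_counit; congr (contract _); apply: linear_ext.
Qed.

Definition contra_dsum : contramodule C :=
  Contramodule contra_dsum_contractA contra_dsum_counit.

Lemma contra_inl_subproof (g : {linear C -> P}) :
  lin_inl P Q (contract g) = contract (lin_inl P Q \o g : {linear C -> contra_dsum}).
Proof.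
congr pair; first by congr (contract _); apply: linear_ext.
by rewrite -[LHS](linear0 contract); congr (contract _); apply: linear_ext.
Qed.
Definition contra_inl : contra_hom P contra_dsum := 
  @ContraHom P contra_dsum (lin_inl P Q) contra_inl_subproof.

Lemma contra_inr_subproof (g : {linear C -> Q}) :
  lin_inr P Q (contract g) = contract (lin_inr P Q \o g : {linear C -> contra_dsum}).
Proof.
congr pair; last by congr (contract _); apply: linear_ext.
by rewrite -[LHS](linear0 contract); congr (contract _); apply: linear_ext.
Qed.
Definition contra_inr : contra_hom Q contra_dsum := 
  @ContraHom Q contra_dsum (lin_inr P Q) contra_inr_subproof.

Definition contra_prl : contra_hom contra_dsum P :=
  @ContraHom contra_dsum P fst (fun=> erefl).
Definition contra_prr : contra_hom contra_dsum Q :=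
  @ContraHom contra_dsum Q snd (fun=> erefl).

End DirectSum.

Definition contracat : addcat.
Proof.
refine (@AddCat (contramodule C) (fun P => P) contra_hom (fun P Q f => f)
  contra_hom_inj contra_id _ contra_comp _ contra_add _
  contra_dsum contra_inl contra_inr contra_prl contra_prr _ _ _) => //=.
- by move=> P Q; apply: contra_hom_inj.
- by move=> P Q; apply: contra_hom_inj.
- by move=> P Q; apply: contra_hom_inj => x; apply: pair_decomp.
Defined.

End ContramoduleCategory.

Section Forgetful.
Variables (k : fieldType) (C : coalgebra k).

Section Action.
Variable P : contramodule C.

Definition dual_module : Type := P.
HB.instance Definition _ := GRing.Zmodule.on dual_module.

(* C^* (x) P -> Hom(C, P) -> P *)
Definition dual_act (f : dual C) (p : dual_module) : dual_module :=
  contract (lin_scalar (p : P) \o f).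

Lemma dual_actA f g p : dual_act f (dual_act g p) = dual_act (f * g) p.
Proof.
rewrite /dual_act.
transitivity (contract ((lin_scalar (p : P) \o fpair f g) \o comul : {linear C -> P}));
  last by congr (contract _); apply: linear_ext.
rewrite -contractA; congr (contract _); apply: linear_ext => c.
rewrite /= -[LHS]linearZ; congr (contract _); apply: linear_ext => c'.
rewrite -[RHS]/(fpair f g (c' ⊗ c) *: (p : P)) fpairE -scalerA.
by [].
Qed.
Lemma dual_act1 : left_id 1 dual_act.
Proof. exact: contract_counit. Qed.
Lemma dual_actDr : right_distributive dual_act +%R.
Proof.
move=> f p q; rewrite /dual_act -linearD; congr (contract _).
by apply: linear_ext => c; apply: scalerDr.
Qed.
Lemma dual_actDl p : {morph dual_act^~ p : f g / f + g}.
Proof.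
move=> f g; rewrite /dual_act -linearD; congr (contract _).
by apply: linear_ext => c; apply: scalerDl.
Qed.
HB.instance Definition _ := GRing.Zmodule_isLmodule.Build (dual C) dual_module
  dual_actA dual_act1 dual_actDr dual_actDl.

End Action.

Definition Theta_obj (P : contramodule C) : lmodType (dual C) := dual_module P.

Lemma Theta_map_linear P Q (f : contra_hom P Q) :
  linear (f : Theta_obj P -> Theta_obj Q).
Proof.
move=> a p q; rewrite [LHS]linearD; congr (_ + _).
rewrite [LHS]contra_funE; congr (contract _); apply: linear_ext => c.
exact: linearZ.
Qed.
Definition Theta_map P Q (f : contra_hom P Q) : {linear Theta_obj P -> Theta_obj Q} :=
  mklin (Theta_map_linear f).

Definition Theta : exact_functor (contracat C) (modcat (dual C)).
Proof.
refine (@ExactFunctor (contracat C) (modcat (dual C)) Theta_obj Theta_map _ _ _ _).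
- by move=> P; apply: linear_ext.
- by move=> P Q S g f; apply: linear_ext.
- by move=> P Q f g; apply: linear_ext.
- by [].
Defined.

End Forgetful.

Definition Ext_Theta (k : fieldType) (C : coalgebra k) (n : nat)
    (P Q : contramodule C) :
    @Ext (contracat C) n P Q -> @Ext (modcat (dual C)) n (Theta C P) (Theta C Q) :=
  @Ext_map _ _ (Theta C) n P Q.

Section Trivial.
Variables (k : fieldType) (C : coalgebra k) (gamma : coaugmentation C).
Variable T : lmodType k.

(* t |-> gamma(1) (x) t *)
Definition triv_coact : {linear T -> tensor C T} :=
  mklin (@tpure_linearr k C T (gamma 1)).
Lemma triv_coactE t : triv_coact t = gamma 1 ⊗ t. Proof. by []. Qed.

Lemma triv_coactA t :
  tassoc (tmap comul idfun (triv_coact t)) = tmap idfun triv_coact (triv_coact t).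
Proof. by rewrite !triv_coactE !tmapE coaug_comul tassocE. Qed.
Lemma triv_coact_counit t : tunitl (tmap counit idfun (triv_coact t)) = t.
Proof. by rewrite triv_coactE tmapE tunitlE coalg_counit /= scale1r. Qed.

Definition triv_comodule : comodule C := Comodule triv_coactA triv_coact_counit.

(* Hom(C, T) -> Hom(k, T) = T *)
Lemma triv_contract_linear : linear (fun g : {linear C -> T} => (g \o gamma) 1).
Proof. by []. Qed.
Definition triv_contract : {linear {linear C -> T} -> T} := mklin triv_contract_linear.

Lemma triv_contractA (g : {linear tensor C C -> T}) :
  triv_contract (triv_contract \o tcurry g) = triv_contract (g \o comul).
Proof. by rewrite /= /lin_of /= coaug_comul. Qed.
Lemma triv_contract_counit (t : T) : triv_contract (lin_scalar t \o counit) = t.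
Proof. by rewrite -[LHS]/(counit (gamma 1) *: t) coalg_counit; apply: scale1r. Qed.

Definition triv_contramodule : contramodule C :=
  Contramodule triv_contractA triv_contract_counit.

End Trivial.

Definition finite_dim (k : fieldType) (V : lmodType k) : Prop :=
  exists n (e : 'I_n -> V), forall v, exists c : 'I_n -> k, v = \sum_(i < n) c i *: e i.

Definition comod_Ext_finite_dim (k : fieldType) (C : coalgebra k) (n : nat)
    (M N : comodule C) : Prop :=
  @Ext_finite_dim (comodcat C) k n M N (@comod_scale k C N).

(* Main.v *)
Require Import Defs.
From HB Require Import structures.
From Stdlib Require Import Relations.
From mathcomp Require Import all_boot all_algebra.
From mathcomp Require Import boolp classical_sets zify.
Import Defs.

(* Let 0 -> M_j -> C (x) V_j -> M_(j+1) -> 0, M_0 = k, be the minimal coresolution of the left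
comodule k. Its terms M_j have socle V_j = Ext^j_C(k, k), so V_j is finite-dimensional for j < n
and V_n is not. Let N_i be the syzygies of the coresolution N_i -> N_i (x) C of the right
comodule k; a dimension shift in the complex N_i (x) M_j shows that its n-th cohomology
soc(N_n) / d(N_(n-1)) is infinite-dimensional too.

Injectivity fails: the contramodules Hom(N_i (x) C, T) form a projective resolution of T with
syzygies Hom(N_i, T). As T and the cohomology are infinite-dimensional, there is a nonzero class
in Ext^(C,n)(T, k) given by a functional f on Hom(N_n, T) which depends only on the restriction
of maps to soc(N_n) and kills those of finite rank. Maps of finite rank N_i -> T form an exact
sequence of C^*-modules ending in T (finite rank is preserved by the linear retraction of
N_i -> N_i (x) C), on which f vanishes; so the class dies over C^*.

Surjectivity fails for P = Hom(C, T): the double duals (C (x) V_j)^** with V_j finite-dimensional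
are injective C^*-modules, hence Ext^(n-1)(P, k) over C^* consists of the maps P -> M_(n-1)^**
modulo those which lift to (C (x) V_(n-2))^**. Given a functional f on Hom(M_n, T) of the same
kind, extend it to B on Hom(C (x) V_(n-1), T) and put s(h)(mu) = B(mu * h). If s lifted, or for
n = 1 came from a contramodule map, then f = 0 by expanding in a finite frame of V_(n-1). On the
contramodule side all extensions of the projective P are equivalent. *)

Set Implicit Arguments.
Unset Strict Implicit.
Unset Printing Implicit Defensive.

Import GRing.Theory.

Local Open Scope ring_scope.

(** * Linear algebra *)

(** The forgetful functor loses information because [dual C] acts on a contramodule only through
    maps from C of finite rank, whereas [contract] takes all linear maps. Both halves exploit this
    gap by a functional that vanishes on maps of finite rank. Such a functional can be nonzero only
    if source and target are both infinite-dimensional, which is where T and the degree n enter.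
    Right comodules appear because Hom(N, T) is a left contramodule when N is a right comodule,
    whereas the infinite-dimensional space of the theorem comes from left comodules. The bicomplex
    of the N_i and M_j carries the information from one side to the other. Double duals appear
    because extending a map to the double dual of C ⊗ V, for V finite-dimensional, amounts to
    extending finitely many functionals over k. The second half is not deduced from the first
    through a long exact sequence. It is a separate construction with an explicit P, which shares
    with the first only the kind of functional. Yoneda classes are classes under zigzags, so each
    computation is reduced to morphisms of extensions with prescribed ends. *)

Section LinearSelection.
Variables (k : fieldType) (V W : lmodType k).
Implicit Types G H : V -> W -> Prop.

Definition linear_rel G :=
  G 0 0 /\ forall a v w v' w', G v w -> G v' w' -> G (a *: v + v') (a *: w + w').

(** The single use of Zorn's lemma, in place of bases. [G] is the graph of a map prescribed on a
    subspace and [H] a linear constraint on the values; suitable pairs give complements,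
    retractions, separating functionals and coordinates. A maximal admissible graph is defined
    everywhere, since a missing vector could be sent to any value that [H] allows. *)
Lemma lin_select G H : linear_rel G -> linear_rel H ->
  (forall v w, G v w -> H v w) -> (forall w, G 0 w -> w = 0) ->
  (forall v, exists w, H v w) ->
  exists g : {linear V -> W}, (forall v w, G v w -> g v = w) /\ forall v, H v (g v).
Proof.
move=> [G0 GP] [H0 HP] GH Gf Ht.
pose rel_of (A : set (V * W)) v w := A (v, w) \/ G v w.
pose good A := [/\ linear_rel (rel_of A), forall v w, rel_of A v w -> H v w
  & forall w, rel_of A 0 w -> w = 0].
have [|A [[[A0 AP] AH Af] Amax]] := @Zorn_bigcup (V * W)%type good.
  move=> F Fgood Ftot; split.
  - split; first by right.
    move=> a v w v' w' [[X FX Xv]|Gv] [[Y FY Yv]|Gv'].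
    + have [XY|YX] := Ftot _ _ FX FY.
        have [[_ YP] _ _] := Fgood _ FY.
        have [||?|?] := YP a v w v' w'; [by left; apply: XY | by left | |by right].
        by left; exists Y.
      have [[_ XP] _ _] := Fgood _ FX.
      have [||?|?] := XP a v w v' w'; [by left | by left; apply: YX | |by right].
      by left; exists X.
    + have [[_ XP] _ _] := Fgood _ FX.
      by have [||?|?] := XP a v w v' w'; [by left | by right | left; exists X|right].
    + have [[_ YP] _ _] := Fgood _ FY.
      by have [||?|?] := YP a v w v' w'; [by right | by left | left; exists Y|right].
    + by right; apply: GP.
  - move=> v w [[X FX Xv]|]; last exact: GH.
    by have [_ XH _] := Fgood _ FX; apply: XH; left.
  - move=> w [[X FX Xv]|]; last exact: Gf.
    by have [_ _] := Fgood _ FX; apply; left.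
have dom v : exists w, rel_of A v w.
  apply: contrapT => nv; have [w0 Hw0] := Ht v.
  pose B : set (V * W) := fun p => exists a u w,
    rel_of A u w /\ p = (u + a *: v, w + a *: w0).
  have AB p : rel_of A p.1 p.2 -> B p.
    by case: p => u w /= Auw; exists 0, u, w; rewrite !scale0r !addr0.
  have BA u w : rel_of B u w -> B (u, w) by case=> // Guw; apply: AB; right.
  apply: (Amax B); first split.
  - by move=> p Ap; apply: AB; left; case: p Ap.
  - move=> BsA; apply: nv; exists w0; left; apply: BsA.
    by exists 1, 0, 0; rewrite !scale1r !add0r.
  - split.
    + split; first by right.
      move=> b u w u' w' /BA[a [x [y [xy [-> ->]]]]] /BA[a' [x' [y' [xy' [-> ->]]]]].
      left; exists (b * a + a'), (b *: x + x'), (b *: y + y'); split; first exact: AP.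
      by rewrite !scalerDr !scalerDl !scalerA; congr pair; rewrite addrACA.
    + move=> u w /BA[a [x [y [xy [-> ->]]]]].
      by rewrite addrC [y + _]addrC; apply: HP => //; apply: AH.
    + move=> w /BA[a [x [y [xy [E ->]]]]].
      (* If a nonzero multiple of [v] were cancelled by an element of the domain, [v] itself would
         be in the domain. *)
      have [a0|a0] := eqVneq a 0.
        by move: E xy; rewrite a0 !scale0r !addr0 => <- /Af.
      case: nv; exists (- a^-1 *: y).
      have <- : - a^-1 *: x + 0 = v.
        move/esym/eqP: E; rewrite addr_eq0 => /eqP ->.
        by rewrite scalerN scaleNr opprK scalerA mulVf // scale1r addr0.
      by rewrite -[_ *: y]addr0; apply: AP.
have [g gP] := choice dom.
have uniq v w w' : rel_of A v w -> rel_of A v w' -> w = w'.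
  move=> Aw Aw'; apply/eqP; rewrite -subr_eq0; apply/eqP/Af.
  by rewrite -(subrr v) -!scaleN1r addrC [w + _]addrC; apply: AP.
have gl : linear g by move=> a u v; apply: uniq (gP _) _; apply: AP.
exists (mklin gl); split=> [v w Gvw|v]; last exact: AH.
by apply: uniq (gP v) _; right.
Qed.

End LinearSelection.

Section LinearAlgebra.
Variable k : fieldType.
Implicit Types U V W : lmodType k.

(** With [e] a projector onto the kernel of [f], the vector [x - e x] depends on [f x] only and can
    be taken as its image under [g]. Retractions, sections and splittings of exact pairs are all
    instances. *)
Lemma generalized_inverse V W (f : {linear V -> W}) :
  exists g : {linear W -> V}, forall v, f (g (f v)) = f v.
Proof.
have [||||v|e [eker e_im]] := @lin_select _ V V (fun x y => f x = 0 /\ x = y)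
    (fun _ y => f y = 0).
- split; first by rewrite linear0.
  by move=> a v w v' w' [v0 <-] [v'0 <-]; rewrite linearP v0 v'0 scaler0 addr0.
- split; first by rewrite linear0.
  by move=> a _ w _ w' w0 w'0; rewrite linearP w0 w'0 scaler0 addr0.
- by move=> v w [v0 <-].
- by move=> w [_ <-].
- by exists 0; rewrite linear0.
have [||||w|g [gf _]] := @lin_select _ W V
    (fun y z => exists x, y = f x /\ z = x - e x) (fun _ _ => True) => //.
- split; first by exists 0; rewrite (linear0 f) (linear0 e) subrr.
  move=> a _ _ _ _ [x [-> ->]] [x' [-> ->]]; exists (a *: x + x').
  by rewrite (linearP f) (linearP e) opprD scalerDr scalerN addrACA.
- by move=> z [x [/esym x0 ->]]; rewrite (eker x x) ?subrr.
- by exists 0.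
exists g => v; rewrite (gf _ (v - e v)); last by exists v.
by rewrite linearB e_im subr0.
Qed.

Lemma linear_retraction V W (f : {linear V -> W}) : injective f ->
  exists g : {linear W -> V}, cancel f g.
Proof. by move=> fI; have [g gP] := generalized_inverse f; exists g => v; apply: fI. Qed.

Lemma linear_section V W (f : {linear V -> W}) : (forall w, exists v, f v = w) ->
  exists g : {linear W -> V}, cancel g f.
Proof.
move=> fS; have [g gP] := generalized_inverse f.
by exists g => w; have [v <-] := fS w.
Qed.

Lemma linear_extension U V W (i : {linear U -> V}) (f : {linear U -> W}) :
  injective i -> exists g : {linear V -> W}, forall u, g (i u) = f u.
Proof.
move=> /linear_retraction[r rP]; exists (f \o r) => u.
by rewrite /= rP.
Qed.

Definition lin_closed V (S : V -> Prop) :=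
  S 0 /\ forall a x y, S x -> S y -> S (a *: x + y).

Lemma separating_functional V (S : V -> Prop) (v0 : V) : lin_closed S -> ~ S v0 ->
  exists f : {linear V -> k^o}, (forall v, S v -> f v = 0) /\ f v0 = 1.
Proof.
move=> [S0 SP] nS.
have [||||v|f [fG _]] := @lin_select _ V k^o
    (fun v a => S (v - a *: v0)) (fun _ _ => True) => //.
- split; first by rewrite scale0r subr0.
  move=> a v b v' b' Sv Sv'; have := SP a _ _ Sv Sv'.
  by rewrite scalerBr scalerA addrACA -opprD -scalerDl.
- move=> a; rewrite sub0r => Sa; apply/eqP/negPn/negP => a0; apply: nS.
  have := SP (- a^-1) _ _ Sa S0.
  by rewrite scalerN scaleNr opprK scalerA mulVf // scale1r addr0.
- by exists 0.
exists f; split=> [v Sv|]; first by apply: fG; rewrite scale0r subr0.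
by apply: fG; rewrite scale1r subrr.
Qed.

(** The coefficients are a function on all naturals, so that lists can be mapped and concatenated
    without casts between index types. *)
Definition in_span V (e : seq V) (v : V) :=
  exists c : nat -> k, v = \sum_(i < size e) c i *: e`_i.

Lemma in_span_closed V (e : seq V) : lin_closed (in_span e).
Proof.
split=> [|a _ _ [c ->] [d ->]].
  by exists (fun=> 0); rewrite big1 // => i _; rewrite scale0r.
exists (fun i => a * c i + d i); rewrite scaler_sumr -big_split.
by apply: eq_bigr => i _; rewrite scalerDl scalerA.
Qed.

Lemma in_span_map V W (f : {linear V -> W}) (e : seq V) v :
  in_span e v -> in_span (map f e) (f v).
Proof.
move=> [c ->]; exists c; rewrite size_map linear_sum; apply: eq_bigr => i _.
by rewrite linearZ (nth_map 0).
Qed.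

Lemma finite_dimP V : finite_dim V <-> exists e : seq V, forall v, in_span e v.
Proof.
split=> [[n [e eP]]|[e eP]].
  exists (map e (enum 'I_n)) => v; have [c ->] := eP v.
  case: n e eP c => [|n] e eP c.
    by exists (fun=> 0); rewrite big_ord0 big1 // => i _; rewrite scale0r.
  exists (fun i => c (inord i)); rewrite size_map size_enum_ord.
  apply: eq_bigr => i _; rewrite inord_val (nth_map i) ?size_enum_ord //.
  by rewrite nth_ord_enum.
exists (size e), (fun i => e`_i) => v; have [c ->] := eP v.
by exists c.
Qed.

End LinearAlgebra.

(** * Yoneda extensions: pullbacks, pushouts and comparison theorems *)

Section AbelianProperties.
Variable K : addcat.

(** The properties of an abelian category on which the comparison arguments rest. Kernels,
    established for modules and comodules, give pullbacks; cokernels, established for contramodules,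
    give pushouts. *)
Definition has_negatives := forall (A B : K) (f : hom A B),
  exists g : hom A B, forall x, app g x = - app f x.

Definition has_lifts := forall (A X W : K) (i : hom A X) (h : hom W X),
  injective (app i) -> (forall w, exists a, app i a = app h w) ->
  exists g : hom W A, comp i g = h.

Definition has_descents := forall (A X W : K) (p : hom X A) (h : hom X W),
  (forall a, exists x, app p x = a) -> (forall x, app p x = 0 -> app h x = 0) ->
  exists g : hom A W, comp g p = h.

Definition has_kernels := forall (X Y : K) (f : hom X Y), exists (Z : K) (i : hom Z X),
  injective (app i) /\ forall x, app f x = 0 <-> exists z, app i z = x.

Definition has_cokernels := forall (X Y : K) (f : hom X Y), exists (Q : K) (p : hom Y Q),
  (forall q, exists y, app p y = q) /\ forall y, app p y = 0 <-> exists x, app f x = y.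

End AbelianProperties.

Section YonedaTheory.
Variable K : addcat.
Implicit Types A B X Y Z : K.

Lemma compP A B X (g : hom B X) (f : hom A B) (h : hom A X) :
  comp g f = h <-> forall x, app g (app f x) = app h x.
Proof.
split=> [<- x|E]; first by rewrite app_comp.
by apply: app_inj => x; rewrite app_comp /= E.
Qed.

Lemma appM A B X (g : hom B X) (f : hom A B) x : app (comp g f) x = app g (app f x).
Proof. by rewrite app_comp. Qed.

Definition zerom A B : hom A B := comp (@prrm K A B) (@inlm K A B).
Lemma app_zerom A B x : app (zerom A B) x = 0.
Proof. by rewrite appM app_prr_inl. Qed.

Lemma ses_morP A B A' B' (S : ses A B) (S' : ses A' B') g f :
  ses_mor S S' g f <-> exists h : hom (ses_mid S) (ses_mid S'),
    (forall b, app h (app (ses_inj S) b) = app (ses_inj S') (app f b)) /\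
    (forall x, app (ses_sur S') (app h x) = app g (app (ses_sur S) x)).
Proof.
split=> -[h [E F]]; exists h.
  by split=> x; rewrite -!appM ?E ?F.
by split; apply/compP => x; rewrite ?E ?F !appM.
Qed.

Lemma ses_injI A B (S : ses A B) : injective (app (ses_inj S)).
Proof. by have [] := ses_exact S. Qed.
Lemma ses_surS A B (S : ses A B) a : exists x, app (ses_sur S) x = a.
Proof. by have [_ + _] := ses_exact S; apply. Qed.
Lemma ses_kerP A B (S : ses A B) (x : car (ses_mid S)) :
  app (ses_sur S) x = 0 <-> exists b, app (ses_inj S) b = x.
Proof. by have [_ _] := ses_exact S; apply. Qed.
Lemma ses_sur_inj A B (S : ses A B) b : app (ses_sur S) (app (ses_inj S) b) = 0.
Proof. by apply/ses_kerP; exists b. Qed.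

Lemma ses_mor_id A B (S : ses A B) : ses_mor S S (idm A) (idm B).
Proof. by apply/ses_morP; exists (idm _); split=> x; rewrite !app_idm. Qed.

Lemma ses_mor_comp A B A' B' A'' B'' (S : ses A B) (S' : ses A' B') (S'' : ses A'' B'')
    g f g' f' : ses_mor S S' g f -> ses_mor S' S'' g' f' ->
  ses_mor S S'' (comp g' g) (comp f' f).
Proof.
move=> /ses_morP[h [E F]] /ses_morP[h' [E' F']]; apply/ses_morP.
by exists (comp h' h); split=> x; rewrite !appM ?E ?E' // F' F.
Qed.

Lemma exseq_mor_id n A B (E : exseq n A B) : exseq_mor E E (idm A) (idm B).
Proof.
elim: n A B E => [|n IH] A B E /=; first exact: ses_mor_id.
by exists (idm _); split; [apply: ses_mor_id | apply: IH].
Qed.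

Lemma exseq_mor_comp n A B A' B' A'' B'' (E : exseq n A B) (E' : exseq n A' B')
    (E'' : exseq n A'' B'') g f g' f' : exseq_mor E E' g f -> exseq_mor E' E'' g' f' ->
  exseq_mor E E'' (comp g' g) (comp f' f).
Proof.
elim: n A B A' B' A'' B'' E E' E'' g f g' f'
  => [|n IH] A B A' B' A'' B'' E E' E'' g f g' f' /=; first exact: ses_mor_comp.
move=> [z [M N]] [z' [M' N']]; exists (comp z' z).
by split; [apply: ses_mor_comp M M' | apply: IH N N'].
Qed.

Lemma ses_mor_zero A B A' B' (S : ses A B) (S' : ses A' B') :
  ses_mor S S' (zerom _ _) (zerom _ _).
Proof.
apply/ses_morP; exists (zerom _ _).
by split=> x; rewrite !app_zerom raddf0.
Qed.

Lemma exseq_mor_zero n A B A' B' (E : exseq n A B) (E' : exseq n A' B') :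
  exseq_mor E E' (zerom _ _) (zerom _ _).
Proof.
elim: n A B A' B' E E' => [|n IH] A B A' B' E E' /=; first exact: ses_mor_zero.
by exists (zerom _ _); split; [apply: ses_mor_zero | apply: IH].
Qed.

Lemma comp1m A B (f : hom A B) : comp (idm B) f = f.
Proof. by apply/compP => x; rewrite app_idm. Qed.
Lemma compm1 A B (f : hom A B) : comp f (idm A) = f.
Proof. by apply/compP => x; rewrite app_idm. Qed.
Lemma compmA A B X Y (h : hom X Y) (g : hom B X) (f : hom A B) :
  comp h (comp g f) = comp (comp h g) f.
Proof. by apply/compP => x; rewrite !appM. Qed.

Lemma exseq_mor_eq n A B A' B' (E : exseq n A B) (E' : exseq n A' B') g f g' f' :
  app g =1 app g' -> app f =1 app f' -> exseq_mor E E' g f -> exseq_mor E E' g' f'.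
Proof. by move=> /app_inj -> /app_inj ->. Qed.

Lemma yext_equiv_trans n A B (E1 E2 E3 : yext n A B) :
  yext_equiv E1 E2 -> yext_equiv E2 E3 -> yext_equiv E1 E3.
Proof. exact: rst_trans. Qed.
Lemma yext_equiv_sym n A B (E1 E2 : yext n A B) : yext_equiv E1 E2 -> yext_equiv E2 E1.
Proof. exact: rst_sym. Qed.
Lemma yext_equiv_refl n A B (E : yext n A B) : yext_equiv E E.
Proof. exact: rst_refl. Qed.
Lemma exseq_mor_equiv n A B (E E' : exseq n A B) :
  exseq_mor E E' (idm A) (idm B) -> @yext_equiv K n.+1 A B E E'.
Proof. exact: rst_step. Qed.

Lemma Ext_classP n A B (E E' : yext n A B) :
  Ext_class E = Ext_class E' <-> yext_equiv E E'.
Proof.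
split=> [/(congr1 sval) /= ->|H]; first exact: yext_equiv_refl.
apply: eq_exist; apply/funext => F; apply/propext; split.
  by apply: yext_equiv_trans; apply: yext_equiv_sym.
exact: yext_equiv_trans.
Qed.

Lemma Ext_classK n A B (x : Ext n A B) : exists E, x = Ext_class E.
Proof. by case: x => x [E xE]; exists E; apply: eq_exist. Qed.

Section Splitting.
Variables A B : K.

Lemma split_is_ses : is_ses (@inlm K B A) (@prrm K B A).
Proof.
split=> [|a|x].
- by apply: (can_inj (g := app (@prlm K B A))) => b; rewrite app_prl_inl.
- by exists (app (@inrm K B A) a); rewrite app_prr_inr.
split=> [x0|[b <-]]; last by rewrite app_prr_inl.
by exists (app (@prlm K B A) x); rewrite -[RHS]app_dsum_id x0 raddf0 addr0.
Qed.
Definition split_ses := Ses split_is_ses.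

End Splitting.

(* The pushforward of E along the zero map to B'. *)
Fixpoint exseq_split n A B (B' : K) : exseq n A B -> exseq n A B' :=
  match n with
  | 0 => fun=> split_ses A B'
  | n'.+1 => fun E => existT _ (projT1 E) ((projT2 E).1, exseq_split B' (projT2 E).2)
  end.

(** The middle map of the last short exact sequence kills the image of [B], so it descends to the
    quotient and, with the inclusion of [B'], defines a map on the direct sum. When [g] is an
    identity, [E'] becomes equivalent to an extension built from [E] alone; this is how classes are
    shown to coincide. *)
Lemma exseq_split_mor n A B A' B' (E : exseq n A B) (E' : exseq n A' B') g f :
  has_descents K -> exseq_mor E E' g f -> app f =1 (fun=> 0) ->
  exseq_mor (exseq_split B' E) E' g (idm B').
Proof.
move=> desc; elim: n A B A' B' E E' g f => [|n IH] A B A' B' E E' g f; last first.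
  by move=> [z [M N]] f0; exists z; split=> //; apply: IH N f0.
move=> /ses_morP[h [hi hs]] f0; apply/ses_morP.
have [h' /compP h'E] : exists h' : hom A (ses_mid E'), comp h' (ses_sur E) = h.
  apply: desc; first exact: ses_surS.
  by move=> x /ses_kerP[b <-]; rewrite hi f0 raddf0.
exists (addm (comp (ses_inj E') (@prlm K B' A)) (comp h' (@prrm K B' A))); split=> [b|x] /=.
  by rewrite app_addm /= !appM app_prl_inl app_prr_inl raddf0 addr0 app_idm.
rewrite app_addm /= !appM raddfD ses_sur_inj add0r.
by have [y <-] := ses_surS E (app (@prrm K B' A) x); rewrite h'E hs.
Qed.

Section Subtraction.
Hypothesis negs : has_negatives K.

Lemma hom_sub A B (f g : hom A B) : exists d : hom A B, forall x, app d x = app f x - app g x.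
Proof.
have [g' g'E] := negs g; exists (addm f g') => x.
by rewrite app_addm /= g'E.
Qed.

Lemma exseq_mor_sub n A B A' B' (E : exseq n A B) (E' : exseq n A' B') g f g' f' dg df :
  exseq_mor E E' g f -> exseq_mor E E' g' f' ->
  (forall x, app dg x = app g x - app g' x) -> (forall x, app df x = app f x - app f' x) ->
  exseq_mor E E' dg df.
Proof.
have sub A1 B1 A2 B2 (S : ses A1 B1) (S' : ses A2 B2) u v u' v' du dv :
    ses_mor S S' u v -> ses_mor S S' u' v' ->
    (forall x, app du x = app u x - app u' x) -> (forall x, app dv x = app v x - app v' x) ->
    ses_mor S S' du dv.
  move=> /ses_morP[h [E1 F1]] /ses_morP[h' [E2 F2]] duE dvE; apply/ses_morP.
  have [d dE] := hom_sub h h'; exists d.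
  by split=> x; rewrite dE ?duE ?dvE ?E1 ?E2 raddfB // F1 F2.
elim: n A B A' B' E E' g f g' f' dg df => [|n IH] A B A' B' E E' g f g' f' dg df /=.
  exact: sub.
move=> [z [M N]] [z' [M' N']] dgE dfE; have [d dE] := hom_sub z z'.
by exists d; split; [apply: sub dgE dE | apply: IH dE dfE].
Qed.

End Subtraction.

Section Pullback.
Hypothesis lifts : has_lifts K.
Hypothesis kernels : has_kernels K.
Hypothesis negs : has_negatives K.

(** The pullback is the kernel of a difference map on a direct sum. Its universal property is kept
    for arbitrary [T], [u] and [f], so that two extensions with the same map to a third can be
    linked through one pullback. *)
Lemma ses_pull A A' B (S : ses A B) (g : hom A' A) : exists S' : ses A' B,
  ses_mor S' S g (idm B) /\
  forall A'' B'' (T : ses A'' B'') (u : hom A'' A') (f : hom B'' B),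
    ses_mor T S (comp g u) f -> ses_mor T S' u f.
Proof.
pose X := ses_mid S.
have [d dE] := hom_sub negs (comp (ses_sur S) (@prlm K X A')) (comp g (@prrm K X A')).
have [Z [i [iI iP]]] := kernels d.
have iE x a : app (ses_sur S) x = app g a ->
    exists z, app (@prlm K X A') (app i z) = x /\ app (@prrm K X A') (app i z) = a.
  move=> xa; have [|z zE] := (iP (app (@inlm K X A') x + app (@inrm K X A') a)).1.
    rewrite dE !appM !raddfD app_prl_inl app_prr_inr app_prr_inl app_prl_inr !raddf0.
    by rewrite addr0 add0r xa subrr.
  exists z; rewrite zE !raddfD app_prl_inl app_prr_inr app_prr_inl app_prl_inr.
  by rewrite addr0 add0r.
have zE z : app (ses_sur S) (app (@prlm K X A') (app i z)) = app g (app (@prrm K X A') (app i z)).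
  have /iP : exists z', app i z' = app i z by exists z.
  by rewrite dE !appM => /eqP; rewrite subr_eq0 => /eqP.
have dinj z z' : app (@prlm K X A') (app i z) = app (@prlm K X A') (app i z') ->
    app (@prrm K X A') (app i z) = app (@prrm K X A') (app i z') -> z = z'.
  by move=> E F; apply/iI/app_dsum_inj.
have [j jE] : exists j : hom B Z, comp i j = comp (@inlm K X A') (ses_inj S).
  apply: lifts => // b; have [|z [E F]] := iE (app (ses_inj S) b) 0.
    by rewrite ses_sur_inj raddf0.
  exists z; apply: app_dsum_inj; rewrite !appM ?app_prl_inl ?app_prr_inl //.
have {}jE b : app i (app j b) = app (@inlm K X A') (app (ses_inj S) b).
  by rewrite -!appM jE.
have S'P : is_ses j (comp (@prrm K X A') i).
  split=> [b b' E|a|z].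
  - have := congr1 (fun z => app (@prlm K X A') (app i z)) E.
    by rewrite /= !jE !app_prl_inl => /ses_injI.
  - have [x xE] := ses_surS S (app g a); have [z [_ zA]] := iE _ _ xE.
    by exists z; rewrite appM.
  rewrite appM; split=> [z0|[b <-]]; last by rewrite jE app_prr_inl.
  have := zE z; rewrite z0 raddf0 => /ses_kerP[b bE]; exists b.
  by apply: dinj; rewrite jE ?app_prl_inl ?app_prr_inl.
exists (Ses S'P); split.
  apply/ses_morP; exists (comp (@prlm K X A') i); split=> /= [b|z].
    by rewrite appM jE app_prl_inl app_idm.
  by rewrite !appM.
move=> A'' B'' T u f /ses_morP[h [hi hs]]; apply/ses_morP.
have [h' h'E] : exists h' : hom (ses_mid T) Z,
    comp i h' = addm (comp (@inlm K X A') h) (comp (@inrm K X A') (comp u (ses_sur T))).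
  apply: lifts => // x; have [|z [E F]] := iE (app h x) (app u (app (ses_sur T) x)).
    by rewrite hs appM.
  exists z; rewrite app_addm /= !appM.
  by apply: app_dsum_inj; rewrite raddfD ?app_prl_inl ?app_prr_inr ?app_prr_inl ?app_prl_inr
    ?addr0 ?add0r.
have {}h'E x : app i (app h' x) =
    app (@inlm K X A') (app h x) + app (@inrm K X A') (app u (app (ses_sur T) x)).
  by rewrite -appM h'E app_addm /= !appM.
exists h'; split=> /= [b|x].
  apply: dinj; rewrite h'E jE raddfD.
    by rewrite !app_prl_inl app_prl_inr addr0 hi.
  by rewrite !app_prr_inl app_prr_inr add0r ses_sur_inj raddf0.
by rewrite appM h'E raddfD app_prr_inl app_prr_inr add0r.
Qed.

Lemma exseq_pull n A A' B (E : exseq n A B) (g : hom A' A) : exists E' : exseq n A' B,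
  exseq_mor E' E g (idm B) /\
  forall A'' B'' (T : exseq n A'' B'') (u : hom A'' A') (f : hom B'' B),
    exseq_mor T E (comp g u) f -> exseq_mor T E' u f.
Proof.
case: n E => [|n] E; first exact: ses_pull.
have [S' [M U]] := ses_pull (projT2 E).1 g.
exists (existT _ (projT1 E) (S', (projT2 E).2)); split.
  by exists (idm _); split=> //; apply: exseq_mor_id.
move=> A'' B'' T u f [z [P Q]]; exists z; split=> //=.
exact: U.
Qed.

End Pullback.

Section Pushout.
Hypothesis descents : has_descents K.
Hypothesis cokernels : has_cokernels K.
Hypothesis negs : has_negatives K.

Lemma ses_push A B B' (S : ses A B) (f : hom B B') : exists S' : ses A B',
  ses_mor S S' (idm A) f.
Proof.
pose X := ses_mid S.
have [f' f'E] := negs f.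
pose d := addm (comp (@inlm K X B') (ses_inj S)) (comp (@inrm K X B') f').
have dl b : app (@prlm K X B') (app d b) = app (ses_inj S) b.
  by rewrite app_addm /= !appM raddfD app_prl_inl app_prl_inr addr0.
have dr b : app (@prrm K X B') (app d b) = - app f b.
  by rewrite app_addm /= !appM raddfD app_prr_inr app_prr_inl add0r f'E.
have [Q [p [pS pP]]] := cokernels d.
have [s sE] : exists s : hom Q A, comp s p = comp (ses_sur S) (@prlm K X B').
  apply: descents => // x /pP[b <-].
  by rewrite appM dl ses_sur_inj.
have {}sE x : app s (app p x) = app (ses_sur S) (app (@prlm K X B') x).
  by rewrite -!appM sE.
have S'P : is_ses (comp p (@inrm K X B')) s.
  split=> [b b'|a|q].
  - rewrite !appM => /eqP; rewrite -subr_eq0 -!raddfB => /eqP /pP[c cE].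
    have := congr1 (app (@prlm K X B')) cE; rewrite dl app_prl_inr => /eqP.
    rewrite -(raddf0 (app (ses_inj S))) => /eqP /ses_injI c0.
    have := congr1 (app (@prrm K X B')) cE; rewrite dr app_prr_inr c0 raddf0 oppr0.
    by move/esym/eqP; rewrite subr_eq0 => /eqP.
  - have [x xE] := ses_surS S a; exists (app p (app (@inlm K X B') x)).
    by rewrite sE app_prl_inl.
  have [y <-] := pS q; rewrite sE; split=> [/ses_kerP[b bE]|[b]].
    exists (app (@prrm K X B') y + app f b); rewrite appM.
    apply/eqP; rewrite -subr_eq0 -raddfB; apply/eqP/pP; exists (- b).
    apply: app_dsum_inj; rewrite raddfN raddfN ?dl ?dr raddfB.
      by rewrite app_prl_inr bE sub0r.
    by rewrite app_prr_inr opprK addrAC subrr add0r.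
  rewrite appM => /eqP; rewrite -subr_eq0 -raddfB => /eqP /pP[c cE].
  have := congr1 (app (@prlm K X B')) cE; rewrite dl raddfB app_prl_inr sub0r => E.
  by apply/ses_kerP; exists (- c); rewrite raddfN E opprK.
exists (Ses S'P); apply/ses_morP; exists (comp p (@inlm K X B')); split=> /= [b|x].
  rewrite !appM; apply/eqP; rewrite -subr_eq0 -raddfB; apply/eqP/pP; exists b.
  apply: app_dsum_inj; rewrite raddfB ?dl ?dr ?app_prl_inl ?app_prl_inr ?subr0 //.
  by rewrite app_prr_inl app_prr_inr sub0r.
by rewrite appM sE app_prl_inl app_idm.
Qed.

Lemma exseq_push n A B B' (E : exseq n A B) (f : hom B B') : exists E' : exseq n A B',
  exseq_mor E E' (idm A) f.
Proof.
elim: n A E => [|n IH] A E; first exact: ses_push.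
have [E' M] := IH _ (projT2 E).2.
exists (existT _ (projT1 E) ((projT2 E).1, E')); exists (idm _).
by split=> //; apply: ses_mor_id.
Qed.

End Pushout.

Section ProjectiveResolution.

Fixpoint resolution n (Om : nat -> K) (S : forall j, ses (Om j) (Om j.+1)) :
    exseq n (Om 0) (Om n.+1) :=
  match n return exseq n (Om 0) (Om n.+1) with
  | 0 => S 0
  | n'.+1 => existT _ (Om 1) (S 0, resolution n' (fun j => S j.+1))
  end.

Hypothesis lifts : has_lifts K.
Hypothesis negs : has_negatives K.

Lemma resolution_mor n (Om : nat -> K) (S : forall j, ses (Om j) (Om j.+1))
    A B (E : exseq n A B) (g : hom (Om 0) A) :
  (forall j, projective (ses_mid (S j))) ->
  exists f, exseq_mor (resolution n S) E g f.
Proof.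
elim: n Om S A E g => [|n IH] Om S A E g PS.
  have [h /compP hE] := PS 0 _ _ (ses_sur E) (comp g (ses_sur (S 0))) (ses_surS E).
  have [f /compP fE] : exists f, comp (ses_inj E) f = comp h (ses_inj (S 0)).
    apply: lifts; first exact: ses_injI.
    by move=> b; apply/ses_kerP; rewrite appM hE appM ses_sur_inj raddf0.
  exists f; apply/ses_morP; exists h; split=> [b|x]; first by rewrite fE appM.
  by rewrite hE appM.
have [h /compP hE] := PS 0 _ _ (ses_sur (projT2 E).1) (comp g (ses_sur (S 0)))
  (ses_surS (projT2 E).1).
have [z /compP zE] : exists z, comp (ses_inj (projT2 E).1) z = comp h (ses_inj (S 0)).
  apply: lifts; first exact: ses_injI.
  by move=> b; apply/ses_kerP; rewrite appM hE appM ses_sur_inj raddf0.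
have [f fE] := IH _ (fun j => S j.+1) _ (projT2 E).2 z (fun j => PS j.+1).
exists f; exists z; split=> //; apply/ses_morP; exists h.
by split=> [b|x]; rewrite ?zE ?hE !appM.
Qed.

(** Once [w], composed with the surjection of [S], is subtracted from the middle map, the difference
    goes to zero in [A'] and hence lands in [B']. *)
Lemma ses_mor_lift A B A' B' (S : ses A B) (T : ses A' B') (u : hom A A') (v : hom B B')
    (w : hom A (ses_mid T)) :
  comp (ses_sur T) w = u -> ses_mor S T u v ->
  exists h : hom (ses_mid S) B', comp h (ses_inj S) = v.
Proof.
move=> /compP wE /ses_morP[h [hi hs]].
have [d dE] := hom_sub negs h (comp w (ses_sur S)).
have [l /compP lE] : exists l, comp (ses_inj T) l = d.
  apply: lifts; first exact: ses_injI.
  by move=> x; apply/ses_kerP; rewrite dE raddfB hs appM wE subrr.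
exists l; apply/compP => b; apply: (@ses_injI _ _ T).
by rewrite lE dE hi appM ses_sur_inj raddf0 subr0.
Qed.

(* The comparison theorem, in a form stable under passing to the next syzygy. *)
Lemma resolution_lift n (Om : nat -> K) (S : forall j, ses (Om j) (Om j.+1))
    A B (E : exseq n A B) (g : hom (Om 0) A) (f : hom (Om n.+1) B) :
  (forall j, projective (ses_mid (S j))) ->
  (forall X (p : hom X A), (forall a, exists x, app p x = a) ->
    exists w : hom (Om 0) X, comp p w = g) ->
  exseq_mor (resolution n S) E g f ->
  exists h : hom (ses_mid (S n)) B, comp h (ses_inj (S n)) = f.
Proof.
elim: n Om S A E g f => [|n IH] Om S A E g f PS lift0.
  by have [w wE] := lift0 _ _ (ses_surS E); apply: ses_mor_lift wE.
move=> [z [M N]]; have [w wE] := lift0 _ _ (ses_surS (projT2 E).1).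
have [h hE] := ses_mor_lift wE M.
apply: (IH (fun j => Om j.+1) (fun j => S j.+1) _ (projT2 E).2 z f) N => //.
move=> X p pS; have [h' h'E] := PS 0 _ _ p h pS.
by exists (comp h' (ses_inj (S 0))); rewrite compmA h'E.
Qed.

(** The comparison map, modulo maps that extend to the last projective, is an invariant of the
    Yoneda class. Equivalence is generated by zigzags, whence the induction; at a transitivity step
    [resolution_mor] supplies a comparison map to the intermediate extension. *)
Lemma resolution_equiv n (Om : nat -> K) (S : forall j, ses (Om j) (Om j.+1))
    A B (E E' : exseq n A B) (g : hom (Om 0) A) (f f' : hom (Om n.+1) B) :
  (forall j, projective (ses_mid (S j))) -> @yext_equiv K n.+1 A B E E' ->
  exseq_mor (resolution n S) E g f -> exseq_mor (resolution n S) E' g f' ->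
  exists h : hom (ses_mid (S n)) B,
    forall x, app f x - app f' x = app h (app (ses_inj (S n)) x).
Proof.
move=> PS; have same F u v : exseq_mor (resolution n S) F g u ->
    exseq_mor (resolution n S) F g v -> exists h : hom (ses_mid (S n)) B,
    forall x, app u x - app v x = app h (app (ses_inj (S n)) x).
  move=> Mu Mv; have [d dE] := hom_sub negs u v.
  have zE x : app (zerom (Om 0) A) x = app g x - app g x by rewrite app_zerom subrr.
  have [|h /compP hE] := resolution_lift (f := d) PS _ (exseq_mor_sub negs Mu Mv zE dE).
  - by move=> X p _; exists (zerom _ _); apply/compP => x; rewrite !app_zerom raddf0.
  by exists h => x; rewrite hE dE.
move=> H; move: H f f'.
elim=> [{}E {}E' EE'|{}E|{}E {}E' _ IH|E1 E2 E3 _ H1 _ H2] f f' M M'.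
- have N := exseq_mor_comp M EE'; apply: same M'.
  by move: N; rewrite !comp1m.
- exact: same M M'.
- have [h hE] := IH _ _ M' M; have [h' h'E] := negs h.
  by exists h' => x; rewrite h'E -hE opprB.
have [f2 M2] := resolution_mor E2 g PS.
have [h hE] := H1 _ _ M M2; have [h' h'E] := H2 _ _ M2 M'.
exists (addm h h') => x.
by rewrite app_addm /= -hE -h'E addrA subrK.
Qed.

End ProjectiveResolution.

(** * Comparison with coresolutions by injective objects *)

Section InjectiveCoresolution.

Definition injective_object (I : K) := forall A B (S : ses A B) (u : hom B I),
  exists v : hom (ses_mid S) I, comp v (ses_inj S) = u.

Variables (Z : nat -> K) (S : forall j, ses (Z j.+1) (Z j)).

Fixpoint coresolution n : exseq n (Z n.+1) (Z 0) :=
  match n return exseq n (Z n.+1) (Z 0) with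
  | 0 => S 0
  | n'.+1 => existT _ (Z n'.+1) (S n'.+1, coresolution n')
  end.

Hypothesis descents : has_descents K.
Hypothesis negs : has_negatives K.

(** Injectivity is required up to index [n] only: in the coresolution by double duals it is
    available just for the terms with finite-dimensional socle. *)
Lemma coresolution_mor n A B (E : exseq n A B) (f : hom B (Z 0)) :
  (forall j, (j <= n)%N -> injective_object (ses_mid (S j))) ->
  exists g, exseq_mor E (coresolution n) g f.
Proof.
have ext A' B' (T : ses A' B') j (u : hom B' (Z j)) :
    injective_object (ses_mid (S j)) -> exists v, ses_mor T (S j) v u.
  move=> IS; have [h /compP hE] := IS _ _ T (comp (ses_inj (S j)) u).
  have [v /compP vE] : exists v, comp v (ses_sur T) = comp (ses_sur (S j)) h.
    apply: descents; first exact: ses_surS.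
    by move=> x /ses_kerP[b <-]; rewrite appM hE appM ses_sur_inj.
  exists v; apply/ses_morP; exists h.
  by split=> [b|x]; rewrite ?hE ?vE appM.
elim: n A E => [|n IH] A E IS; first by apply: ext; apply: IS.
have [z N] := IH _ (projT2 E).2 (fun j jn => IS j (leqW jn)).
have [g M] := ext _ _ (projT2 E).1 _ z (IS n.+1 (leqnn _)).
by exists g; exists z.
Qed.

Lemma ses_mor_colift A B A' B' (T : ses A B) (T' : ses A' B') (u : hom A A') (v : hom B B')
    (w : hom (ses_mid T) B') :
  comp w (ses_inj T) = v -> ses_mor T T' u v ->
  exists h : hom A (ses_mid T'), comp (ses_sur T') h = u.
Proof.
move=> /compP wE /ses_morP[h [hi hs]].
have [d dE] := hom_sub negs h (comp (ses_inj T') w).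
have [l /compP lE] : exists l, comp l (ses_sur T) = d.
  apply: descents; first exact: ses_surS.
  by move=> x /ses_kerP[b <-]; rewrite dE hi appM wE subrr.
exists l; apply/compP => a; have [x <-] := ses_surS T a.
by rewrite lE dE raddfB hs appM ses_sur_inj subr0.
Qed.

Lemma coresolution_lift n A B (E : exseq n A B) g (f : hom B (Z 0)) :
  (forall j, (j <= n)%N -> injective_object (ses_mid (S j))) ->
  exseq_mor E (coresolution n) g f -> app f =1 (fun=> 0) ->
  exists h : hom A (ses_mid (S n)), comp (ses_sur (S n)) h = g.
Proof.
move=> IS M f0; elim: n A E g IS M => [|n IH] A E g IS M.
  apply: (ses_mor_colift (w := zerom _ _)) M.
  by apply/compP => x; rewrite app_zerom f0.
case: M => z [M N]; have [h /compP hE] := IH _ _ _ (fun j jn => IS j (leqW jn)) N.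
have [w /compP wE] := IS n (leqnSn n) _ _ (projT2 E).1 h.
apply: (ses_mor_colift (w := comp (ses_sur (S n)) w)) M.
by apply/compP => x; rewrite appM wE hE.
Qed.

Lemma coresolution_equiv n A B (E E' : exseq n A B) g g' (f : hom B (Z 0)) :
  (forall j, (j <= n)%N -> injective_object (ses_mid (S j))) ->
  @yext_equiv K n.+1 A B E E' ->
  exseq_mor E (coresolution n) g f -> exseq_mor E' (coresolution n) g' f ->
  exists h : hom A (ses_mid (S n)),
    forall x, app g x - app g' x = app (ses_sur (S n)) (app h x).
Proof.
move=> IS; have same F u v : exseq_mor F (coresolution n) u f ->
    exseq_mor F (coresolution n) v f -> exists h : hom A (ses_mid (S n)),
    forall x, app u x - app v x = app (ses_sur (S n)) (app h x).
  move=> Mu Mv; have [d dE] := hom_sub negs u v.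
  have zE x : app (zerom B (Z 0)) x = app f x - app f x by rewrite app_zerom subrr.
  have [|h /compP hE] := coresolution_lift IS (exseq_mor_sub negs Mu Mv dE zE).
    by move=> x; rewrite app_zerom.
  by exists h => x; rewrite hE dE.
move=> H; move: H g g'.
elim=> [{}E {}E' EE'|{}E|{}E {}E' _ IH|E1 E2 E3 _ H1 _ H2] g g' M M'.
- have N := exseq_mor_comp EE' M'; apply: same M _.
  by move: N; rewrite !compm1.
- exact: same M M'.
- have [h hE] := IH _ _ M' M; have [h' h'E] := negs h.
  by exists h' => x; rewrite h'E raddfN -hE opprB.
have [g2 M2] := coresolution_mor E2 f IS.
have [h hE] := H1 _ _ M M2; have [h' h'E] := H2 _ _ M2 M'.
exists (addm h h') => x.
by rewrite app_addm /= raddfD -hE -h'E addrA subrK.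
Qed.

End InjectiveCoresolution.

End YonedaTheory.

(** * Yoneda Ext through a coresolution by injectives *)

Section ExtAsHom.
Variables (K : addcat) (k : fieldType).
Hypothesis lifts : has_lifts K.
Hypothesis descents : has_descents K.
Hypothesis kernels : has_kernels K.
Hypothesis negs : has_negatives K.

Lemma exseq_dsum_mor n (A B A' B' A'' B'' : K) (F : exseq n A B) (G : exseq n A' B')
    (Q : exseq n A'' B'') u f v g : exseq_mor F Q u f -> exseq_mor G Q v g ->
  exseq_mor (exseq_dsum F G) Q (addm (comp u prlm) (comp v prrm))
    (addm (comp f prlm) (comp g prrm)).
Proof.
have ses_case (A1 B1 A2 B2 A3 B3 : K) (S : ses A1 B1) (T : ses A2 B2) (Q' : ses A3 B3)
    a b c d : ses_mor S Q' a b -> ses_mor T Q' c d ->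
    ses_mor (ses_dsum S T) Q' (addm (comp a prlm) (comp c prrm))
      (addm (comp b prlm) (comp d prrm)).
  move=> /ses_morP[h [hi hs]] /ses_morP[h' [hi' hs']]; apply/ses_morP.
  exists (addm (comp h prlm) (comp h' prrm)); split=> x.
    rewrite (app_addm (comp h _)) (app_addm (comp b _)) /=.
    rewrite !(appM h) !(appM h') !appM app_prl_dmap app_prr_dmap raddfD.
    by rewrite hi hi'.
  rewrite (app_addm (comp h _)) (app_addm (comp a _)) /= !(appM h) !(appM h').
  by rewrite (appM a) (appM c) app_prl_dmap app_prr_dmap raddfD hs hs'.
elim: n A B A' B' A'' B'' F G Q u f v g
  => [|n IH] A B A' B' A'' B'' F G Q u f v g /=; first exact: ses_case.
move=> [z [M N]] [z' [M' N']]; exists (addm (comp z prlm) (comp z' prrm)).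
by split; [apply: ses_case | apply: IH].
Qed.

Variables (Z : nat -> K) (S : forall j, ses (Z j.+1) (Z j)) (n : nat) (A : K).
Hypothesis IS : forall j, injective_object (ses_mid (S j)).
Hypothesis minimal : forall (h : hom A (ses_mid (S n))) x, app (ses_sur (S n)) (app h x) = 0.
Variable scale : k -> forall j, hom (Z j) (Z j).
Hypothesis scale_ses : forall c j, ses_mor (S j) (S j) (scale c j.+1) (scale c j).
Hypothesis scale0 : forall x, app (scale 0 0) x = 0.

Let std := coresolution S n.

Lemma coresolution_scale c m :
  exseq_mor (coresolution S m) (coresolution S m) (scale c m.+1) (scale c 0).
Proof. by elim: m => [|m IH] /=; [|exists (scale c m.+1)]. Qed.

(** The hypothesis [minimal] turns uniqueness modulo maps through the injective term into plain
    uniqueness. *)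
Lemma coresolution_uniq B (E E' : exseq n A B) g g' f :
  @yext_equiv K n.+1 A B E E' -> exseq_mor E std g f -> exseq_mor E' std g' f -> g = g'.
Proof.
move=> EE' M M'; apply: app_inj => x; apply/eqP; rewrite -subr_eq0; apply/eqP.
have [h ->] := coresolution_equiv descents negs (fun j _ => @IS j) EE' M M'.
exact: minimal.
Qed.

Lemma coresolution_inj (E E' : exseq n A (Z 0)) g :
  exseq_mor E std g (idm _) -> exseq_mor E' std g (idm _) -> @yext_equiv K n.+1 _ _ E E'.
Proof.
move=> M M'; have [P [_ PU]] := exseq_pull lifts kernels negs std g.
apply: (yext_equiv_trans (E2 := P : yext n.+1 _ _)).
  by apply/exseq_mor_equiv/PU; rewrite compm1.
by apply/yext_equiv_sym/exseq_mor_equiv/PU; rewrite compm1.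
Qed.

Lemma coresolution_surj (g : hom A (Z n.+1)) :
  exists E : exseq n A (Z 0), exseq_mor E std g (idm _).
Proof. by have [P [PM _]] := exseq_pull lifts kernels negs std g; exists P. Qed.

(** The map [cls] obtained from this identifies Ext^(n+1)(A, Z 0) with Hom(A, Z n.+1). As the
    operations on Ext are relations between representatives, each of them is translated below into
    an equation between values of [cls]. *)
Let cls_ex (E : exseq n A (Z 0)) : exists g, exseq_mor E std g (idm _).
Proof. exact: (coresolution_mor descents E (idm _) (fun j _ => @IS j)). Qed.
Let cls E := sval (cid (cls_ex E)).
Let clsP E : exseq_mor E std (cls E) (idm _). Proof. exact: (svalP (cid (cls_ex E))). Qed.
Let cls_eq E g : exseq_mor E std g (idm _) -> cls E = g.
Proof. exact: coresolution_uniq (yext_equiv_refl _) (clsP E). Qed.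

Let mor_scale (E : exseq n A (Z 0)) c :
  exseq_mor E std (comp (scale c n.+1) (cls E)) (scale c 0).
Proof. by have := exseq_mor_comp (clsP E) (coresolution_scale c n); rewrite compm1. Qed.

Let mor_dsum (F G : exseq n A (Z 0)) :
  exseq_mor (exseq_dsum F G) std (addm (comp (cls F) prlm) (comp (cls G) prrm))
    (addm prlm prrm).
Proof. by have := exseq_dsum_mor (clsP F) (clsP G); rewrite !comp1m. Qed.

(** Both sides of the equation are induced by morphisms from [E] to [std] over [scale c 0], so
    uniqueness identifies them. Conversely the pullback along [cls F] receives a morphism from
    [E]. *)
Let push_cls (E F : exseq n A (Z 0)) c :
  @yext_push K n.+1 A _ _ (scale c 0) E F <-> cls F = comp (scale c n.+1) (cls E).
Proof.
split=> [[F0 [M FF0]]|FE].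
  apply: coresolution_uniq (yext_equiv_refl _) _ (mor_scale E c).
  have F0F : exseq_mor F0 std (cls F) (idm _).
    have [g Mg] := cls_ex F0.
    by rewrite (coresolution_uniq (yext_equiv_sym FF0) (clsP F) Mg).
  by have := exseq_mor_comp M F0F; rewrite comp1m compm1.
have [P [PM PU]] := exseq_pull lifts kernels negs std (cls F).
exists P; split; last by apply: coresolution_inj PM (clsP F).
by apply: PU; rewrite compm1 FE; apply: mor_scale.
Qed.

Let add_cls (F G E : exseq n A (Z 0)) :
  @yext_add K n.+1 A _ F G E <-> cls E = addm (cls F) (cls G).
Proof.
pose diag : hom A (dsum A A) := addm inlm inrm.
pose w := addm (comp (cls F) prlm) (comp (cls G) prrm).
have wE : comp w diag = addm (cls F) (cls G).
  apply: app_inj => x; rewrite appM !app_addm /= !appM !raddfD.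
  by rewrite !app_prl_inl !app_prr_inr !app_prl_inr !app_prr_inl !raddf0 addr0 add0r.
split=> [[H [[H' [M HH']] [E' [N EE']]]]|EE].
  have E'E : exseq_mor E' std (cls E) (idm _).
    have [g Mg] := cls_ex E'.
    by rewrite (coresolution_uniq (yext_equiv_sym EE') (clsP E) Mg).
  have M1 := exseq_mor_comp N E'E; have M2 := exseq_mor_comp M (mor_dsum F G).
  rewrite compm1 comp1m in M1; rewrite compm1 in M2.
  by rewrite -wE; apply/esym/(coresolution_uniq HH' M2 M1).
have [H [HM HU]] := exseq_pull lifts kernels negs (exseq_dsum F G) diag.
exists H; split; first by exists H; split=> //; apply: yext_equiv_refl.
have [P [PM PU]] := exseq_pull lifts kernels negs std (cls E).
exists P; split; last by apply: coresolution_inj PM (clsP E).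
apply: PU; rewrite compm1 EE -wE -[addm prlm prrm]compm1.
exact: exseq_mor_comp HM (mor_dsum F G).
Qed.

Let lincomb_cls (s : seq (k * exseq n A (Z 0))) (E : exseq n A (Z 0)) :
  @yext_lincomb K k n.+1 A (Z 0) (scale^~ 0) s E <->
  forall x, app (cls E) x = \sum_(p <- s) app (scale p.1 n.+1) (app (cls p.2) x).
Proof.
elim: s E => [|[c E0] s IH] E /=.
  (* The empty combination is expressed as being fixed by the scalar 0. That this scalar also kills
     [cls E] is forced by uniqueness, the zero morphism lying over the same zero map of [Z 0]. *)
  have scale0E : comp (scale 0 n.+1) (cls E) = zerom _ _.
    apply: coresolution_uniq (yext_equiv_refl _) (mor_scale E 0) _.
    apply: exseq_mor_eq (exseq_mor_zero E std) => x //.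
    by rewrite app_zerom scale0.
  apply: iff_trans (push_cls E E 0) _; rewrite scale0E.
  split=> [-> x|E0]; first by rewrite app_zerom big_nil.
  by apply: app_inj => x; rewrite E0 app_zerom big_nil.
split=> [[F [G [/push_cls cF /IH cG /add_cls cE]]] x|cE].
  by rewrite cE app_addm /= cG cF appM big_cons.
have [F MF] := coresolution_surj (comp (scale c n.+1) (cls E0)).
have [d dE] := hom_sub negs (cls E) (comp (scale c n.+1) (cls E0)).
have [G MG] := coresolution_surj d.
exists F, G; split.
- by apply/push_cls/cls_eq.
- by apply/IH => x; rewrite (cls_eq MG) dE cE appM big_cons addrC addKr.
apply/add_cls/app_inj => x; rewrite (cls_eq MF) (cls_eq MG) app_addm /= dE.
by rewrite addrC subrK.
Qed.

Lemma Ext_finite_dim_hom : @Ext_finite_dim K k n.+1 A (Z 0) (scale^~ 0) <->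
  exists ss : seq (hom A (Z n.+1)), forall s, exists cs : seq k, size cs = size ss /\
    forall x, app s x = \sum_(p <- zip cs ss) app (scale p.1 n.+1) (app p.2 x).
Proof.
have zip_cls (cs : seq k) (es : seq (exseq n A (Z 0))) x :
    \sum_(p <- zip cs es) app (scale p.1 n.+1) (app (cls p.2) x) =
    \sum_(p <- zip cs (map cls es)) app (scale p.1 n.+1) (app p.2 x).
  by elim: cs es => [|c cs IH] [|e es]; rewrite /= ?big_nil ?big_cons ?IH.
split=> [[es esP]|[ss ssP]].
  exists (map cls es) => s; have [E ME] := coresolution_surj s.
  have [cs [size_cs /lincomb_cls csE]] := esP E; exists cs.
  by rewrite size_map; split=> // x; rewrite -zip_cls -csE (cls_eq ME).
have [ext extP] := choice coresolution_surj.
have clsK : cancel ext cls by move=> s; apply/cls_eq.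
exists (map ext ss) => E; have [cs [size_cs csE]] := ssP (cls E).
exists cs; rewrite size_map; split=> //; apply/lincomb_cls => x.
by rewrite csE zip_cls -map_comp (eq_map (g := id)) ?map_id.
Qed.

End ExtAsHom.

(** * Modules and tensor products *)

Section ModuleMaps.
Variable R : pzRingType.
Implicit Types A X W : lmodType R.

Lemma linear_lift A X W (i : {linear A -> X}) (h : {linear W -> X}) :
  injective i -> (forall w, exists a, i a = h w) ->
  exists g : {linear W -> A}, forall w, i (g w) = h w.
Proof.
move=> iI /choice[g gE].
have gl : linear g by move=> a u v; apply: iI; rewrite linearP !gE linearP.
by exists (mklin gl).
Qed.

Lemma linear_descent A X W (p : {linear X -> A}) (h : {linear X -> W}) :
  (forall a, exists x, p x = a) -> (forall x, p x = 0 -> h x = 0) ->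
  exists g : {linear A -> W}, forall x, g (p x) = h x.
Proof.
move=> /choice[s sE] ph.
have hE x y : p x = p y -> h x = h y.
  move=> E; apply/eqP; rewrite -subr_eq0 -linearB; apply/eqP/ph.
  by rewrite linearB E subrr.
have gl : linear (h \o s).
  by move=> a u v; rewrite /= -linearP; apply: hE; rewrite linearP !sE.
by exists (mklin gl) => x; apply: hE.
Qed.

Section Submodule.
Variables (M : lmodType R) (S : M -> Prop).
Hypothesis S0 : S 0.
Hypothesis SP : forall a x y, S x -> S y -> S (a *: x + y).

(** The closure hypotheses are arguments of the predicate, so that the submodule instance can be
    attached to it. *)
Definition submodule_pred of S 0 & (forall a x y, S x -> S y -> S (a *: x + y)) :
  pred M := fun x => `[< S x >].
Let P := submodule_pred S0 SP.

Lemma submodule_closed : submod_closed P.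
Proof.
split; first exact/asboolP.
by move=> a x y /asboolP Sx /asboolP Sy; apply/asboolP; apply: SP.
Qed.
HB.instance Definition _ := GRing.isSubmodClosed.Build R M P submodule_closed.

Record submodule := Submodule { submodule_val : M; _ : submodule_val \in P }.
HB.instance Definition _ := [isSub for submodule_val].
HB.instance Definition _ := [Choice of submodule by <:].
HB.instance Definition _ := [SubChoice_isSubLmodule of submodule by <:].

Definition submodule_incl : {linear submodule -> M} := val.

Lemma submodule_incl_inj : injective submodule_incl.
Proof. exact: val_inj. Qed.
Lemma submodule_inclP x : S x <-> exists u, submodule_incl u = x.
Proof.
split=> [/asboolP Sx|[u <-]]; first by exists (@Submodule x Sx).
by case: u => y Sy; apply/asboolP.
Qed.

End Submodule.

Lemma modcat_lifts : has_lifts (modcat R).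
Proof.
move=> A X W i h iI hW; have [g gE] := linear_lift (h := h) iI hW.
by exists g; apply/compP => w; apply: gE.
Qed.

Lemma modcat_descents : has_descents (modcat R).
Proof.
move=> A X W p h pS hX; have [g gE] := linear_descent (h := h) pS hX.
by exists g; apply/compP => w; apply: gE.
Qed.

Lemma modcat_negatives : has_negatives (modcat R).
Proof. by move=> A B f; exists (\- f : {linear A -> B}). Qed.

Lemma modcat_kernels : has_kernels (modcat R).
Proof.
move=> X Y f.
have f0 : app f 0 = 0 by rewrite raddf0.
have fP a x y : app f x = 0 -> app f y = 0 -> app f (a *: x + y) = 0.
  by move=> x0 y0; rewrite [LHS]linearP -/(app f x) -/(app f y) x0 y0 scaler0 addr0.
exists (submodule f0 fP : lmodType R), (submodule_incl f0 fP).
split; first exact: submodule_incl_inj.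
by move=> x; apply: submodule_inclP.
Qed.

End ModuleMaps.

Section TensorExactness.
Variable k : fieldType.
Implicit Types U V W X : lmodType k.

Lemma kernel_projector V W (g : {linear V -> W}) : exists s : {linear W -> V},
  forall v, g (v - s (g v)) = 0.
Proof.
have [s sE] := generalized_inverse g.
by exists s => v; rewrite linearB sE subrr.
Qed.

(** Over a field an exact pair has a contracting homotopy at its middle term. Tensoring preserves
    the homotopy, whence the exactness lemmas below. *)
Lemma exact_splitting U V W (f : {linear U -> V}) (g : {linear V -> W}) :
  (forall v, g v = 0 -> exists u, f u = v) ->
  exists (r : {linear V -> U}) (s : {linear W -> V}), forall v, v = f (r v) + s (g v).
Proof.
move=> ex; have [s sE] := kernel_projector g; have [r rE] := generalized_inverse f.
have dl : linear (fun v => v - s (g v)).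
  by move=> a u v; rewrite (linearP g) (linearP s) opprD addrACA scalerBr.
exists (r \o mklin dl), s => v; have [u uE] := ex _ (sE v).
by rewrite /= /lin_of -uE rE uE subrK.
Qed.

Lemma tmap_exactr U V W X (f : {linear U -> V}) (g : {linear V -> W}) (z : tensor X V) :
  (forall v, g v = 0 -> exists u, f u = v) ->
  tmap idfun g z = 0 -> exists y, tmap idfun f y = z.
Proof.
move=> /exact_splitting[r [s E]] z0; exists (tmap idfun r z).
rewrite tmap_comp.
have : tmap (idfun \o idfun) (f \o r) z + tmap idfun s (tmap idfun g z) = z.
  apply: (tensor_ext (f := tmap (idfun \o idfun) (f \o r) \+ (tmap idfun s \o tmap idfun g))
    (g := idfun)) => x v /=.
  by rewrite !tmapE /= -linearDr -E.
by rewrite z0 linear0 addr0.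
Qed.

Lemma tmap_exactl U V W X (f : {linear U -> V}) (g : {linear V -> W}) (z : tensor V X) :
  (forall v, g v = 0 -> exists u, f u = v) ->
  tmap g idfun z = 0 -> exists y, tmap f idfun y = z.
Proof.
move=> /exact_splitting[r [s E]] z0; exists (tmap r idfun z).
rewrite tmap_comp.
have : tmap (f \o r) (idfun \o idfun) z + tmap s idfun (tmap g idfun z) = z.
  apply: (tensor_ext (f := tmap (f \o r) (idfun \o idfun) \+ (tmap s idfun \o tmap g idfun))
    (g := idfun)) => v x /=.
  by rewrite !tmapE /= -linearDl -E.
by rewrite z0 linear0 addr0.
Qed.

Lemma tmap_injr U V X (f : {linear U -> V}) : injective f ->
  injective (tmap (@idfun X) f).
Proof.
move=> /linear_retraction[r rE]; apply: (can_inj (g := tmap idfun r)) => z.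
by rewrite tmap_comp -[RHS]tmap_id; apply: tmap_ext => // u; apply: rE.
Qed.

Lemma tmap_surjr U V X (f : {linear U -> V}) : (forall v, exists u, f u = v) ->
  forall z : tensor X V, exists y, tmap idfun f y = z.
Proof.
move=> /linear_section[s sE] z; exists (tmap idfun s z).
by rewrite tmap_comp -[RHS]tmap_id; apply: tmap_ext => // u; apply: sE.
Qed.

Lemma tmap_surjl U V X (f : {linear U -> V}) : (forall v, exists u, f u = v) ->
  forall z : tensor V X, exists y, tmap f idfun y = z.
Proof.
move=> /linear_section[s sE] z; exists (tmap s idfun z).
by rewrite tmap_comp -[RHS]tmap_id; apply: tmap_ext => // u; apply: sE.
Qed.

End TensorExactness.

(** * Comodules *)

Section TensorSeparation.
Variable k : fieldType.
Implicit Types U V W D M : lmodType k.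

Lemma tpure0l U V (v : V) : (0 : U) ⊗ v = 0. Proof. exact: (linear0l (@tpure k U V)). Qed.
Lemma tpure0r U V (u : U) : u ⊗ (0 : V) = 0. Proof. exact: (linear0r (@tpure k U V)). Qed.
Lemma tpureBl U V (u u' : U) (v : V) : (u - u') ⊗ v = u ⊗ v - u' ⊗ v.
Proof. exact: (linearBl (@tpure k U V)). Qed.
Lemma tpureZl U V a (u : U) (v : V) : (a *: u) ⊗ v = a *: (u ⊗ v).
Proof. exact: (linearZl_LR (@tpure k U V)). Qed.
Lemma tpureZr U V a (u : U) (v : V) : u ⊗ (a *: v) = a *: (u ⊗ v).
Proof. exact: (linearZr_LR (@tpure k U V)). Qed.

Lemma tmap_compr U V V' V'' (g : {linear V' -> V''}) (f : {linear V -> V'}) (x : tensor U V) :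
  tmap idfun (g \o f) x = tmap idfun g (tmap idfun f x).
Proof. by rewrite tmap_comp; apply: tmap_ext. Qed.
Lemma tmap_compl U V V' V'' (g : {linear V' -> V''}) (f : {linear V -> V'}) (x : tensor V U) :
  tmap (g \o f) idfun x = tmap g idfun (tmap f idfun x).
Proof. by rewrite tmap_comp; apply: tmap_ext. Qed.
Lemma tmap_idr U V (f : {linear V -> V}) (x : tensor U V) : f =1 id -> tmap idfun f x = x.
Proof. by move=> f1; rewrite -[RHS]tmap_id; apply: tmap_ext. Qed.
Lemma tmap_idl U V (f : {linear U -> U}) (x : tensor U V) : f =1 id -> tmap f idfun x = x.
Proof. by move=> f1; rewrite -[RHS]tmap_id; apply: tmap_ext. Qed.
Lemma tmap_swap U U' V V' (g : {linear V -> V'}) (f : {linear U -> U'}) (x : tensor U V) :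
  tmap idfun g (tmap f idfun x) = tmap f idfun (tmap idfun g x).
Proof. by rewrite !tmap_comp; apply: tmap_ext. Qed.
Lemma tassoc_natr U V W W' (h : {linear W -> W'}) (x : tensor (tensor U V) W) :
  tassoc (tmap idfun h x) = tmap idfun (tmap idfun h) (tassoc x).
Proof.
rewrite -(tassoc_nat idfun idfun h); congr tassoc.
by apply: tmap_ext => // y /=; rewrite tmap_id.
Qed.

Lemma tensor_unitl V (z : tensor k^o V) : z = (1 : k^o) ⊗ tunitl z.
Proof.
have l : linear (fun z : tensor k^o V => (1 : k^o) ⊗ tunitl z).
  by move=> a x y; rewrite (linearP (@tunitl k V)) (linearPr (@tpure k _ V)).
apply: (tensor_ext (f := idfun) (g := mklin l)) => a v.
by rewrite /= /lin_of tunitlE tpureZr -tpureZl [a *: _]mulr1.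
Qed.
Lemma tensor_unitr V (z : tensor V k^o) : z = tunitr z ⊗ (1 : k^o).
Proof.
have l : linear (fun z : tensor V k^o => tunitr z ⊗ (1 : k^o)).
  by move=> a x y; rewrite (linearP (@tunitr k V)) (linearPl (@tpure k V _)).
apply: (tensor_ext (f := idfun) (g := mklin l)) => v a.
by rewrite /= /lin_of tunitrE tpureZl -tpureZr [a *: _]mulr1.
Qed.

Lemma tmap_zerol U U' V V' (f : {linear U -> U'}) (g : {linear V -> V'}) x :
  f =1 \0 -> tmap f g x = 0.
Proof.
move=> f0; apply: (tensor_ext (f := tmap f g) (g := \0)) => u v.
by rewrite /= tmapE f0 tpure0l.
Qed.

(** Induction on the number of pure terms. Choose [f] with value 1 on the first entry [d]: the
    projection [x - f x *: d] fixes z, because [f] contracts z to zero, and kills the first term, so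
    z has an expression with one term fewer. *)
Lemma tensor_separated D M (z : tensor D M) :
  (forall f : {linear D -> k^o}, tunitl (tmap f idfun z) = 0) -> z = 0.
Proof.
have [s ->] := tensor_span z; have [r] := ubnP (size s).
elim: r s => // r IH [|[d m] s] /=; first by rewrite big_nil.
rewrite ltnS => sr sep.
case: (eqVneq d 0) sep => [->|/eqP d0] sep.
  rewrite big_cons /= tpure0l add0r; apply: IH => // f.
  by have := sep f; rewrite big_cons /= tpure0l add0r.
have [||f [_ fd]] := @separating_functional k D (fun x => x = 0) d.
- by split=> // a x y -> ->; rewrite scaler0 addr0.
- by [].
have el : linear (fun x => x - f x *: d).
  by move=> a x y; rewrite (linearP f) scalerDl scalerBr scalerA opprD addrACA.
have eE (x : tensor D M) : tmap (mklin el) idfun x = x - d ⊗ tunitl (tmap f idfun x).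
  have gl : linear (fun x : tensor D M => x - d ⊗ tunitl (tmap f idfun x)).
    move=> a x1 x2; rewrite (linearP (tmap f idfun)) (linearP (@tunitl k M)).
    by rewrite (linearPr (@tpure k D M)) opprD addrACA scalerBr.
  apply: (tensor_ext (f := tmap (mklin el) idfun) (g := mklin gl)) => u v.
  rewrite /= /lin_of !tmapE tunitlE /= /lin_of tpureBl /=; congr (_ - _).
  by rewrite tpureZl tpureZr.
have := eE (\sum_(p <- (d, m) :: s) p.1 ⊗ p.2); rewrite sep tpure0r subr0 => zE.
have {zE} zE : \sum_(p <- (d, m) :: s) p.1 ⊗ p.2 =
    \sum_(p <- [seq (mklin el p.1, p.2) | p <- s]) p.1 ⊗ p.2.
  rewrite -zE linear_sum big_cons big_map /= tmapE /= /lin_of fd scale1r subrr tpure0l add0r.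
  by apply: eq_bigr => p _; rewrite tmapE.
by rewrite zE; apply: IH; rewrite ?size_map // => f'; rewrite -zE.
Qed.

End TensorSeparation.

Section ComoduleProperties.
Variables (k : fieldType) (C : coalgebra k).

Lemma subcomodule_axioms (M : comodule C) (K : lmodType k) (i : {linear K -> M})
    (rho : {linear K -> tensor C K}) :
  injective i -> (forall x, tmap idfun i (rho x) = coact (i x)) ->
  (forall x, tassoc (tmap comul idfun (rho x)) = tmap idfun rho (rho x)) /\
  (forall x, tunitl (tmap counit idfun (rho x)) = x).
Proof.
move=> iI rhoE; split=> x.
  apply: (tmap_injr (tmap_injr iI)).
  rewrite -(tassoc_nat idfun idfun i) tmap_comp.
  transitivity (tassoc (tmap comul idfun (coact (i x)))).
    rewrite -rhoE tmap_comp; congr tassoc.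
    by apply: tmap_ext => // c; rewrite /= tmap_id.
  rewrite coactA -rhoE !tmap_comp; apply: tmap_ext => // y /=.
  by rewrite rhoE.
apply: iI; rewrite -tunitl_nat tmap_comp -[RHS]coact_counit -rhoE tmap_comp.
by congr tunitl; apply: tmap_ext.
Qed.

Lemma quotient_comodule_axioms (M : comodule C) (Q : lmodType k) (p : {linear M -> Q})
    (rho : {linear Q -> tensor C Q}) :
  (forall q, exists x, p x = q) -> (forall x, rho (p x) = tmap idfun p (coact x)) ->
  (forall x, tassoc (tmap comul idfun (rho x)) = tmap idfun rho (rho x)) /\
  (forall x, tunitl (tmap counit idfun (rho x)) = x).
Proof.
move=> pS rhoE; split=> q; have [x <-] := pS q.
  exact: (coactA_image (rho := rho) rhoE).
exact: (coact_counit_image (rho := rho) rhoE).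
Qed.

Lemma comodcat_lifts : has_lifts (comodcat C).
Proof.
move=> A X W i h iI hW; have [g gE] := linear_lift (i := i : {linear _ -> _}) (h := h) iI hW.
have gC w : coact (g w) = tmap idfun g (coact w).
  apply: (tmap_injr (f := i : {linear _ -> _}) iI).
  rewrite -comod_funE gE comod_funE tmap_comp.
  by apply: tmap_ext => // y; rewrite /= gE.
by exists (ComodHom gC); apply/compP => w; apply: gE.
Qed.

Lemma comodcat_descents : has_descents (comodcat C).
Proof.
move=> A X W p h pS hX.
have [g gE] := linear_descent (p := p : {linear _ -> _}) (h := h) pS hX.
have gC a : coact (g a) = tmap idfun g (coact a).
  have [x <-] := pS a; rewrite -[app p x]/(comod_fun p x) gE !comod_funE tmap_comp.
  by apply: tmap_ext => // y; rewrite /= gE.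
by exists (ComodHom gC); apply/compP => w; apply: gE.
Qed.

Lemma comodcat_negatives : has_negatives (comodcat C).
Proof.
move=> A B f; exists (comp (comod_scale B (-1) : @hom (comodcat C) B B) f) => x.
by rewrite appM [LHS]scaleN1r.
Qed.

(** The coaction restricts to the linear kernel because tensoring with [C] is exact. *)
Lemma comodcat_kernels : has_kernels (comodcat C).
Proof.
move=> X Y f; pose fl : {linear X -> Y} := comod_fun f.
have f0 : fl 0 = 0 by rewrite linear0.
have fP a x y : fl x = 0 -> fl y = 0 -> fl (a *: x + y) = 0.
  by move=> x0 y0; rewrite linearP x0 y0 scaler0 addr0.
pose Ker : lmodType k := submodule f0 fP.
pose i : {linear Ker -> X} := submodule_incl f0 fP.
have iI : injective i by apply: submodule_incl_inj.
have [||rho rhoE] := linear_lift (i := tmap idfun i) (h := coact \o i).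
- exact: tmap_injr.
- move=> x; apply: (tmap_exactr (g := fl)).
    by move=> v /(submodule_inclP f0 fP).
  have fi0 : fl (i x) = 0 by apply/(submodule_inclP f0 fP); exists x.
  by rewrite /= -comod_funE -/fl fi0 linear0.
have [rhoA rho1] := subcomodule_axioms iI rhoE.
exists (Comodule rhoA rho1).
exists (@ComodHom _ _ (Comodule rhoA rho1) X i (fun x => esym (rhoE x))).
by split=> // x; apply: submodule_inclP.
Qed.

Lemma regular_counit (c : C) : tunitl (tmap counit idfun (comul c)) = c.
Proof. exact: counitl. Qed.
Definition regular_comodule : comodule C := Comodule (@comulA k C) regular_counit.

Section Cofree.
Variable V : lmodType k.

Definition cofree_coact : {linear tensor C V -> tensor C (tensor C V)} :=
  @tassoc _ C C V \o tmap comul idfun.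

Definition tensor_right (v : V) : {linear C -> tensor C V} := mklin (@tpure_linearl k C V v).

Lemma cofree_coactE c v : cofree_coact (c ⊗ v) = tmap idfun (tensor_right v) (comul c).
Proof.
rewrite /= tmapE /=.
have l : linear (fun z : tensor C C => tassoc (z ⊗ v)).
  by move=> a x y; rewrite linearPl linearP.
apply: (tensor_ext (f := mklin l) (g := tmap idfun (tensor_right v))) => a b.
by rewrite /= /lin_of tassocE tmapE.
Qed.

(** A pure tensor with second entry [v] is an image under [tensor_right v], which carries the
    comultiplication of the regular comodule to [cofree_coact]; so the axiom for [C] suffices. *)
Lemma cofree_coactA (x : tensor C V) :
  tassoc (tmap comul idfun (cofree_coact x)) = tmap idfun cofree_coact (cofree_coact x).
Proof.
apply: (tensor_ext (f := @tassoc _ _ _ _ \o (tmap comul idfun \o cofree_coact))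
  (g := tmap idfun cofree_coact \o cofree_coact)) => c v.
exact: (@coactA_image _ _ regular_comodule _ cofree_coact (tensor_right v)
  (fun c' => cofree_coactE c' v)).
Qed.
Lemma cofree_counit (x : tensor C V) : tunitl (tmap counit idfun (cofree_coact x)) = x.
Proof.
apply: (tensor_ext (f := @tunitl _ _ \o (tmap counit idfun \o cofree_coact))
  (g := idfun)) => c v.
exact: (@coact_counit_image _ _ regular_comodule _ cofree_coact (tensor_right v)
  (fun c' => cofree_coactE c' v)).
Qed.
Definition cofree_comodule : comodule C := Comodule cofree_coactA cofree_counit.

Lemma coinduced_subproof (M : comodule C) (f : {linear M -> V}) m :
  cofree_coact ((tmap idfun f \o coact) m) = tmap idfun (tmap idfun f \o coact) (coact m).
Proof.
by rewrite tmap_compr /= -coactA -tassoc_natr tmap_swap.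
Qed.
(** The comodule map adjoint to the linear map [f]. Extension problems into a cofree comodule
    thereby become linear ones. *)
Definition coinduced (M : comodule C) (f : {linear M -> V}) : comod_hom M cofree_comodule :=
  @ComodHom _ _ M cofree_comodule (tmap idfun f \o coact) (coinduced_subproof f).

Definition cofree_proj : {linear tensor C V -> V} := @tunitl _ V \o tmap counit idfun.

Lemma cofree_projE c v : cofree_proj (c ⊗ v) = counit c *: v.
Proof. by rewrite /= tmapE tunitlE. Qed.

Lemma cofree_proj_coact (x : tensor C V) : tmap idfun cofree_proj (cofree_coact x) = x.
Proof.
apply: (tensor_ext (f := tmap idfun cofree_proj \o cofree_coact) (g := idfun)) => c v.
rewrite -[LHS]/(tmap idfun cofree_proj (cofree_coact (c ⊗ v))) cofree_coactE -tmap_compr.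
rewrite -[RHS]/(tensor_right v c) -[in RHS](counitr c).
apply: (tensor_ext (f := tmap idfun (cofree_proj \o tensor_right v))
  (g := tensor_right v \o (@tunitr _ _ \o tmap idfun counit))) => a b.
by rewrite /= !tmapE tunitrE /= /lin_of tmapE tunitlE tpureZl tpureZr.
Qed.

Lemma cofree_hom_coinduced (M : comodule C) (h : comod_hom M cofree_comodule) m :
  h m = coinduced (cofree_proj \o h) m.
Proof.
rewrite -[LHS]cofree_proj_coact -[cofree_coact _]/(coact (h m)) comod_funE.
by rewrite -tmap_compr.
Qed.

Lemma cofree_injective : @injective_object (comodcat C) cofree_comodule.
Proof.
move=> A B S u; pose i : {linear B -> comod_space (ses_mid S)} := comod_fun (ses_inj S).
have [v vE] := linear_extension (cofree_proj \o (u : comod_hom _ _))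
  (@ses_injI _ _ _ S : injective i).
exists (coinduced v); apply/compP => b.
rewrite [RHS]cofree_hom_coinduced -[LHS]/(tmap idfun v (coact (i b))) comod_funE.
by rewrite -tmap_compr; apply: tmap_ext.
Qed.

End Cofree.

Section QuotientComodule.
Variables (M N : comodule C) (f : comod_hom M N).

Definition coker_coact_subproof u : (tmap idfun (coker_pi f) \o coact) (f u) = 0.
Proof.
rewrite /= comod_funE -tmap_compr; apply: tmap_zero => x /=.
by rewrite -(linear0 (coker_pi f)); apply/coker_pi_eq; exists x; rewrite subr0.
Qed.
Definition coker_coact : {linear coker f -> tensor C (coker f)} :=
  coker_lift coker_coact_subproof.
Lemma coker_coactE x : coker_coact (coker_pi f x) = tmap idfun (coker_pi f) (coact x).
Proof. exact: coker_liftE. Qed.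
Definition coker_comodule : comodule C :=
  let ax := quotient_comodule_axioms (@coker_pi_surj _ _ _ f) coker_coactE in
  Comodule ax.1 ax.2.
Definition coker_comod_pi : comod_hom N coker_comodule :=
  @ComodHom _ _ N coker_comodule (coker_pi f) coker_coactE.

Lemma coker_is_ses : injective f ->
  @is_ses (comodcat C) M N coker_comodule f coker_comod_pi.
Proof.
move=> fI; split=> //; first exact: coker_pi_surj.
move=> x; split=> [|[u <-]].
  by rewrite -[RHS](linear0 (coker_pi f)) => /coker_pi_eq[u]; rewrite subr0 => ->; exists u.
by rewrite -(linear0 (coker_pi f)); apply/coker_pi_eq; exists u; rewrite subr0.
Qed.

End QuotientComodule.

End ComoduleProperties.

(** * The minimal coresolution of the trivial comodule *)

Section Conilpotency.
Variables (k : fieldType) (C : coalgebra k) (gamma : coaugmentation C).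

(** Membership in the augmentation ideal of the dual algebra. *)
Definition aug_dual (f : dual C) := f (gamma 1) = 0.

Definition quot_dual (g : {linear coaug_quotient gamma -> k^o}) : dual C :=
  g \o (coker_pi gamma : {linear C -> coaug_quotient gamma}).

(** The order is reversed since the product of [dual C] evaluates its right factor on c_(1): the
    head of the list meets the first tensor factor, and acts first on a comodule. *)
Fixpoint dual_prod (fs : seq (dual C)) : dual C :=
  if fs is f :: fs' then dual_prod fs' * f else 1.

Fixpoint tpow_eval (D : lmodType k) m (fs : seq {linear D -> k^o}) : {linear tpow D m -> k^o} :=
  match m return {linear tpow D m -> k^o} with
  | 0 => head 0 fs
  | m'.+1 => fpair (tpow_eval m' (behead fs)) (head 0 fs)
  end.

Lemma fpair_tmap (U U' V V' : lmodType k) (f : {linear V' -> k^o}) (g : {linear U' -> k^o})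
    (a : {linear U -> U'}) (b : {linear V -> V'}) x :
  fpair f g (tmap a b x) = fpair (f \o b) (g \o a) x.
Proof.
apply: (tensor_ext (f := fpair f g \o tmap a b) (g := fpair (f \o b) (g \o a))) => u v /=.
by rewrite tmapE !fpairE.
Qed.

Lemma fpair_ext (U V : lmodType k) (f f' : {linear V -> k^o}) (g g' : {linear U -> k^o}) :
  f =1 f' -> g =1 g' -> fpair f g =1 fpair f' g'.
Proof. by move=> /linear_ext -> /linear_ext ->. Qed.

Lemma iter_comul_eval m (fs : seq {linear coaug_quotient gamma -> k^o}) (c : C) :
  size fs = m.+1 ->
  tpow_eval m fs (iter_comul (coaug_quotient gamma) m (coker_pi gamma c)) =
  dual_prod [seq quot_dual f | f <- fs] c.
Proof.
elim: m fs c => [|m IH] [|f [|f' fs]] c //.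
  by move=> _; rewrite -[RHS]/((1 * quot_dual f) c) mul1r.
move=> [sfs]; have {}IH c' : tpow_eval m (f' :: fs) _ = _ := IH (f' :: fs) c' (congr1 S sfs).
rewrite -[LHS]/(fpair (tpow_eval m (f' :: fs)) f (tmap idfun
  (iter_comul (coaug_quotient gamma) m) (quot_comul gamma (coker_pi gamma c)))).
rewrite quot_comulE !fpair_tmap.
by apply: fpair_ext => c' /=; rewrite ?IH.
Qed.

Hypothesis conil : conilpotent gamma.

(** Functionals vanishing at [gamma 1] factor through C / gamma(k), so a product of them is
    evaluated through an iterated comultiplication there, and conilpotence makes one of these vanish
    on [c]. All longer lists are included, so that finitely many elements have a common bound. *)
Lemma conilpotent_dual_prod (c : C) : exists m, forall fs : seq (dual C),
  (m <= size fs)%N -> (forall f, f \in fs -> aug_dual f) -> dual_prod fs c = 0.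
Proof.
have [m [_ m0]] := conil (coker_pi gamma c); exists m.+1 => fs.
have [r] := ubnP (size fs - m.+1); elim: r fs => // r IH fs.
rewrite ltnS => sr mfs aug.
have [fsm|fsm] := eqVneq (size fs) m.+1; last first.
  case: fs => [|f [|f' fs]] // in sr mfs aug fsm *.
    by case: m {m0 IH} sr mfs fsm.
  (* Merging two factors shortens the product, and f' * f still kills gamma 1. *)
  have -> : dual_prod [:: f, f' & fs] = dual_prod ((f' * f) :: fs).
    by rewrite /= mulrA.
  apply: IH.
  - by rewrite /= in sr mfs fsm *; lia.
  - by rewrite /= in sr mfs fsm *; lia.
  move=> g; rewrite inE => /orP[/eqP ->|gfs]; last by apply: aug; rewrite !inE gfs !orbT.
  rewrite /aug_dual -[LHS]/(fpair f' f (comul (gamma 1))) coaug_comul fpairE.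
  by rewrite (aug f) ?inE ?eqxx // mulr0.
have fE (f : dual C) : aug_dual f -> exists g : {linear coaug_quotient gamma -> k^o},
    f = quot_dual g.
  move=> f0; have fg a : f (gamma a) = 0.
    by rewrite -[a]mulr1 -[a * 1]/(a *: (1 : k^o)) !linearZ /= f0 scaler0.
  exists (coker_lift fg); apply: linear_ext => x.
  by rewrite /= coker_liftE.
have [gs gsE] : exists gs : seq {linear coaug_quotient gamma -> k^o},
    fs = [seq quot_dual g | g <- gs].
  elim: fs aug {sr mfs fsm} => [|f fs IHf] aug; first by exists [::].
  have [g gE] := fE f (aug f (mem_head _ _)).
  have [gs gsE] := IHf (fun h hfs => aug h (mem_behead (s := f :: fs) hfs)).
  by exists (g :: gs); rewrite /= gE gsE.
rewrite gsE -(@iter_comul_eval m) ?m0 ?linear0 //.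
by rewrite -fsm gsE size_map.
Qed.

Section Action.
Variable M : comodule C.

Definition comod_act (f : dual C) : {linear M -> M} :=
  @tunitl _ M \o (tmap f idfun \o coact).

Lemma comod_actM f g x : comod_act g (comod_act f x) = comod_act (g * f) x.
Proof.
rewrite -[LHS]/(tunitl (tmap g idfun (coact (tunitl (tmap f idfun (coact x)))))).
rewrite -tunitl_nat tmap_swap -coactA.
pose L : {linear tensor (tensor C C) M -> M} := (@tunitl _ M \o
  (tmap g idfun \o (@tunitl _ (tensor C M) \o
  (tmap f idfun \o @tassoc _ C C M)))).
rewrite -[LHS]/(L (tmap comul idfun (coact x))).
apply: (tensor_ext (f := L \o tmap comul idfun)
  (g := @tunitl _ M \o tmap (g * f : dual C) idfun)) => c m.
rewrite -[LHS]/(L (tmap comul idfun (c ⊗ m))) tmapE -[RHS]/(tunitl (tmap _ idfun (c ⊗ m))).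
rewrite tmapE tunitlE -[(g * f) c]/(fpair g f (comul c)).
have l1 : linear (fun z : tensor C C => L (z ⊗ m)).
  by move=> a y y'; rewrite (linearPl (@tpure k _ M)) (linearP L).
apply: (tensor_ext (f := mklin l1) (g := lin_scalar m \o fpair g f)) => a b.
rewrite -[LHS]/(L (a ⊗ b ⊗ m)) /= tassocE !tmapE tunitlE /= linearZ /= tmapE linearZ /=.
by rewrite tunitlE fpairE scalerA mulrC.
Qed.

Fixpoint comod_acts (fs : seq (dual C)) (x : M) : M :=
  if fs is f :: fs' then comod_acts fs' (comod_act f x) else x.

Lemma comod_actsE fs x : comod_acts fs x = comod_act (dual_prod fs) x.
Proof.
elim: fs x => [|f fs IH] x /=; last by rewrite IH comod_actM.
by rewrite -[RHS]/(tunitl (tmap counit idfun (coact x))) coact_counit.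
Qed.

Lemma comod_acts_nilpotent (x : M) : exists m, forall fs : seq (dual C),
  (m <= size fs)%N -> (forall f, f \in fs -> aug_dual f) -> comod_acts fs x = 0.
Proof.
suff [m mP] : exists m, forall fs : seq (dual C), (m <= size fs)%N ->
    (forall f, f \in fs -> aug_dual f) ->
    tunitl (tmap (dual_prod fs) idfun (coact x)) = 0.
  by exists m => fs mfs aug; rewrite comod_actsE; apply: mP.
have [s ->] := tensor_span (coact x).
elim: s => [|[c y] s [m mP]].
  by exists 0%N => fs _ _; rewrite big_nil !linear0.
have [m' m'P] := conilpotent_dual_prod c; exists (maxn m m') => fs.
rewrite geq_max => /andP[mfs m'fs] aug.
rewrite big_cons !linearD /= mP // addr0 tmapE tunitlE m'P //.
exact: scale0r.
Qed.

Definition socle_mem (x : M) := coact x = gamma 1 ⊗ x.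

(** Every functional on C / gamma(k) contracts the image of [coact x] to zero, so that image
    vanishes and [coact x] comes from k ⊗ M. The counit axiom then determines its preimage. *)
Lemma socleP x : (forall f, aug_dual f -> comod_act f x = 0) -> socle_mem x.
Proof.
move=> x0.
have [y yE] : exists y : tensor k^o M, tmap gamma idfun y = coact x.
  apply: (tmap_exactl (g := coker_pi gamma)).
    by move=> c; rewrite -(linear0 (coker_pi gamma)) => /coker_pi_eq[a]; rewrite subr0; exists a.
  apply: tensor_separated => f; rewrite -tmap_compl; apply: x0.
  rewrite /aug_dual /= -[RHS](linear0 f); congr (f _).
  by rewrite -(linear0 (coker_pi gamma)); apply/coker_pi_eq; exists 1; rewrite subr0.
have yx : tunitl y = x.
  rewrite -(coact_counit x) -yE tmap_comp.
  have := tmap_ext (f := counit \o gamma) (f' := idfun) (g := idfun \o idfun) (g' := idfun)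
    (fun a => coalg_counit gamma a) (frefl _) y.
  by rewrite tmap_id => ->.
by rewrite /socle_mem -yE [y]tensor_unitl yx tmapE.
Qed.

End Action.
Arguments comod_act {M} f.

Lemma comod_act_hom (M N : comodule C) (h : comod_hom M N) f x :
  comod_act f (h x) = h (comod_act f x).
Proof. by rewrite /= comod_funE -tmap_swap tunitl_nat. Qed.

(** The augmentation ideal preserves the kernel of [h] and acts nilpotently on each element. By
    induction on the nilpotency bound it annihilates a given kernel element, which therefore lies in
    the socle. *)
Lemma comod_hom_socle_inj (M N : comodule C) (h : comod_hom M N) :
  (forall x, socle_mem x -> h x = 0 -> x = 0) -> injective h.
Proof.
move=> hs; suff ker0 x : h x = 0 -> x = 0.
  by move=> x y hxy; apply/eqP; rewrite -subr_eq0; apply/eqP/ker0; rewrite linearB hxy subrr.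
have [m] := comod_acts_nilpotent x; elim: m x => [|m IH] x mP hx0.
  by have := mP [::] isT; apply.
apply: hs => //; apply: socleP => f f0; apply: IH.
  move=> fs mfs aug; apply: (mP (f :: fs)); first by rewrite ltnS.
  by move=> g; rewrite inE => /orP[/eqP ->|/aug].
by rewrite -comod_act_hom hx0 linear0.
Qed.

End Conilpotency.
Arguments comod_act {k C M} f.

(** * Socles and injective envelopes of comodules *)

Section MinimalCoresolution.
Variables (k : fieldType) (C : coalgebra k) (gamma : coaugmentation C).

Section Socle.
Variable M : comodule C.

Lemma socle0 : socle_mem gamma (0 : M).
Proof. by rewrite /socle_mem linear0 tpure0r. Qed.
Lemma socle_closed a (x y : M) :
  socle_mem gamma x -> socle_mem gamma y -> socle_mem gamma (a *: x + y).
Proof.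
by rewrite /socle_mem => sx sy; rewrite linearP sx sy (linearPr (@tpure k C M)).
Qed.

Definition socle : lmodType k := submodule socle0 socle_closed.
Definition socle_incl : {linear socle -> M} := submodule_incl socle0 socle_closed.

Lemma socle_incl_inj : injective socle_incl.
Proof. exact: submodule_incl_inj. Qed.
Lemma socle_inclP x : socle_mem gamma x <-> exists u, socle_incl u = x.
Proof. exact: submodule_inclP. Qed.

Definition socle_retr : {linear M -> socle} :=
  sval (cid (linear_retraction socle_incl_inj)).
Lemma socle_inclK : cancel socle_incl socle_retr.
Proof. exact: svalP (cid (linear_retraction socle_incl_inj)). Qed.

(** The injective envelope of [M] when [gamma] is conilpotent: it is then injective, and its image
    contains the whole socle of the target. *)
Definition socle_embed : comod_hom M (cofree_comodule C socle) := coinduced socle_retr.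

Lemma socle_embedE x : socle_mem gamma x -> socle_embed x = gamma 1 ⊗ socle_retr x.
Proof. by move=> sx; rewrite /= sx tmapE. Qed.

Lemma socle_embed_inj : conilpotent gamma -> injective socle_embed.
Proof.
move=> conil; apply: (comod_hom_socle_inj conil) => _ /[dup] /socle_inclP[u <-] su.
rewrite socle_embedE // socle_inclK => /(congr1 (@cofree_proj _ C socle)).
by rewrite cofree_projE coalg_counit [_ *: _]scale1r linear0 => ->; rewrite linear0.
Qed.

Lemma socle_cofree (z : cofree_comodule C socle) :
  socle_mem gamma z -> exists x, socle_embed x = z.
Proof.
move=> sz; pose v := cofree_proj C socle z; exists (socle_incl v).
rewrite socle_embedE; last by apply/socle_inclP; exists v.
rewrite socle_inclK -[RHS]cofree_proj_coact -[cofree_coact _ _ z]/(coact z) sz.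
by rewrite [RHS]tmapE.
Qed.

Definition next_comodule : comodule C := coker_comodule socle_embed.

End Socle.

Variable M0 : comodule C.

Fixpoint mcomod (j : nat) : comodule C :=
  if j is j'.+1 then next_comodule (mcomod j') else M0.

Hypothesis conil : conilpotent gamma.

Definition mcomod_ses j : @ses (comodcat C) (mcomod j.+1) (mcomod j) :=
  Ses (coker_is_ses (@socle_embed_inj (mcomod j) conil)).

(** A map from a trivial comodule lands in the socle of the cofree term, which lies in the image of
    [mcomod j]. This supplies the minimality under which Ext is Hom into a cosyzygy. *)
Lemma mcomod_minimal (T : lmodType k) j
    (h : comod_hom (triv_comodule gamma T) (ses_mid (mcomod_ses j))) x :
  app (ses_sur (mcomod_ses j)) (h x) = 0.
Proof.
have [|y <-] := @socle_cofree (mcomod j) (h x).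
  by rewrite /socle_mem comod_funE triv_coactE tmapE.
exact: ses_sur_inj (mcomod_ses j) y.
Qed.

End MinimalCoresolution.
Arguments socle_incl {k C gamma M}.

Section MinimalExt.
Variables (k : fieldType) (C : coalgebra k) (gamma : coaugmentation C).
Hypothesis conil : conilpotent gamma.

Let K0 := triv_comodule gamma k^o.

Lemma socle_hom_subproof (M : comodule C) (u : socle gamma M) a :
  coact (lin_scalar (socle_incl u) a) = tmap idfun (lin_scalar (socle_incl u)) (coact (a : K0)).
Proof.
rewrite triv_coactE tmapE /= /lin_of linearZ tpureZr; congr (_ *: _).
by apply/socle_inclP; exists u.
Qed.
Definition socle_hom (M : comodule C) (u : socle gamma M) : comod_hom K0 M :=
  @ComodHom k C K0 M (lin_scalar (socle_incl u)) (socle_hom_subproof u).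

Lemma hom_socle (M : comodule C) (h : comod_hom K0 M) :
  exists u : socle gamma M, socle_incl u = h 1.
Proof. by apply/socle_inclP; rewrite /socle_mem comod_funE triv_coactE tmapE. Qed.

(** Ext becomes Hom from k into the cosyzygy, and such a map amounts to the image of 1, an arbitrary
    element of the socle. *)
Lemma mcomod_Ext_finite_dim n :
  comod_Ext_finite_dim n.+1 K0 K0 <-> finite_dim (socle gamma (mcomod gamma K0 n.+1)).
Proof.
have lin0 (h : comod_hom K0 (mcomod gamma K0 n.+1)) a : h a = a *: h 1.
  by rewrite -linearZ [a *: _]mulr1.
have sumE (cs : seq k) (ss : seq (comod_hom K0 (mcomod gamma K0 n.+1))) x :
    size cs = size ss ->
    \sum_(p <- zip cs ss) @app (comodcat C) _ _ (comod_scale _ p.1)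
      (@app (comodcat C) _ _ p.2 x) =
    \sum_(i < size ss) cs`_i *: (map (fun h : comod_hom K0 _ => h x) ss)`_i.
  elim: cs ss => [|c cs IH] [|h ss] //= E; first by rewrite big_nil big_ord0.
  by rewrite big_cons big_ord_recl /= IH //; case: E.
apply: iff_trans (Ext_finite_dim_hom (@comodcat_lifts k C) (@comodcat_descents k C)
  (@comodcat_kernels k C) (@comodcat_negatives k C) (S := mcomod_ses K0 conil) (n := n)
  (A := K0) _ _ (scale := fun c j => comod_scale (mcomod gamma K0 j) c) _ _) _.
- by move=> j; apply: cofree_injective.
- by move=> h x; apply: mcomod_minimal.
- move=> c j; apply/ses_morP; exists (comod_scale _ c).
  by split=> x; [rewrite [RHS]linearZ | rewrite [LHS]linearZ].
- by move=> x; apply: scale0r.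
apply: iff_trans _ (iff_sym (finite_dimP _)).
split=> [[ss ssP]|[e eP]].
  have [pre preP] := choice (@hom_socle (mcomod gamma K0 n.+1)).
  exists (map pre ss) => u; have [cs [size_cs csE]] := ssP (socle_hom u).
  exists (nth 0 cs); apply: socle_incl_inj.
  have := csE 1; rewrite sumE // [LHS]scale1r => ->.
  rewrite linear_sum size_map; apply: eq_bigr => i _.
  by rewrite linearZ !(nth_map (socle_hom 0)) // preP.
exists (map (@socle_hom _) e) => s; have [u uE] := hom_socle s; have [c cE] := eP u.
exists (mkseq c (size e)); rewrite size_mkseq size_map; split=> // x.
rewrite sumE ?size_mkseq ?size_map // [LHS]lin0 -uE cE !linear_sum.
apply: eq_bigr => i _; rewrite nth_mkseq // -map_comp (nth_map 0) //=.
by rewrite !linearZ /= !scalerA mulrC.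
Qed.

End MinimalExt.

(** * Right comodules and the cobar differential *)

Section TensorAssocInverse.
Variables (k : fieldType) (U V W : lmodType k).

Definition tensor_left (u : U) : {linear V -> tensor U V} := mklin (@tpure_linearr k U V u).

Lemma tassocV_linearl (z : tensor V W) : linear (fun u : U => tmap (tensor_left u) idfun z).
Proof.
move=> a u u'; have [s ->] := tensor_span z.
rewrite !(linear_sum (tmap _ _)) scaler_sumr -big_split.
apply: eq_bigr => p _ /=; rewrite !tmapE /= /lin_of (linearPl (@tpure k U V)).
by rewrite (linearPl (@tpure k (tensor U V) W)).
Qed.
Lemma tassocV_linearr (u : U) : linear (tmap (tensor_left u) (@idfun W)).
Proof. exact: linearP. Qed.
Definition tassocV : tensor U (tensor V W) -> tensor (tensor U V) W :=
  tlift (mkbil tassocV_linearl tassocV_linearr).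
HB.instance Definition _ := GRing.Linear.copy tassocV (tlift _).

Lemma tassocV_left u z : tassocV (u ⊗ z) = tmap (tensor_left u) idfun z.
Proof. exact: tliftE. Qed.
Lemma tassocVE u v w : tassocV (u ⊗ (v ⊗ w)) = u ⊗ v ⊗ w.
Proof. by rewrite tassocV_left tmapE. Qed.

Lemma tassocVK : cancel tassocV (@tassoc k U V W).
Proof.
apply: (tensor_ext (f := @tassoc _ _ _ _ \o tassocV) (g := idfun)) => u z.
have l1 : linear (fun z : tensor V W => tassoc (tassocV (u ⊗ z))).
  by move=> a x y; rewrite (linearPr (@tpure k U _)) !linearP.
apply: (tensor_ext (f := mklin l1) (g := mklin (@tpure_linearr k U _ u))) => v w.
by rewrite /= /lin_of tassocVE tassocE.
Qed.

Lemma tassocK : cancel (@tassoc k U V W) tassocV.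
Proof.
apply: (tensor_ext3 (f := tassocV \o @tassoc _ _ _ _) (g := idfun)) => u v w.
by rewrite /= tassocE tassocVE.
Qed.

End TensorAssocInverse.

Section RightComodules.
Variables (k : fieldType) (C : coalgebra k).

Record rcomodule := Rcomodule {
  rcomod_space :> lmodType k;
  rcoact : {linear rcomod_space -> tensor rcomod_space C};
  rcoactA : forall n, tassoc (tmap rcoact idfun (rcoact n)) = tmap idfun comul (rcoact n);
  rcoact_counit : forall n, tunitr (tmap idfun counit (rcoact n)) = n
}.

Arguments rcoact {r}.

Lemma tunitr_nat (V V' : lmodType k) (f : {linear V -> V'}) (x : tensor V k^o) :
  tunitr (tmap f idfun x) = f (tunitr x).
Proof.
apply: (tensor_ext (f := @tunitr _ V' \o tmap f idfun) (g := f \o @tunitr _ V)) => v a /=.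
by rewrite tmapE !tunitrE linearZ.
Qed.

Lemma tassoc_natl (U U' V W : lmodType k) (f : {linear U -> U'}) (x : tensor (tensor U V) W) :
  tassoc (tmap (tmap f idfun) idfun x) = tmap f idfun (tassoc x).
Proof.
rewrite (tassoc_nat f idfun idfun); apply: tmap_ext => // y.
exact: tmap_id.
Qed.

Section ImageAxioms.
Variables (M : rcomodule) (X : lmodType k).
Variables (rho : {linear X -> tensor X C}) (j : {linear M -> X}).
Hypothesis rho_j : forall m, rho (j m) = tmap j idfun (rcoact m).

Lemma rcoactA_image m :
  tassoc (tmap rho idfun (rho (j m))) = tmap idfun comul (rho (j m)).
Proof.
rewrite !rho_j tmap_swap -rcoactA -tassoc_natl -!tmap_compl; congr tassoc.
by apply: tmap_ext.
Qed.

Lemma rcoact_counit_image m : tunitr (tmap idfun counit (rho (j m))) = j m.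
Proof. by rewrite rho_j tmap_swap tunitr_nat rcoact_counit. Qed.

End ImageAxioms.

Definition regular_rcomodule : rcomodule := Rcomodule (@comulA k C) (@counitr k C).

Section RightCofree.
Variable W : lmodType k.

Definition rcofree_coact : {linear tensor W C -> tensor (tensor W C) C} :=
  @tassocV _ W C C \o tmap idfun comul.

Lemma rcofree_coactE w c : rcofree_coact (w ⊗ c) = tmap (tensor_left C w) idfun (comul c).
Proof. by rewrite /= tmapE tassocV_left. Qed.

Lemma rcofree_coactA (x : tensor W C) :
  tassoc (tmap rcofree_coact idfun (rcofree_coact x)) = tmap idfun comul (rcofree_coact x).
Proof.
apply: (tensor_ext (f := @tassoc _ _ _ _ \o (tmap rcofree_coact idfun \o rcofree_coact))
  (g := tmap idfun comul \o rcofree_coact)) => w c.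
exact: (@rcoactA_image regular_rcomodule _ rcofree_coact (tensor_left C w)
  (fun c' => rcofree_coactE w c')).
Qed.
Lemma rcofree_counit (x : tensor W C) : tunitr (tmap idfun counit (rcofree_coact x)) = x.
Proof.
apply: (tensor_ext (f := @tunitr _ _ \o (tmap idfun counit \o rcofree_coact))
  (g := idfun)) => w c.
exact: (@rcoact_counit_image regular_rcomodule _ rcofree_coact (tensor_left C w)
  (fun c' => rcofree_coactE w c')).
Qed.
Definition rcofree : rcomodule := Rcomodule rcofree_coactA rcofree_counit.

End RightCofree.

Section Next.
Variable N : rcomodule.

Definition rnext_space : lmodType k := coker (@rcoact N).
Definition rnext_pi : {linear tensor N C -> rnext_space} := coker_pi (@rcoact N).

Lemma rnext_pi_surj x : exists y, rnext_pi y = x.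
Proof. exact: coker_pi_surj. Qed.
Lemma rnext_piP x : rnext_pi x = 0 <-> exists n, rcoact n = x.
Proof.
rewrite -[0](linear0 rnext_pi); split=> [/coker_pi_eq[u]|[n <-]].
  by rewrite subr0 => ->; exists u.
by apply/coker_pi_eq; exists n; rewrite subr0.
Qed.

Lemma rcofree_coact_rcoact (n : N) :
  rcofree_coact N (rcoact n) = tmap rcoact idfun (rcoact n).
Proof. by rewrite /= -rcoactA tassocK. Qed.

Lemma rnext_coact_subproof n : (tmap rnext_pi idfun \o rcofree_coact N) (rcoact n) = 0.
Proof.
rewrite -[LHS]/(tmap rnext_pi idfun (rcofree_coact N (rcoact n))) rcofree_coact_rcoact.
rewrite -tmap_compl tmap_zerol // => m.
by apply/rnext_piP; exists m.
Qed.
Definition rnext_coact : {linear rnext_space -> tensor rnext_space C} :=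
  coker_lift rnext_coact_subproof.
Lemma rnext_coactE x : rnext_coact (rnext_pi x) = tmap rnext_pi idfun (rcofree_coact N x).
Proof. exact: coker_liftE. Qed.

Lemma rnext_coactA x :
  tassoc (tmap rnext_coact idfun (rnext_coact x)) = tmap idfun comul (rnext_coact x).
Proof.
have [y <-] := rnext_pi_surj x.
exact: (@rcoactA_image (rcofree N) _ rnext_coact rnext_pi rnext_coactE).
Qed.
Lemma rnext_counit x : tunitr (tmap idfun counit (rnext_coact x)) = x.
Proof.
have [y <-] := rnext_pi_surj x.
exact: (@rcoact_counit_image (rcofree N) _ rnext_coact rnext_pi rnext_coactE).
Qed.
Definition rnext : rcomodule := Rcomodule rnext_coactA rnext_counit.

End Next.

Section Theta.
Variable N : rcomodule.
Implicit Types M L : comodule C.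

(* The cobar differential, n (x) m |-> [n (x) m_(-1)] (x) m_(0). *)
Definition theta M : {linear tensor N M -> tensor (rnext N) M} :=
  tmap (@rnext_pi N) idfun \o (@tassocV _ N C M \o tmap idfun coact).

Lemma tassocV_natr (U V W W' : lmodType k) (h : {linear W -> W'}) (x : tensor U (tensor V W)) :
  tassocV (tmap idfun (tmap idfun h) x) = tmap idfun h (tassocV x).
Proof. by apply: (can_inj (@tassocK _ _ _ _)); rewrite tassoc_natr !tassocVK. Qed.

Lemma theta_nat M L (h : comod_hom M L) x :
  theta L (tmap idfun h x) = tmap idfun h (theta M x).
Proof.
rewrite /= [RHS]tmap_swap; congr (tmap _ _ _); rewrite -tassocV_natr -!tmap_compr; congr tassocV.
by apply: tmap_ext => // m; rewrite /= comod_funE.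
Qed.

(** The right-hand side is membership in the cotensor product of [N] and [M]. If [theta] kills [x],
    exactness gives [y] whose right coaction matches the left coaction of [x]; contracting the
    middle factor by the counit shows that x = y. *)
Lemma theta_kernel M x : theta M x = 0 <->
  tassoc (tmap rcoact idfun x) = tmap idfun coact x.
Proof.
split=> [x0|E]; last first.
  rewrite /= -E tassocK -tmap_compl tmap_zerol // => m.
  by apply/rnext_piP; exists m.
have [y yE] := tmap_exactl (f := @rcoact N) (g := @rnext_pi N)
  (fun v => (rnext_piP v).1) x0.
have {}yE : tassoc (tmap rcoact idfun y) = tmap idfun coact x by rewrite yE tassocVK.
suff xy : x = y by rewrite -[RHS]yE xy.
have := congr1 (tmap idfun (@tunitl _ M \o tmap counit idfun)) yE.
rewrite -[RHS]tmap_compr [RHS]tmap_idr => [<-|m]; last exact: coact_counit.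
rewrite -[RHS](@tmap_idl _ _ _ ((@tunitr _ _ \o tmap idfun counit) \o rcoact)) => [|n];
  last exact: rcoact_counit.
rewrite tmap_compl; move: (tmap rcoact idfun y) => z; apply/esym.
apply: (tensor_ext3 (f := tmap (@tunitr _ _ \o tmap idfun counit) idfun)
  (g := tmap idfun (@tunitl _ M \o tmap counit idfun) \o @tassoc _ _ _ _)) => n c m.
by rewrite /= tassocE !tmapE /= !tmapE tunitrE tunitlE tpureZl tpureZr.
Qed.

End Theta.

Lemma theta_theta (N : rcomodule) (M : comodule C) x : theta (rnext N) M (theta N M x) = 0.
Proof.
apply/theta_kernel.
pose y := tmap idfun coact x; pose q := @rnext_pi N.
rewrite -[theta N M x]/(tmap q idfun (tassocV y)).
rewrite (tmap_swap coact q) -tmap_compl.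
rewrite (tmap_ext (f' := tmap q idfun \o rcofree_coact N) (g' := idfun)) //; last first.
  exact: rnext_coactE.
rewrite tmap_compl tassoc_natl; congr (tmap _ _ _); rewrite -tassocV_natr -tmap_compr.
rewrite (tmap_ext (f' := idfun) (g' := @tassoc _ _ _ _ \o (tmap comul idfun \o coact))) //;
  last first.
  by move=> m; rewrite /= coactA.
rewrite !tmap_compr -/y.
apply: (tensor_ext (f := @tassoc _ _ _ _ \o (tmap (rcofree_coact N) idfun \o @tassocV _ _ _ _))
  (g := @tassocV _ _ _ _ \o (tmap idfun (@tassoc _ _ _ _) \o tmap idfun (tmap comul idfun)))).
move=> n z /=.
have l1 : linear (fun z : tensor C M => tassoc (tmap (rcofree_coact N) idfun (tassocV (n ⊗ z)))).
  by move=> a u v; rewrite (linearPr (@tpure k N _)) !linearP.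
have l2 : linear (fun z : tensor C M =>
    tassocV (tmap idfun (@tassoc _ _ _ _) (tmap idfun (tmap comul idfun) (n ⊗ z)))).
  by move=> a u v; rewrite (linearPr (@tpure k N _)) !linearP.
apply: (tensor_ext (f := mklin l1) (g := mklin l2)) => c m.
rewrite /= /lin_of tassocVE !tmapE /= !tmapE /=; move: (comul c) => d.
have l3 : linear (fun d : tensor C C => tassoc (tassocV (n ⊗ d) ⊗ m)).
  by move=> a u v; rewrite (linearPr (@tpure k N _)) linearP linearPl linearP.
have l4 : linear (fun d : tensor C C => tassocV (n ⊗ tassoc (d ⊗ m))).
  by move=> a u v; rewrite linearPl linearP (linearPr (@tpure k N _)) linearP.
apply: (tensor_ext (f := mklin l3) (g := mklin l4)) => a b.
by rewrite /= /lin_of tassocVE !tassocE tassocVE.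
Qed.

(** A cocycle lies in the cotensor product with a cofree comodule, which is [rnext N] tensored with
    V; [w] is its coordinate there. Any lift of [w] along the surjection from N ⊗ C becomes, after
    reassociation, a cochain with boundary [x]. *)
Lemma theta_cofree_acyclic (N : rcomodule) (V : lmodType k) x :
  theta (rnext N) (cofree_comodule C V) x = 0 -> exists y, theta N (cofree_comodule C V) y = x.
Proof.
move=> /theta_kernel xE; pose w := tmap idfun (cofree_proj C V) x.
have {xE} xE : x = tassoc (tmap rcoact idfun w).
  have := congr1 (tmap idfun (tmap idfun (cofree_proj C V))) xE.
  rewrite -tassoc_natr tmap_swap -[RHS]tmap_compr [RHS]tmap_idr //.
  by move=> z; apply: cofree_proj_coact.
have [w' wE] := tmap_surjl (@rnext_pi_surj N) w.
exists (tassoc w'); rewrite xE -wE -tmap_compl.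
rewrite (tmap_ext (f' := tmap (@rnext_pi N) idfun \o rcofree_coact N) (g' := idfun)) //;
  last exact: rnext_coactE.
rewrite tmap_compl tassoc_natl; congr (tmap _ _ _).
apply: (tensor_ext3 (f := @tassocV _ _ _ _ \o (tmap idfun (cofree_coact C V) \o @tassoc _ _ _ _))
  (g := @tassoc _ _ _ _ \o tmap (rcofree_coact N) idfun)) => n c v.
rewrite /= tassocE !tmapE /= !tmapE /=; move: (comul c) => d.
have l1 : linear (fun d : tensor C C => tassocV (n ⊗ tassoc (d ⊗ v))).
  by move=> a u u'; rewrite linearPl linearP (linearPr (@tpure k N _)) linearP.
have l2 : linear (fun d : tensor C C => tassoc (tassocV (n ⊗ d) ⊗ v)).
  by move=> a u u'; rewrite (linearPr (@tpure k N _)) linearP linearPl linearP.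
apply: (tensor_ext (f := mklin l1) (g := mklin l2)) => a b.
by rewrite /= /lin_of tassocVE !tassocE tassocVE.
Qed.

End RightComodules.
Arguments rcoact {k C r}.

(** * Coresolution of the right comodule k and dimension shifting *)

Section RightCoresolution.
Variables (k : fieldType) (C : coalgebra k) (gamma : coaugmentation C).

(** Finite-dimensionality of Z modulo B, phrased on representatives so that cohomology spaces need
    not be formed. *)
Definition finite_mod (X : lmodType k) (Z B : X -> Prop) :=
  exists e : seq X, (forall i, (i < size e)%N -> Z e`_i) /\
    forall x, Z x -> exists y, in_span e y /\ B (x - y).

Definition rtriv_coact : {linear k^o -> tensor k^o C} :=
  mklin (@tpure_linearl k k^o C (gamma 1)).

Lemma rtriv_coactA (a : k^o) :
  tassoc (tmap rtriv_coact idfun (rtriv_coact a)) = tmap idfun comul (rtriv_coact a).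
Proof. by rewrite /= /lin_of !tmapE /= /lin_of coaug_comul tassocE. Qed.
Lemma rtriv_counit (a : k^o) : tunitr (tmap idfun counit (rtriv_coact a)) = a.
Proof. by rewrite /= /lin_of tmapE tunitrE (coalg_counit gamma 1) scale1r. Qed.
Definition rtriv : rcomodule C := Rcomodule rtriv_coactA rtriv_counit.

Fixpoint rcores (i : nat) : rcomodule C :=
  if i is i'.+1 then rnext (rcores i') else rtriv.

Definition cocycle i (M : comodule C) (x : tensor (rcores i) M) := theta (rcores i) M x = 0.

Definition coboundary i (M : comodule C) : tensor (rcores i) M -> Prop :=
  match i return tensor (rcores i) M -> Prop with
  | 0 => fun x => x = 0
  | i'.+1 => fun x => exists y, theta (rcores i') M y = x
  end.

Definition socle_boundary i : rcores i -> Prop :=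
  match i return rcores i -> Prop with
  | 0 => fun n => n = 0
  | i'.+1 => fun n => exists m, rnext_pi (rcores i') (m ⊗ gamma 1) = n
  end.

Definition rsocle_mem i (n : rcores i) := rcoact n = n ⊗ gamma 1.

Hypothesis conil : conilpotent gamma.
Let K0 := triv_comodule gamma k^o.
Let M j := mcomod gamma K0 j.

Let J j := cofree_comodule C (socle gamma (M j)).
Let iota j : comod_hom (M j) (J j) := ses_inj (mcomod_ses K0 conil j).
Let p j : comod_hom (J j) (M j.+1) := ses_sur (mcomod_ses K0 conil j).

Let p_iota j x : p j (iota j x) = 0.
Proof. exact: (@ses_sur_inj _ _ _ (mcomod_ses K0 conil j) x). Qed.

(* The long exact sequence of the complexes rcores (x) M for 0 -> M j -> J j -> M j.+1 -> 0, the
   middle one being acyclic in positive degrees. *)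
Let cohomology_lift (N : rcomodule C) j :
  finite_mod (fun x => theta (rnext N) (M j) x = 0) (fun x => exists y, theta N (M j) y = x) ->
  finite_mod (fun x => theta N (M j.+1) x = 0)
    (fun x => exists d, theta N (J j) d = 0 /\ tmap idfun (p j) d = x).
Proof.
have iI : injective (iota j) := @ses_injI _ _ _ (mcomod_ses K0 conil j).
have pS : forall x, exists y, p j y = x := @ses_surS _ _ _ (mcomod_ses K0 conil j).
have ex x : p j x = 0 -> exists y, iota j y = x := (@ses_kerP _ _ _ (mcomod_ses K0 conil j) x).1.
have tI (N' : rcomodule C) : injective (tmap (@idfun N') (iota j)) := tmap_injr iI.
have tp0 (N' : rcomodule C) (x : tensor N' (M j)) :
    tmap idfun (p j) (tmap idfun (iota j) x) = 0.
  by rewrite -tmap_compr tmap_zero // => y; apply: p_iota.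
move=> [e [eZ eP]].
have /choice[y yP] (x' : tensor (rnext N) (M j)) :
    exists y, theta (rnext N) (M j) x' = 0 -> theta N (J j) y = tmap idfun (iota j) x'.
  have [x'0|] := pselect (theta (rnext N) (M j) x' = 0); last by exists 0.
  have [|y yE] := @theta_cofree_acyclic _ _ N _ (tmap idfun (iota j) x').
    by rewrite (theta_nat (iota j)) x'0 linear0.
  by exists y.
exists [seq tmap idfun (p j) (y x') | x' <- e]; split.
  move=> l; rewrite size_map => le; rewrite (nth_map 0) //.
  by rewrite (theta_nat (p j)) yP ?tp0 //; apply: eZ.
move=> x x0.
have [z zE] := tmap_surjr pS x.
have [x' x'E] : exists x', tmap idfun (iota j) x' = theta N (J j) z.
  by apply: (tmap_exactr ex); rewrite -(theta_nat (p j)) zE.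
have /eP[_ [[c ->] [w wE]]] : theta (rnext N) (M j) x' = 0.
  by apply: tI; rewrite -theta_nat x'E theta_theta linear0.
pose d := z - \sum_(l < size e) c l *: y e`_l - tmap idfun (iota j) w.
exists (\sum_(l < size e) c l *: tmap idfun (p j) (y e`_l)); split.
  exists c; rewrite size_map; apply: eq_bigr => l _.
  by rewrite (nth_map 0).
exists d; split.
  have E : tmap idfun (iota j) (\sum_(l < size e) c l *: e`_l) =
      theta N (J j) (\sum_(l < size e) c l *: y e`_l).
    rewrite !linear_sum; apply: eq_bigr => l _.
    by rewrite !linearZ yP //; apply: eZ.
  have dE : tmap idfun (iota j) (x' - \sum_(l < size e) c l *: e`_l) =
      theta N (J j) z - theta N (J j) (\sum_(l < size e) c l *: y e`_l).
    by rewrite -x'E -E; apply: (linearB (tmap idfun (iota j))).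
  by rewrite /d !linearB (theta_nat (iota j)) wE dE subrr.
have pE : \sum_(l < size e) c l *: tmap idfun (p j) (y e`_l) =
    tmap idfun (p j) (\sum_(l < size e) c l *: y e`_l).
  by rewrite linear_sum; apply: eq_bigr => l _; rewrite linearZ.
by rewrite pE -zE /d !linearB /= tp0 subr0.
Qed.

(** After [cohomology_lift] it remains to see that cocycles of the cofree middle term map to
    coboundaries. *)
Lemma cohomology_shift i j : finite_mod (@cocycle i.+1 (M j)) (@coboundary i.+1 (M j)) ->
  finite_mod (@cocycle i (M j.+1)) (@coboundary i (M j.+1)).
Proof.
move=> /cohomology_lift[e [eZ eP]]; exists e; split=> // x /eP[y [ye [d [d0 dE]]]].
exists y; split=> //; move: d d0 dE {e eZ eP ye}.
case: i x y => [|i] x y d d0 /= <-; last first.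
  have [u uE] := theta_cofree_acyclic d0; exists (tmap idfun (p j) u).
  exact: etrans (theta_nat (p j) u) (congr1 _ uE).
(* Acyclicity does not cover degree 0, where minimality takes over: the cocycle is a socle element
   of the cofree comodule, so it comes from [M j] and dies under [p j]. *)
move: d0 => /theta_kernel; rewrite [d]tensor_unitl tmapE tassocE tmapE.
move=> /(congr1 (@tunitl _ _)); rewrite !tunitlE !scale1r => /esym sd.
have [u uE] := socle_cofree (sd : socle_mem gamma (tunitl d)).
by rewrite tmapE -uE [p j _]p_iota tpure0r.
Qed.

Lemma cohomology_shifts i j : finite_mod (@cocycle (i + j) K0) (@coboundary (i + j) K0) ->
  finite_mod (@cocycle i (M j)) (@coboundary i (M j)).
Proof.
elim: j i => [|j IH] i; first by rewrite addn0.
by rewrite addnS -addSn => /IH; apply: cohomology_shift.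
Qed.

(** The two ends of the shift are compared. With k as left comodule, the cohomology in degree n is
    the right socle modulo boundaries; with [M n], the cohomology in degree 0 is the left socle. *)
Lemma socle_finite_dim n : finite_mod (@rsocle_mem n) (@socle_boundary n) ->
  finite_dim (socle gamma (M n)).
Proof.
move=> [e [eZ eP]].
have [e' [_ e'P]] : finite_mod (@cocycle 0 (M n)) (@coboundary 0 (M n)).
  apply: cohomology_shifts; exists [seq x ⊗ (1 : k^o) | x <- e]; split.
    move=> i; rewrite size_map => ie; apply/theta_kernel; rewrite (nth_map 0) //.
    by rewrite tmapE [rcoact _]eZ // tassocE tmapE triv_coactE.
  move=> x /theta_kernel; rewrite [x]tensor_unitr tmapE tmapE triv_coactE /=.
  move=> xE; have sx : rsocle_mem (tunitr x).
    have := congr1 (tmap idfun (@tunitr _ C)) xE.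
    rewrite tmapE /= tunitrE scale1r /rsocle_mem => <-.
    have l : linear (fun z : tensor (rcores n) C =>
        tmap idfun (@tunitr _ C) (tassoc (z ⊗ (1 : k^o)))).
      by move=> a z z'; rewrite (linearPl (@tpure k _ k^o)) !linearP.
    apply/esym/(tensor_ext (f := mklin l) (g := idfun)) => u c.
    by rewrite /= /lin_of tassocE tmapE /= tunitrE scale1r.
  have [_ [[c ->] cB]] := eP _ sx.
  exists (\sum_(i < size e) c i *: (e`_i ⊗ (1 : k^o))); split.
    by exists c; rewrite size_map; apply: eq_bigr => i _; rewrite (nth_map 0).
  have l : linear (fun u : rcores n => u ⊗ (1 : k^o)) := @tpure_linearl k _ k^o 1.
  have -> : tunitr x ⊗ (1 : k^o) - \sum_(i < size e) c i *: (e`_i ⊗ (1 : k^o)) =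
      mklin l (tunitr x - \sum_(i < size e) c i *: e`_i).
    have <- : mklin l (\sum_(i < size e) c i *: e`_i) =
        \sum_(i < size e) c i *: (e`_i ⊗ (1 : k^o)).
      by rewrite linear_sum; apply: eq_bigr => i _; rewrite linearZ.
    exact/esym/(linearB (mklin l)).
  case: n e eZ eP x xE sx c cB l => [|n] e eZ eP x xE sx c /= [].
    by move=> -> l; rewrite linear0.
  move=> m mE l; exists (m ⊗ (1 : k^o)); rewrite /= /lin_of -mE.
  by rewrite tmapE triv_coactE tassocVE tmapE.
apply/finite_dimP; exists (map (@socle_retr k C gamma (M n)) (map (@tunitl k (M n)) e')) => v.
rewrite -[v]socle_inclK; apply: in_span_map.
pose x := (1 : k^o) ⊗ socle_incl v.
have -> : socle_incl v = tunitl x by rewrite tunitlE scale1r.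
apply: in_span_map; have [|y [ye /eqP]] := e'P x; last by rewrite subr_eq0 => /eqP ->.
apply/theta_kernel; rewrite !tmapE tassocE /=; congr (_ ⊗ _); apply/esym.
by apply/socle_inclP; exists v.
Qed.

End RightCoresolution.

(** * Functionals vanishing on maps of finite rank *)

Section InfiniteRank.
Variable k : fieldType.
Implicit Types X T : lmodType k.

Lemma in_span_cat X (e e' : seq X) a x y :
  in_span e x -> in_span e' y -> in_span (e ++ e') (a *: x + y).
Proof.
move=> [c ->] [d ->]; exists (fun i => if (i < size e)%N then a * c i else d (i - size e)%N).
rewrite size_cat big_split_ord /= scaler_sumr; congr (_ + _); apply: eq_bigr => i _ /=.
  by rewrite nth_cat ltn_ord scalerA.
by rewrite nth_cat ltnNge leq_addr /= addKn.
Qed.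

(** Each term is chosen in Z outside the sum of B and the span of its predecessors; no finite list
    in Z exhausts Z modulo B. *)
Lemma independent_sequence X (Z B : X -> Prop) : lin_closed B -> ~ finite_mod Z B ->
  exists z : nat -> X, (forall i, Z (z i)) /\
    forall m (c : nat -> k), B (\sum_(i < m) c i *: z i) -> forall i, (i < m)%N -> c i = 0.
Proof.
move=> [B0 BP] nfin.
have /choice[f fP] (e : seq X) : exists x, (forall i, (i < size e)%N -> Z e`_i) ->
    Z x /\ forall y, in_span e y -> ~ B (x - y).
  have [eZ|] := pselect (forall i, (i < size e)%N -> Z e`_i); last by exists 0.
  apply: contrapT => nx; apply: nfin; exists e; split=> // x Zx.
  apply: contrapT => ny; apply: nx; exists x => _; split=> // y ey Bxy.
  by apply: ny; exists y.
pose s := fix s m := if m is m'.+1 then rcons (s m') (f (s m')) else [::].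
pose z i := f (s i).
have sE m : s m = mkseq z m.
  elim: m => [|m IH] //; rewrite -[s m.+1]/(rcons (s m) (f (s m))) -/(z m) IH.
  by rewrite /mkseq -[m.+1]addn1 iotaD map_cat cats1.
have zP m : Z (z m) /\ forall y, in_span (s m) y -> ~ B (z m - y).
  elim/ltn_ind: m => m IH; apply: fP => i; rewrite sE size_mkseq => im.
  by rewrite nth_mkseq //; have [] := IH i im.
exists z; split=> [i|m c]; first by have [] := zP i.
elim: m => // m IH; rewrite big_ord_recr /= => Bc.
have cm : c m = 0.
  apply: contrapT => /eqP cm; have [_ nB] := zP m.
  apply: (nB (- (c m)^-1 *: \sum_(i < m) c i *: z i)).
    exists (fun i => - (c m)^-1 * c i); rewrite sE size_mkseq scaler_sumr.
    by apply: eq_bigr => i _; rewrite nth_mkseq // scalerA.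
  have := BP (c m)^-1 _ _ Bc B0.
  by rewrite addr0 scalerDr scalerA mulVf // scale1r scaleNr opprK addrC.
move: Bc; rewrite cm scale0r addr0 => /IH{}IH i.
by rewrite ltnS leq_eqVlt => /orP[/eqP ->|/IH].
Qed.

Section PolynomialCombination.
Variables (X : lmodType k) (z : nat -> X).

Lemma poly_comb_widen (p : {poly k}) n : (size p <= n)%N ->
  \sum_(i < size p) p`_i *: z i = \sum_(i < n) p`_i *: z i.
Proof.
move=> pn; rewrite (big_ord_widen n (fun i => p`_i *: z i)) // big_mkcond.
by apply: eq_bigr => i _; case: ltnP => // pi; rewrite nth_default // scale0r.
Qed.
Lemma poly_comb_linear : linear (fun p : {poly k} => \sum_(i < size p) p`_i *: z i).
Proof.
move=> a p q; pose n := maxn (size (a *: p + q)) (maxn (size p) (size q)).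
rewrite !(@poly_comb_widen _ n) ?leq_max ?leqnn ?orbT // scaler_sumr -big_split.
by apply: eq_bigr => i _; rewrite coefD coefZ scalerDl scalerA.
Qed.
(** Polynomials serve as the free space on a countable basis, and their size later detects infinite
    rank. *)
Definition poly_comb : {linear {poly k} -> X} := mklin poly_comb_linear.
Lemma poly_combXn i : poly_comb 'X^i = z i.
Proof.
rewrite /= /lin_of (@poly_comb_widen _ i.+1) ?size_polyXn // big_ord_recr /=.
rewrite coefXn eqxx scale1r big1 ?add0r // => j _.
by rewrite coefXn ltn_eqF ?scale0r.
Qed.
Lemma poly_comb_inj (B : X -> Prop) :
  (forall m (c : nat -> k), B (\sum_(i < m) c i *: z i) -> forall i, (i < m)%N -> c i = 0) ->
  forall p, B (poly_comb p) -> p = 0.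
Proof.
move=> zB p Bp; apply/polyP => i; rewrite coef0.
have [pi|pi] := ltnP i (size p); last by rewrite nth_default.
exact: (zB (size p) (nth 0 p)).
Qed.

End PolynomialCombination.

Lemma infinite_rank_map X T (Z B : X -> Prop) : lin_closed B ->
  ~ finite_mod Z B -> ~ finite_dim T ->
  exists g : {linear X -> T}, (forall x, B x -> g x = 0) /\
    ~ exists e, forall x, Z x -> in_span e (g x).
Proof.
move=> BP nB nT; have [B0 _] := BP; have Blin := BP.2.
have [z [zZ zB]] := independent_sequence BP nB.
have [||t [_ t0]] := @independent_sequence T (fun=> True) (fun x => x = 0).
- by split=> [|a x y -> ->] //; rewrite scaler0 addr0.
- move=> [e [_ eP]]; apply/nT/finite_dimP; exists e => v.
  by have [y [ye /eqP]] := eP v I; rewrite subr_eq0 => /eqP ->.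
have tI : injective (poly_comb t).
  move=> p q E; have pq0 : poly_comb t (p - q) = 0 by rewrite linearB E subrr.
  by apply/eqP; rewrite -subr_eq0; apply/eqP/(poly_comb_inj (B := fun x => x = 0) t0).
have [||||x|g [gG _]] := @lin_select _ X T
    (fun x y => exists p, B (x - poly_comb z p) /\ y = poly_comb t p) (fun _ _ => True) => //.
- split; first by exists 0; rewrite (linear0 (poly_comb z)) (linear0 (poly_comb t)) subr0.
  move=> a x _ x' _ [p [xp ->]] [p' [xp' ->]]; exists (a *: p + p').
  rewrite (linearP (poly_comb z)) (linearP (poly_comb t)).
  by split=> //; rewrite opprD addrACA -scalerBr; apply: Blin.
- move=> y [p [Bp ->]]; suff -> : p = 0 by rewrite (linear0 (poly_comb t)).
  apply: (@poly_comb_inj _ z B zB); have := Blin (-1) _ _ Bp B0.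
  by rewrite sub0r scaleN1r opprK addr0.
- by exists 0.
exists g; split=> [x Bx|[e eP]].
  by apply: gG; exists 0; rewrite (linear0 (poly_comb z)) (linear0 (poly_comb t)) subr0.
have gz i : g (z i) = t i.
  by apply: gG; exists 'X^i; rewrite !poly_combXn subrr.
have [r rK] := linear_retraction tI.
(* The polynomial X^n has size n + 1, more than any combination of the images of [e] under [r], so
   it is not in their span. *)
pose n := (\max_(i < size e) size (r (nth 0%R e i)))%N.
have := eP _ (zZ n); rewrite gz => /(in_span_map r); rewrite -(poly_combXn t n) rK.
move=> [c /(congr1 (size : {poly k} -> nat))]; rewrite size_polyXn size_map => nE.
have := leq_trans (eq_leq nE) (size_sum _ _ _); apply/negP; rewrite -ltnNge ltnS.
apply/bigmax_leqP => i _; apply: leq_trans (size_scale_leq _ _) _.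
by rewrite (nth_map 0) //; apply: (leq_bigmax i).
Qed.

Lemma infinite_rank_functional X T (Z B : X -> Prop) : lin_closed B ->
  ~ finite_mod Z B -> ~ finite_dim T ->
  exists (f : {linear {linear X -> T} -> k^o}) (g0 : {linear X -> T}),
    [/\ forall g : {linear X -> T}, (exists e, forall x, Z x -> in_span e (g x)) -> f g = 0,
        forall x, B x -> g0 x = 0 & f g0 = 1].
Proof.
move=> BP nB nT; have [g0 [g0B ng0]] := infinite_rank_map BP nB nT.
have [||f [fS f1]] := @separating_functional k {linear X -> T}
  (fun g => exists e, forall x, Z x -> in_span e (g x)) g0 => //.
- split; first by exists [::] => x _; have [] := in_span_closed (Nil T).
  move=> a g h [e eP] [e' e'P]; exists (e ++ e') => x Zx.
  by apply: in_span_cat; [apply: eP | apply: e'P].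
by exists f, g0.
Qed.

End InfiniteRank.

(** * Contramodules of linear maps *)

Section ContramoduleProperties.
Variables (k : fieldType) (C : coalgebra k).

Lemma contract_ext (P : contramodule C) (g h : {linear C -> P}) :
  g =1 h -> contract g = contract h.
Proof. by move=> /linear_ext ->. Qed.

Lemma contracat_lifts : has_lifts (contracat C).
Proof.
move=> A X W i h iI hW; pose il : {linear A -> X} := contra_fun i.
have [g gE] := linear_lift (i := il) (h := contra_fun h) iI hW.
have gC (u : {linear C -> W}) : g (contract u) = contract (g \o u).
  apply: iI; rewrite -[LHS]/(il (g (contract u))) -[RHS]/(i (contract (g \o u))).
  rewrite gE !contra_funE; apply: contract_ext => c /=.
  by rewrite -gE.
by exists (ContraHom gC); apply/compP => w; apply: gE.
Qed.

Lemma linear_lift_surj (A B X : lmodType k) (p : {linear A -> B}) (u : {linear X -> B}) :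
  (forall b, exists a, p a = b) -> exists v : {linear X -> A}, u =1 p \o v.
Proof. by move=> /linear_section[s sE]; exists (s \o u) => x; rewrite /= sE. Qed.

Lemma contracat_descents : has_descents (contracat C).
Proof.
move=> A X W p h pS hX; pose pl : {linear X -> A} := contra_fun p.
have [g gE] := linear_descent (p := pl) (h := contra_fun h) pS hX.
have gC (u : {linear C -> A}) : g (contract u) = contract (g \o u).
  have [v vE] := linear_lift_surj u (pS : forall b, exists a, pl a = b).
  rewrite (contract_ext vE) -[contract (pl \o v)](contra_funE p) -/pl gE contra_funE.
  by apply: contract_ext => c /=; rewrite vE /= gE.
by exists (ContraHom gC); apply/compP => w; apply: gE.
Qed.

Lemma contra_opp_subproof (P Q : contramodule C) (f : contra_hom P Q) (g : {linear C -> P}) :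
  (\- f) (contract g) = contract ((\- f : {linear P -> Q}) \o g).
Proof.
rewrite [LHS](congr1 -%R (contra_funE f g)) -(linearN contract).
exact: contract_ext.
Qed.

Lemma contracat_negatives : has_negatives (contracat C).
Proof. by move=> A B f; exists (@ContraHom _ _ A B (\- contra_fun f) (contra_opp_subproof f)). Qed.

Section Cokernel.
Variables (B Y : contramodule C) (u : contra_hom B Y).

Let pi : {linear Y -> coker u} := coker_pi u.
Let sec : {linear coker u -> Y} := sval (cid (linear_section (@coker_pi_surj _ _ _ u))).
Let secK q : pi (sec q) = q. Proof. exact: svalP (cid (linear_section _)) q. Qed.
Let pi0 y : pi y = 0 <-> exists x, y = u x.
Proof.
rewrite -[0](linear0 pi); apply: iff_trans (coker_pi_eq u _ _) _.
by split=> -[x E]; exists x; rewrite subr0 in E *.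
Qed.

Lemma coker_contract_linear :
  linear (fun g : {linear C -> coker u} => pi (contract (sec \o g))).
Proof.
move=> a g h; rewrite -linearP -linearP; congr (pi _); apply: contract_ext => c.
by rewrite /= linearP.
Qed.
Definition coker_contract : {linear {linear C -> coker u} -> coker u} :=
  mklin coker_contract_linear.

(** The contraaction does not depend on the section [sec]: two lifts differ by a map into the image
    of [u], and this map lifts linearly to [B]. *)
Lemma coker_contractE (h : {linear C -> Y}) : coker_contract (pi \o h) = pi (contract h).
Proof.
rewrite -[LHS]/(pi (contract (sec \o (pi \o h)))).
apply/eqP; rewrite -subr_eq0 -linearB -linearB; apply/eqP/pi0.
have [r rE] := generalized_inverse (contra_fun u).
pose d : {linear C -> Y} := (sec \o (pi \o h) : {linear C -> Y}) - h.
have dE c : exists x, d c = u x by apply/pi0; rewrite linearB /= secK subrr.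
exists (contract (r \o d)); rewrite contra_funE; apply: contract_ext => c.
by have [x xE] := dE c; rewrite /= -[_ - _]/(d c) xE rE.
Qed.

Lemma coker_contractA (g : {linear tensor C C -> coker u}) :
  coker_contract (coker_contract \o tcurry g) = coker_contract (g \o comul).
Proof.
have [h hE] := linear_lift_surj g (@coker_pi_surj _ _ _ u).
have -> : g = pi \o h by apply: linear_ext.
transitivity (coker_contract (pi \o (h \o comul))); last first.
  by congr (coker_contract _); apply: linear_ext.
rewrite coker_contractE -contractA -coker_contractE.
congr (coker_contract _); apply: linear_ext => c.
rewrite -[RHS]/(pi (contract (tcurry h c))) -coker_contractE.
by congr (coker_contract _); apply: linear_ext.
Qed.
Lemma coker_contract_counit (q : coker u) : coker_contract (lin_scalar q \o counit) = q.
Proof.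
rewrite -[RHS]secK -[in RHS](contract_counit (sec q)) -coker_contractE.
congr (coker_contract _); apply: linear_ext => c.
by rewrite /= /lin_of linearZ /= secK.
Qed.
Definition coker_contramodule : contramodule C :=
  Contramodule coker_contractA coker_contract_counit.

Lemma coker_contra_pi_subproof (h : {linear C -> Y}) : pi (contract h) = coker_contract (pi \o h).
Proof. by rewrite coker_contractE. Qed.
Definition coker_contra_pi : contra_hom Y coker_contramodule :=
  @ContraHom _ _ Y coker_contramodule pi coker_contra_pi_subproof.

End Cokernel.

Lemma contracat_cokernels : has_cokernels (contracat C).
Proof.
move=> X Y f; exists (coker_contramodule f), (coker_contra_pi f).
split; first exact: coker_pi_surj.
move=> y; rewrite -[0](linear0 (coker_pi f)); apply: iff_trans (coker_pi_eq f _ _) _.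
by split=> -[x E]; exists x; move: E; rewrite subr0 => ->.
Qed.

End ContramoduleProperties.

Section HomContramodule.
Variables (k : fieldType) (C : coalgebra k).
Implicit Types N : rcomodule C.

Section Object.
Variables (N : rcomodule C) (T : lmodType k).

Section Uncurry.
Variable h : {linear C -> {linear N -> T}}.
Lemma uncurry_linearl c : linear (fun n : N => h c n).
Proof. exact: linearP. Qed.
Lemma uncurry_linearr n : linear (fun c : C => h c n).
Proof. by move=> a c c'; rewrite linearP. Qed.
Definition uncurry : {linear tensor N C -> T} :=
  tlift (mkbil (f := fun n c => h c n) uncurry_linearl uncurry_linearr).
Lemma uncurryE n c : uncurry (n ⊗ c) = h c n.
Proof. exact: tliftE. Qed.
End Uncurry.

Lemma hom_contract_linear :
  linear (fun h : {linear C -> {linear N -> T}} => (uncurry h \o rcoact : {linear N -> T})).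
Proof.
move=> a g h; apply: linear_ext => n /=.
apply: (tensor_ext (f := uncurry (a *: g + h)) (g := a *: uncurry g + uncurry h)) => m c.
by rewrite linDE linZE !uncurryE.
Qed.
(** Under the identification of Hom(C, Hom(N, T)) with Hom(N ⊗ C, T), this is restriction along the
    right coaction. *)
Definition hom_contract : {linear {linear C -> {linear N -> T}} -> {linear N -> T}} :=
  mklin hom_contract_linear.

Lemma hom_contractE h n : hom_contract h n = uncurry h (rcoact n). Proof. by []. Qed.

Lemma hom_contractA (g : {linear tensor C C -> {linear N -> T}}) :
  hom_contract (hom_contract \o tcurry g) = hom_contract (g \o comul).
Proof.
apply: linear_ext => n; rewrite !hom_contractE.
pose L : {linear tensor N (tensor C C) -> T} :=
  tlift (mkbil (f := fun m z => g z m) (fun z => linearP (g z))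
    (fun m a z z' => congr1 (fun f : {linear N -> T} => f m) (linearP g a z z'))).
have LE m z : L (m ⊗ z) = g z m by apply: tliftE.
transitivity (L (tassoc (tmap rcoact idfun (rcoact n)))).
  apply: (tensor_ext (g := L \o (@tassoc _ _ _ _ \o tmap rcoact idfun))) => m c.
  rewrite uncurryE -[LHS]/(uncurry (tcurry g c) (rcoact m)).
  rewrite -[RHS]/(L (tassoc (tmap rcoact idfun (m ⊗ c)))) tmapE.
  have l : linear (fun z : tensor N C => L (tassoc (z ⊗ c))).
    by move=> a z z'; rewrite linearPl !linearP.
  apply: (tensor_ext (g := mklin l)) => m' c'.
  by rewrite uncurryE /= /lin_of tassocE LE.
rewrite rcoactA; apply: (tensor_ext (f := L \o tmap idfun comul)) => m c.
by rewrite uncurryE -[LHS]/(L (tmap idfun comul (m ⊗ c))) tmapE LE.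
Qed.

Lemma hom_contract_counit (g : {linear N -> T}) : hom_contract (lin_scalar g \o counit) = g.
Proof.
apply: linear_ext => n; rewrite hom_contractE -[RHS](congr1 g (rcoact_counit n)).
apply: (tensor_ext (g := g \o (@tunitr _ _ \o tmap idfun counit))) => m c.
by rewrite uncurryE /= tmapE tunitrE linearZ.
Qed.

Definition hom_contra : contramodule C := Contramodule hom_contractA hom_contract_counit.

End Object.

Lemma precomp_linear (U V T : lmodType k) (j : {linear U -> V}) :
  linear (fun g : {linear V -> T} => (g \o j : {linear U -> T})).
Proof. by move=> a g h; apply: linear_ext. Qed.
Definition precomp (U V T : lmodType k) (j : {linear U -> V}) :
  {linear {linear V -> T} -> {linear U -> T}} := mklin (@precomp_linear U V T j).
Lemma precompE (U V T : lmodType k) (j : {linear U -> V}) (g : {linear V -> T}) u :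
  precomp T j g u = g (j u).
Proof. by []. Qed.

Section Map.
Variables (N N' : rcomodule C) (T : lmodType k) (j : {linear N -> N'}).
Hypothesis jC : forall n, rcoact (j n) = tmap j idfun (rcoact n).

Lemma hom_contra_map_subproof (h : {linear C -> hom_contra N' T}) :
  precomp T j (contract h) = contract (precomp T j \o h : {linear C -> hom_contra N T}).
Proof.
apply: linear_ext => n; rewrite precompE [LHS]hom_contractE [RHS]hom_contractE jC.
apply: (tensor_ext (f := uncurry h \o tmap j idfun)) => m c.
by rewrite uncurryE -[LHS]/(uncurry h (tmap j idfun (m ⊗ c))) tmapE uncurryE.
Qed.
Definition hom_contra_map : contra_hom (hom_contra N' T) (hom_contra N T) :=
  @ContraHom _ _ (hom_contra N' T) (hom_contra N T) (precomp T j) hom_contra_map_subproof.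
End Map.

End HomContramodule.

(** * Free contramodules and a projective resolution of T *)

Section FreeContramodule.
Variables (k : fieldType) (C : coalgebra k) (W T : lmodType k).

Let P := hom_contra (rcofree C W) T.

Definition free_unit : {linear {linear W -> T} -> P} :=
  precomp T (@tunitr _ W \o tmap idfun counit : {linear tensor W C -> W}).

Lemma free_unitE w n c : free_unit w (n ⊗ c) = counit c *: w n.
Proof. by rewrite precompE /= tmapE tunitrE linearZ. Qed.

Lemma hom_contract_free (h : {linear C -> P}) n c :
  contract h (n ⊗ c) = uncurry h (tmap (tensor_left C n) idfun (comul c)).
Proof. by rewrite [LHS]hom_contractE [rcoact _]rcofree_coactE. Qed.

Lemma free_generation (g : P) : contract (free_unit \o tcurry g) = g.
Proof.
apply/linear_ext/tensor_ext => n c; rewrite hom_contract_free.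
have <- : tensor_left C n (tunitl (tmap counit idfun (comul c))) = n ⊗ c by rewrite counitl.
apply: (tensor_ext (f := uncurry (free_unit \o tcurry g) \o tmap (tensor_left C n) idfun)
  (g := g \o (tensor_left C n \o (@tunitl _ C \o tmap counit idfun)))) => a b.
rewrite -[LHS]/(uncurry (free_unit \o tcurry g) (tmap (tensor_left C n) idfun (a ⊗ b))).
rewrite tmapE uncurryE -[LHS]/(free_unit (tcurry g b) (n ⊗ a)) free_unitE /= /lin_of.
by rewrite tmapE tunitlE /= tpureZr linearZ.
Qed.

(** Hom(W ⊗ C, T) is Hom(C, Hom(W, T)), the free contramodule on Hom(W, T). A linear lift [u] on
    generators therefore extends by contracting [u \o tcurry g]. *)
Lemma free_projective : @projective (contracat C) P.
Proof.
move=> A B p f pS.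
have [u uE] := linear_lift_surj (contra_fun f \o free_unit)
  (pS : forall b, exists a, contra_fun p a = b).
have Fl : linear (fun g : P => contract (u \o tcurry g)).
  move=> a g g'; rewrite -linearP; apply: contract_ext => c /=.
  by rewrite -linearP; congr (u _); apply: linear_ext.
have FC (h : {linear C -> P}) : mklin Fl (contract h) = contract (mklin Fl \o h).
  have l1 (b : C) : linear (fun a : C => tcurry (h b) a) := linearP _.
  have l2 (a : C) : linear (fun b : C => tcurry (h b) a).
    by move=> r b b'; apply: linear_ext => n; rewrite /= /lin_of linearP.
  pose G : {linear tensor C C -> A} := u \o tlift (mkbil l1 l2).
  have GE a b : G (a ⊗ b) = u (tcurry (h b) a) by rewrite /= tliftE.
  transitivity (contract (G \o comul)).
    apply: contract_ext => c; rewrite -[LHS]/(u (tcurry (contract h : P) c)); congr (u _).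
    apply: linear_ext => n; rewrite -[LHS]/((contract h : P) (n ⊗ c)) hom_contract_free.
    have l3 : linear (fun z : tensor C C => tlift (mkbil l1 l2) z n).
      by move=> r z z'; rewrite linearP.
    apply: (tensor_ext (f := uncurry h \o tmap (tensor_left C n) idfun) (g := mklin l3)) => a b.
    rewrite -[LHS]/(uncurry h (tmap (tensor_left C n) idfun (a ⊗ b))) tmapE uncurryE.
    by rewrite /= /lin_of tliftE.
  rewrite -contractA; apply: contract_ext => c; apply: contract_ext => c'.
  by rewrite -[LHS]/(G (c' ⊗ c)) GE.
exists (@ContraHom _ _ P A (mklin Fl) FC); apply/compP => g.
rewrite -[LHS]/(contra_fun p (contract (u \o tcurry g))) contra_funE.
rewrite -[in RHS](free_generation g) -[RHS]/(contra_fun f (contract _)) contra_funE.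
by apply: contract_ext => c; apply: esym (uE (tcurry g c)).
Qed.

(** The trivial contraaction evaluates at [gamma 1], so [f] sees only the restriction of [g] to W ⊗
    gamma(k). *)
Lemma free_hom_trivial (gamma : coaugmentation C) (T' : lmodType k)
    (f : contra_hom P (triv_contramodule gamma T')) (g : P) :
  (forall n, g (n ⊗ gamma 1) = 0) -> f g = 0.
Proof.
move=> g0; rewrite -(free_generation g) contra_funE.
rewrite -[LHS]/(f (free_unit (tcurry g (gamma 1)))).
have -> : tcurry g (gamma 1) = 0 by apply: linear_ext => n; apply: g0.
by rewrite !linear0.
Qed.

End FreeContramodule.

Section ContraResolution.
Variables (k : fieldType) (C : coalgebra k) (gamma : coaugmentation C) (T : lmodType k).

Section Step.
Variable N : rcomodule C.

Definition hom_inj : contra_hom (hom_contra (rnext N) T) (hom_contra (rcofree C N) T) :=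
  @hom_contra_map _ _ (rcofree C N) (rnext N) T (@rnext_pi _ _ N) (@rnext_coactE _ _ N).
Definition hom_sur : contra_hom (hom_contra (rcofree C N) T) (hom_contra N T) :=
  @hom_contra_map _ _ N (rcofree C N) T rcoact (@rcofree_coact_rcoact _ _ N).

Lemma hom_injE g x : hom_inj g x = g (rnext_pi N x). Proof. by []. Qed.
Lemma hom_surE g n : hom_sur g n = g (rcoact n). Proof. by []. Qed.

Lemma hom_inj_inj : injective hom_inj.
Proof.
move=> g h E; apply: linear_ext => x; have [y <-] := rnext_pi_surj x.
by rewrite -!hom_injE E.
Qed.

(** A merely linear section of [hom_sur]. It preserves finite rank, which later keeps the sequences
    of maps of finite rank exact. *)
Definition hom_ext (g : {linear N -> T}) : {linear tensor N C -> T} :=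
  g \o (@tunitr _ N \o tmap idfun counit).
Lemma hom_extE g : hom_sur (hom_ext g) = g.
Proof. by apply: linear_ext => n; rewrite hom_surE /= rcoact_counit. Qed.

Lemma hom_kerP g : hom_sur g = 0 <-> exists h, hom_inj h = g.
Proof.
split=> [g0|[h <-]].
  have g0' n : g (rcoact n) = 0 by rewrite -hom_surE g0.
  exists (coker_lift g0' : {linear coker (@rcoact k C N) -> T}).
  by apply: linear_ext => x; rewrite hom_injE; apply: coker_liftE.
apply: linear_ext => n; rewrite hom_surE hom_injE.
have -> : rnext_pi N (rcoact n) = 0 by apply/rnext_piP; exists n.
exact: linear0.
Qed.

Lemma hom_is_ses : @is_ses (contracat C) _ _ _ hom_inj hom_sur.
Proof.
split; first exact: hom_inj_inj.
  by move=> g; exists (hom_ext g); apply: hom_extE.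
exact: hom_kerP.
Qed.

End Step.

Lemma eval_one_linear : linear (fun g : {linear k^o -> T} => g 1).
Proof. by []. Qed.
Lemma eval_one_contra (h : {linear C -> hom_contra (rtriv gamma) T}) :
  mklin eval_one_linear (contract h) = contract (mklin eval_one_linear \o h :
    {linear C -> triv_contramodule gamma T}).
Proof. by rewrite /= /lin_of [LHS]uncurryE. Qed.
Definition eval_one : contra_hom (hom_contra (rtriv gamma) T) (triv_contramodule gamma T) :=
  @ContraHom _ _ (hom_contra (rtriv gamma) T) (triv_contramodule gamma T)
    (mklin eval_one_linear) eval_one_contra.

Lemma eval_one_inj : injective eval_one.
Proof.
move=> g h E; apply: linear_ext => a.
have E1 (u : {linear k^o -> T}) : u a = a *: u 1 by rewrite -linearZ [a *: _]mulr1.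
by rewrite !E1; congr (_ *: _).
Qed.
Lemma eval_one_surj t : exists g, eval_one g = t.
Proof. by exists (lin_scalar t); apply: scale1r. Qed.

Lemma hom_first_is_ses : @is_ses (contracat C) _ _ _ (hom_inj (rtriv gamma))
  (comp (eval_one : @hom (contracat C) _ _) (hom_sur (rtriv gamma))).
Proof.
have [iI pS ex] := hom_is_ses (rtriv gamma).
split=> // [t|g].
  have [g gE] := eval_one_surj t; have [h hE] := pS g.
  by exists h; rewrite appM hE.
apply: iff_trans (ex g); rewrite appM; split=> [E|->]; last exact: (linear0 (contra_fun eval_one)).
exact: eval_one_inj (etrans E (esym (linear0 (contra_fun eval_one)))).  
Qed.

(** Degree 0 is T itself instead of the isomorphic Hom(k, T), so that the resolution ends in the
    contramodule of the theorem. *)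
Definition contra_syz (j : nat) : contramodule C :=
  if j is j'.+1 then hom_contra (rcores gamma j'.+1) T else triv_contramodule gamma T.

Definition contra_mid (j : nat) : contramodule C := hom_contra (rcofree C (rcores gamma j)) T.

Definition contra_sur (j : nat) : contra_hom (contra_mid j) (contra_syz j) :=
  match j return contra_hom (contra_mid j) (contra_syz j) with
  | 0 => contra_comp eval_one (hom_sur (rtriv gamma))
  | j'.+1 => hom_sur (rcores gamma j'.+1)
  end.

Lemma contra_is_ses j : @is_ses (contracat C) (contra_syz j.+1) (contra_mid j) (contra_syz j)
  (hom_inj (rcores gamma j)) (contra_sur j).
Proof. by case: j => [|j]; [apply: hom_first_is_ses | apply: hom_is_ses]. Qed.

Definition contra_ses (j : nat) : @ses (contracat C) (contra_syz j) (contra_syz j.+1) :=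
  Ses (contra_is_ses j).

Lemma contra_ses_projective j : projective (ses_mid (contra_ses j)).
Proof. exact: free_projective. Qed.

End ContraResolution.

(** * Maps of finite rank, and the failure of injectivity *)

Section SubSes.
Variable R : pzRingType.

Lemma sub_ses (A B A' B' X' : lmodType R) (S : @ses (modcat R) A B)
    (a : {linear A' -> A}) (b : {linear B' -> B})
    (x : {linear X' -> (ses_mid S : lmodType R)}) :
  injective a -> injective b -> injective x ->
  (forall u, exists v, a v = app (ses_sur S) (x u)) ->
  (forall v, exists u, a v = app (ses_sur S) (x u)) ->
  (forall w, exists u, x u = app (ses_inj S) (b w)) ->
  (forall u, app (ses_sur S) (x u) = 0 -> exists w, x u = app (ses_inj S) (b w)) ->
  exists S' : @ses (modcat R) A' B', @ses_mor (modcat R) _ _ _ _ S' S a b.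
Proof.
move=> aI bI xI xs xsS xi xiE.
pose i : {linear B -> (ses_mid S : lmodType R)} := ses_inj S.
pose p : {linear (ses_mid S : lmodType R) -> A} := ses_sur S.
have [i' i'E] := linear_lift (i := x) (h := i \o b) xI xi.
have [p' p'E] := linear_lift (i := a) (h := p \o x) aI xs.
have S'P : @is_ses (modcat R) B' X' A' i' p'.
  split=> [w w' E|v|u].
  - by apply: bI; apply: (@ses_injI _ _ _ S); rewrite -[LHS]i'E -[RHS]i'E; congr (x _).
  - by have [u uE] := xsS v; exists u; apply: aI; rewrite p'E.
  split=> [u0|[w <-]].
    have [|w wE] := xiE u; first by rewrite -[LHS]p'E [p' u]u0 linear0.
    by exists w; apply: xI; rewrite i'E.
  by apply: aI; rewrite p'E /= i'E linear0; apply: (@ses_sur_inj _ _ _ S).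
exists (Ses S'P); apply/ses_morP; exists x; split=> [w|u].
  exact: i'E.
exact/esym/p'E.
Qed.

End SubSes.

Lemma resolution_ses_mor (K L : addcat) (F : exact_functor K L) n
    (Om : nat -> K) (S : forall j, ses (Om j) (Om j.+1))
    (Om' : nat -> L) (S' : forall j, ses (Om' j) (Om' j.+1))
    (u : forall j, hom (Om' j) (F (Om j))) :
  (forall j, ses_mor (S' j) (ses_map F (S j)) (u j) (u j.+1)) ->
  exseq_mor (resolution n S') (exseq_map F (resolution n S)) (u 0) (u n.+1).
Proof.
elim: n Om S Om' S' u => [|n IH] Om S Om' S' u uS; first exact: uS.
exists (u 1); split; first exact: uS.
exact: (IH (fun j => Om j.+1) (fun j => S j.+1) (fun j => Om' j.+1) (fun j => S' j.+1)
  (fun j => u j.+1)).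
Qed.

Section FiniteRank.
Variables (k : fieldType) (C : coalgebra k) (gamma : coaugmentation C) (T : lmodType k).

Section Object.
Variable N : rcomodule C.

Let M : lmodType (dual C) := Theta_obj (hom_contra N T).
Definition finite_rank (g : M) := exists e : seq T, forall n, in_span e ((g : {linear N -> T}) n).

Lemma finite_rank0 : finite_rank 0.
Proof. by exists [::] => n; have [] := in_span_closed (Nil T). Qed.
(** The action of [a] replaces each value of [g] by a combination of values of [g], so the same
    finite list still spans. *)
Lemma finite_rankP a g h : finite_rank g -> finite_rank h -> finite_rank (a *: g + h).
Proof.
move=> [e eP] [e' e'P]; exists (e ++ e') => n.
have [c cE] : in_span e ((a *: g : {linear N -> T}) n).
  have [e0 eP'] := in_span_closed e.
  have [s sE] := tensor_span (rcoact n).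
  rewrite [X in in_span e X](_ : _ = uncurry (lin_scalar (g : {linear N -> T}) \o a) (rcoact n)) //.
  rewrite sE; elim: s {sE} => [|p s IH]; first by rewrite big_nil linear0.
  rewrite big_cons linearD uncurryE; apply: eP' => //; exact: eP.
rewrite -[X in in_span _ X]/((a *: g : {linear N -> T}) n + (h : {linear N -> T}) n).
by rewrite -[X in X + _]scale1r; apply: in_span_cat => //; exists c.
Qed.

Definition fr_module : lmodType (dual C) := submodule finite_rank0 finite_rankP.
Definition fr_incl : {linear fr_module -> M} := submodule_incl finite_rank0 finite_rankP.
Lemma fr_incl_inj : injective fr_incl. Proof. exact: submodule_incl_inj. Qed.
Lemma fr_inclP g : finite_rank g <-> exists u, fr_incl u = g.
Proof. exact: submodule_inclP. Qed.

End Object.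
Arguments fr_incl {N}.

(** Degree 0 is all of T, since each vector of T is the value at 1 of a map of rank at most one. *)
Definition fr_syz j : lmodType (dual C) :=
  if j is j'.+1 then fr_module (rcores gamma j'.+1) else Theta_obj (triv_contramodule gamma T).

Definition fr_syz_incl j : {linear fr_syz j -> Theta_obj (contra_syz gamma T j)} :=
  match j return {linear fr_syz j -> Theta_obj (contra_syz gamma T j)} with
  | 0 => idfun
  | j'.+1 => fr_incl (N := rcores gamma j'.+1)
  end.

Lemma fr_syz_incl_inj j : injective (fr_syz_incl j).
Proof. by case: j => [|j]; [|apply: fr_incl_inj]. Qed.

Lemma fr_ses_ex j : exists S : @ses (modcat (dual C)) (fr_syz j) (fr_syz j.+1),
  @ses_mor (modcat (dual C)) _ _ _ _ S (ses_map (Theta C) (contra_ses gamma T j))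
    (fr_syz_incl j) (fr_syz_incl j.+1).
Proof.
pose N := rcores gamma j; pose x := @fr_incl (rcofree C N).
have fr_mid (u : fr_module (rcofree C N)) : exists e : seq T, forall n,
  in_span e ((x u : {linear tensor N C -> T}) n).
  exact: ((fr_inclP (N := rcofree C N) (x u)).2 (ex_intro _ u erefl)).
apply: (@sub_ses (dual C) _ _ _ _ _ (ses_map (Theta C) (contra_ses gamma T j))
  (fr_syz_incl j) (fr_syz_incl j.+1) x).
- exact: fr_syz_incl_inj.
- exact: fr_syz_incl_inj.
- exact: fr_incl_inj.
- case: j @N @x fr_mid => [|j] N x fr_mid u; first by eexists.
  have [e eP] := fr_mid u.
  have /fr_inclP[v vE] : @finite_rank (rcores gamma j.+1) (hom_sur T (rcores gamma j.+1) (x u)).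
    by exists e => n; rewrite hom_surE.
  by exists v.
- case: j @N @x fr_mid => [|j] N x fr_mid v.
    pose g := @hom_ext k C T (rtriv gamma) (lin_scalar (v : T)).
    have /fr_inclP[u uE] : @finite_rank (rcofree C N) g.
      exists [:: v : T] => n; exists (fun=> (tunitr (tmap idfun counit n) : k)).
      by rewrite big_ord_recl big_ord0 addr0.
    exists u; rewrite uE -[RHS]/(eval_one gamma T (hom_sur T N g)).
    by rewrite /g hom_extE; exact: esym (scale1r (v : T)).
  have /fr_inclP[e eP] : exists w, fr_incl w = fr_syz_incl j.+1 v by exists v.
  have /fr_inclP[u uE] : @finite_rank (rcofree C N)
      (@hom_ext k C T (rcores gamma j.+1) (fr_syz_incl j.+1 v)).
    by exists e => n; apply: eP.
  by exists u; rewrite uE; apply/esym/hom_extE.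
- move=> w; have /fr_inclP[e eP] : exists w', fr_incl w' = fr_syz_incl j.+1 w by exists w.
  apply/fr_inclP; exists e => n; rewrite -[X in in_span e X]/(hom_inj T N (fr_syz_incl j.+1 w) n).
  by rewrite hom_injE.
- move=> u u0; have [h hE] := (@ses_kerP _ _ _ (contra_ses gamma T j) (x u)).1 u0.
  have [e eP] := fr_mid u.
  have /fr_inclP[w wE] : @finite_rank (rcores gamma j.+1) h.
    exists e => n; have [y <-] := rnext_pi_surj n.
    have <- : (x u : {linear tensor N C -> T}) y = (h : {linear _ -> _}) (rnext_pi N y).
      by rewrite -[x u]hE.
    exact: eP.
  by exists w; rewrite -hE -wE.
Qed.

Definition fr_ses j := sval (cid (fr_ses_ex j)).
Lemma fr_ses_mor j : @ses_mor (modcat (dual C)) _ _ _ _ (fr_ses j)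
  (ses_map (Theta C) (contra_ses gamma T j)) (fr_syz_incl j) (fr_syz_incl j.+1).
Proof. exact: svalP (cid (fr_ses_ex j)). Qed.

End FiniteRank.
Arguments fr_incl {k C T N}.

Section NonInjective.
Variables (k : fieldType) (C : coalgebra k) (gamma : coaugmentation C) (T : lmodType k).

(** On the socle [contract h] agrees with [h (gamma 1)], so [f] kills their difference; and
    evaluation at [gamma 1] is the contraaction of the trivial target. *)
Lemma rank_functional_contra n (f : {linear {linear rcores gamma n -> T} -> k^o}) :
  (forall g : {linear rcores gamma n -> T},
    (exists e, forall x, rsocle_mem x -> in_span e (g x)) -> f g = 0) ->
  forall h : {linear C -> hom_contra (rcores gamma n) T},
    f (contract h) = contract (f \o h : {linear C -> triv_contramodule gamma k^o}).
Proof.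
move=> f0 h; rewrite -[RHS]/(f (h (gamma 1))); apply/eqP; rewrite -subr_eq0 -linearB; apply/eqP.
apply: f0; exists [::] => x sx; suff -> : (contract h - h (gamma 1)) x = 0.
  by have [] := in_span_closed (Nil T).
rewrite -[LHS]/(uncurry h (rcoact x) - h (gamma 1) x).
by rewrite [rcoact x]sx uncurryE subrr.
Qed.

Theorem Ext_Theta_not_injective n : conilpotent gamma ->
  ~ finite_dim (socle gamma (mcomod gamma (triv_comodule gamma k^o) n.+1)) ->
  ~ finite_dim T ->
  ~ injective (@Ext_Theta k C n.+1 (triv_contramodule gamma T) (triv_contramodule gamma k^o)).
Proof.
move=> conil nV nT inj.
have [||f [g0 [f0 g0B fg0]]] := @infinite_rank_functional k (rcores gamma n.+1) T
    (@rsocle_mem _ _ gamma n.+1) (@socle_boundary _ _ gamma n.+1) _ _ nT.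
- split; first by exists 0; rewrite tpure0l linear0.
  move=> a _ _ [m <-] [m' <-]; exists (a *: m + m').
  by rewrite (linearPl (@tpure k _ C)) linearP.
- by move=> /(socle_finite_dim conil).
pose K := contracat C; pose L := modcat (dual C).
pose fC : @hom K (contra_syz gamma T n.+1) (triv_contramodule gamma k^o) :=
  @ContraHom _ _ (hom_contra (rcores gamma n.+1) T) (triv_contramodule gamma k^o) f
    (rank_functional_contra f0).
pose res := @resolution K n (contra_syz gamma T) (contra_ses gamma T).
have descK := @contracat_descents k C; have negK := @contracat_negatives k C.
have [E EM] := exseq_push descK (@contracat_cokernels k C) negK res fC.
have [E0 E0M] := exseq_push descK (@contracat_cokernels k C) negK res
  (@zerom K _ (triv_contramodule gamma k^o)).
have : @yext_equiv K n.+1 _ _ E E0.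
  apply: ((Ext_classP (K := K) (n := n.+1) E E0).1 (inj _ _ _)).
  rewrite /Ext_Theta !Ext_map_class; apply: (Ext_classP _ _).2.
  have frM := @resolution_ses_mor K L (Theta C) n _ (contra_ses gamma T) _
    (fr_ses gamma T) (fr_syz_incl gamma T) (fr_ses_mor gamma T).
  (* Both [f] and the zero map vanish on maps of finite rank, so over [dual C] both extensions
     receive a morphism from the same split pushforward of the finite rank sequence. *)
  have fr_zero F (u : @hom K (contra_syz gamma T n.+1) (triv_contramodule gamma k^o)) :
      exseq_mor res F (@idm K _) u ->
      (forall w, app (fmap (Theta C) u) (fr_syz_incl gamma T n.+1 w) = 0) ->
      exseq_mor (exseq_split (Theta C (triv_contramodule gamma k^o))
        (@resolution L n _ (fr_ses gamma T))) (exseq_map (Theta C) F) (@idm L _) (@idm L _).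
    move=> M u0.
    have M' := exseq_mor_comp frM (exseq_map_mor (Theta C) M).
    have := exseq_split_mor (@modcat_descents _) M'.
    rewrite fmap_idm comp1m; apply=> w.
    by rewrite appM u0.
  apply: yext_equiv_trans (yext_equiv_sym _) _; apply: exseq_mor_equiv.
    apply: fr_zero EM _ => w; apply: (f0 (fr_syz_incl gamma T n.+1 w)).
    have /fr_inclP[e eP] : exists w', fr_incl w' = fr_syz_incl gamma T n.+1 w by exists w.
    by exists e => x _; apply: eP.
  apply: fr_zero E0M _ => w; exact: (@app_zerom K _ _ (fr_syz_incl gamma T n.+1 w)).
(* Equivalence of [E] and [E0] would extend [f] to a contramodule map [h] on Hom(N_n ⊗ C, T). As
   [g0] kills boundaries, its image there vanishes on N_n ⊗ gamma(k) and is killed by [h], whereas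
   [f g0] is 1. *)
move=> /(resolution_equiv (@contracat_lifts k C) negK (@contra_ses_projective _ _ gamma T))
  /(_ EM E0M)[h /(_ g0)].
rewrite app_zerom subr0 [LHS]fg0 => /esym; apply/eqP.
rewrite (_ : app h _ = 0) 1?eq_sym ?oner_eq0 //.
apply: (@free_hom_trivial _ _ _ _ gamma k^o h) => x.
by rewrite hom_injE g0B //; exists x.
Qed.

End NonInjective.

(** * Double duals of comodules *)

Section Bidual.
Variables (k : fieldType) (C : coalgebra k).
Implicit Types M N J L : comodule C.

Definition bidual M : Type := {linear {linear M -> k^o} -> k^o}.
HB.instance Definition _ M := GRing.Zmodule.on (bidual M).

Section Module.
Variable M : comodule C.

Definition bidual_act (f : dual C) (xi : bidual M) : bidual M :=
  xi \o precomp k^o (comod_act f).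

Lemma bidual_actE f (xi : bidual M) mu :
  bidual_act f xi mu = xi (mu \o comod_act f).
Proof. by []. Qed.

Lemma comod_act1 (x : M) : comod_act 1 x = x.
Proof. exact: coact_counit. Qed.
Lemma comod_actD (f g : dual C) (x : M) : comod_act (f + g) x = comod_act f x + comod_act g x.
Proof.
apply: (tensor_ext (f := @tunitl _ M \o tmap (f + g) idfun)
  (g := (@tunitl _ M \o tmap f idfun) \+ (@tunitl _ M \o tmap g idfun))) => c m.
by rewrite /= !tmapE !tunitlE scalerDl.
Qed.

Lemma comod_actZ a (f : dual C) (x : M) : comod_act (a *: f) x = a *: comod_act f x.
Proof.
apply: (tensor_ext (f := @tunitl _ M \o tmap (a *: f) idfun)
  (g := lin_scale a (@tunitl _ M \o tmap f idfun))) => c m.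
by rewrite /= /lin_of /= !tmapE !tunitlE scalerA.
Qed.

Lemma bidual_actA f g xi : bidual_act f (bidual_act g xi) = bidual_act (f * g) xi.
Proof.
apply: linear_ext => mu; rewrite !bidual_actE; congr (xi _).
by apply: linear_ext => x; rewrite -[RHS]/(mu (comod_act (f * g) x)) -comod_actM.
Qed.
Lemma bidual_act1 : left_id 1 bidual_act.
Proof.
move=> xi; apply: linear_ext => mu; rewrite bidual_actE; congr (xi _).
by apply: linear_ext => x; rewrite -[LHS]/(mu (comod_act 1 x)) comod_act1.
Qed.
Lemma bidual_actDr : right_distributive bidual_act +%R.
Proof. by move=> f xi eta; apply: linear_ext. Qed.
Lemma bidual_actDl xi : {morph bidual_act^~ xi : f g / f + g}.
Proof.
move=> f g; apply: linear_ext => mu; rewrite linDE !bidual_actE -linearD; congr (xi _).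
by apply: linear_ext => x; rewrite -[LHS]/(mu (comod_act (f + g) x)) comod_actD linearD.
Qed.
HB.instance Definition _ := GRing.Zmodule_isLmodule.Build (dual C) (bidual M)
  bidual_actA bidual_act1 bidual_actDr bidual_actDl.

End Module.

Section Map.
Variables (M N : comodule C) (h : comod_hom M N).

Lemma bidual_map_linear :
  linear (fun xi : bidual M => (xi \o precomp k^o h : bidual N)).
Proof.
move=> f xi eta; apply: linear_ext => mu.
rewrite -[LHS]/((f *: xi) (mu \o h) + eta (mu \o h)).
rewrite -[RHS]/(xi ((mu \o comod_act f) \o h) + eta (mu \o h)); congr (_ + _).
rewrite -[LHS]/(xi ((mu \o h) \o comod_act f)); congr (xi _).
by apply: linear_ext => x; rewrite -[RHS]/(mu (comod_act f (h x))) comod_act_hom.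
Qed.
Definition bidual_map : {linear bidual M -> bidual N} := mklin bidual_map_linear.
Lemma bidual_mapE xi mu : bidual_map xi mu = xi (mu \o h). Proof. by []. Qed.
End Map.

Lemma bidual_is_ses M J L (i : comod_hom M J) (p : comod_hom J L) :
  @is_ses (comodcat C) M J L i p ->
  @is_ses (modcat (dual C)) (bidual M) (bidual J) (bidual L) (bidual_map i) (bidual_map p).
Proof.
move=> [iI pS ex].
have iS mu : exists nu : {linear J -> k^o}, nu \o i = mu :> {linear M -> k^o}.
  have [nu nuE] := linear_extension (i := comod_fun i) mu iI.
  by exists nu; apply: linear_ext.
split.
- move=> xi eta E; apply: linear_ext => mu; have [nu <-] := iS mu.
  by rewrite -!bidual_mapE; congr ((_ : bidual J) nu).
- move=> eta; have pI : injective (precomp k^o (p : {linear J -> L})).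
    move=> mu nu E; apply: linear_ext => l; have [x <-] := pS l.
    by rewrite -[LHS]/(precomp k^o (p : {linear J -> L}) mu x) E.
  have [xi xiE] := linear_extension (eta : {linear _ -> _}) pI.
  by exists xi; apply: linear_ext.
move=> xi; split=> [xi0|[eta <-]].
  have [||eta etaE] := @linear_descent _ {linear M -> k^o} {linear J -> k^o} k^o
      (precomp k^o (i : {linear M -> J})) xi.
  - by move=> mu; have [nu nuE] := iS mu; exists nu.
  - move=> nu nu0; have [|l lE] := linear_descent (p := comod_fun p) (h := nu) pS.
      move=> x /ex[m mE]; rewrite -[x]mE.
      by rewrite -[LHS]/(precomp k^o (i : {linear M -> J}) nu m) nu0.
    have -> : nu = l \o p by apply: linear_ext => x; rewrite /= lE.
    by rewrite -bidual_mapE -[bidual_map p xi]/(app _ xi) xi0.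
  by exists eta; apply: linear_ext => mu; apply: etaE.
apply: linear_ext => mu; rewrite bidual_mapE bidual_mapE.
rewrite -[RHS](linear0 eta); congr (eta _); apply: linear_ext => m.
rewrite -[LHS]/(mu (p (i m))) -[RHS](linear0 mu); congr (mu _).
by apply/ex; exists m.
Qed.

End Bidual.

(** * Injectivity of the double dual of C ⊗ V for finite-dimensional V *)

Section RestrictScalars.
Variables (k : fieldType) (C : coalgebra k) (X : lmodType (dual C)).

Definition restricted : Type := X.
HB.instance Definition _ := GRing.Zmodule.on restricted.

Definition restricted_scale (a : k) (x : restricted) : restricted := (a *: (1 : dual C)) *: (x : X).

Lemma dual_scalel a (f g : dual C) : (a *: f) * g = a *: (f * g).
Proof.
apply: linear_ext => c.
apply: (tensor_ext (f := fpair (a *: f) g) (g := lin_scale a (fpair f g))) => u v.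
have E1 : fpair (a *: f) g (u ⊗ v) = a * f v * g u := fpairE (a *: f : {linear C -> k^o}) g u v.
have E2 : fpair f g (u ⊗ v) = f v * g u := fpairE (f : {linear C -> k^o}) g u v.
by apply: etrans E1 _; rewrite -[RHS]/(a * fpair f g (u ⊗ v)) E2 mulrA.
Qed.
Lemma restricted_scaleA a b x :
  restricted_scale a (restricted_scale b x) = restricted_scale (a * b) x.
Proof. by rewrite /restricted_scale scalerA dual_scalel mul1r scalerA. Qed.
Lemma restricted_scale1 : left_id 1 restricted_scale.
Proof. by move=> x; rewrite /restricted_scale scale1r [LHS]scale1r. Qed.
Lemma restricted_scaleDr : right_distributive restricted_scale +%R.
Proof. by move=> a x y; rewrite /restricted_scale [LHS]scalerDr. Qed.
Lemma restricted_scaleDl x : {morph restricted_scale^~ x : a b / a + b}.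
Proof. by move=> a b; rewrite /restricted_scale scalerDl [LHS]scalerDl. Qed.
HB.instance Definition _ := GRing.Zmodule_isLmodule.Build k restricted
  restricted_scaleA restricted_scale1 restricted_scaleDr restricted_scaleDl.

Lemma restricted_scaleE a (f : dual C) (x : X) : (a *: f) *: x = a *: (f *: x : restricted) :> X.
Proof. by rewrite -[RHS]/((a *: (1 : dual C)) *: (f *: x)) scalerA dual_scalel mul1r. Qed.

End RestrictScalars.

Section Frames.
Variables (k : fieldType) (V : lmodType k).

(* The vectors e i span V but need not be independent. *)
Lemma finite_dim_frame : finite_dim V -> exists r (e : 'I_r -> V) (phi : 'I_r -> {linear V -> k^o}),
  forall v, v = \sum_(i < r) phi i v *: e i.
Proof.
move=> [r [e eP]]; exists r, e.
have [||||v|phi [_ phiP]] := @lin_select k V {ffun 'I_r -> k^o} (fun v c => v = 0 /\ c = 0)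
  (fun v c => v = \sum_(i < r) (c i : k) *: e i).
- by split=> // a v w v' w' [-> ->] [-> ->]; rewrite !scaler0 !addr0.
- split; first by rewrite big1 // => i _; rewrite ffunE scale0r.
  move=> a v w v' w' -> ->; rewrite scaler_sumr -big_split; apply: eq_bigr => i _.
  by rewrite !ffunE scalerDl scalerA.
- by move=> v w [-> ->]; rewrite big1 // => i _; rewrite ffunE scale0r.
- by move=> w [].
- have [c cE] := eP v; exists [ffun i => c i].
  by rewrite [LHS]cE; apply: eq_bigr => i _; rewrite ffunE.
have pl i : linear (fun v => phi v i : k^o) by move=> a u v; rewrite linearP !ffunE.
by exists (fun i => mklin (pl i)) => v; apply: phiP.
Qed.

End Frames.

Section CofreeBidual.
Variables (k : fieldType) (C : coalgebra k) (V : lmodType k).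
Let J := cofree_comodule C V.
Variables (r : nat) (e : 'I_r -> V) (phi : 'I_r -> {linear V -> k^o}).
Hypothesis frame : forall v, v = \sum_(i < r) phi i v *: e i.

Definition frame_comp (mu : {linear J -> k^o}) (i : 'I_r) : dual C := mu \o tensor_right C (e i).
Definition frame_fun (i : 'I_r) : {linear J -> k^o} := phi i \o cofree_proj C V.

Lemma frame_funE i c v : frame_fun i (c ⊗ v) = counit c * phi i v.
Proof. by rewrite -[LHS]/(phi i (cofree_proj C V (c ⊗ v))) cofree_projE linearZ. Qed.

Lemma cofree_act (f : dual C) c v :
  comod_act f (c ⊗ v : J) = tensor_right C v (tunitl (tmap f idfun (comul c))).
Proof.
rewrite -[LHS]/(tunitl (tmap f idfun (cofree_coact C V (c ⊗ v)))) cofree_coactE.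
by rewrite -tmap_swap tunitl_nat.
Qed.

Definition frame_term (mu : {linear J -> k^o}) i : {linear J -> k^o} :=
  frame_fun i \o comod_act (frame_comp mu i).

(** The dual of C ⊗ V is generated over [dual C] by the finitely many [frame_fun i], with
    coefficients [frame_comp mu i]. This is the use made of the finite dimension of V. *)
Lemma frame_decomp (mu : {linear J -> k^o}) : mu = \sum_(i < r) frame_term mu i.
Proof.
apply: linear_ext; apply: (tensor_ext (g := \sum_(i < r) _)) => c v.
have -> : (\sum_(i < r) frame_term mu i) (c ⊗ v) =
    \sum_(i < r) frame_fun i (comod_act (frame_comp mu i) (c ⊗ v : J)).
  by elim/big_rec2: _ => // i x y _ <-.
rewrite [in LHS](frame v) (linear_sumr (@tpure k C V)) linear_sum; apply: eq_bigr => i _.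
rewrite cofree_act frame_funE.
transitivity (phi i v * mu (c ⊗ e i)).
  have E : c ⊗ (phi i v *: e i) = (phi i v : k) *: (c ⊗ e i) := tpureZr _ _ _.
  by apply: etrans (congr1 mu E) _; rewrite linearZ.
rewrite mulrC; congr (_ * _).
rewrite -[LHS]/(frame_comp mu i c) -[in LHS](counitr c).
apply: (tensor_ext (f := frame_comp mu i \o (@tunitr _ C \o tmap idfun counit))
  (g := counit \o (@tunitl _ C \o tmap (frame_comp mu i) idfun))) => a b.
rewrite -[LHS]/(frame_comp mu i (tunitr (tmap idfun counit (a ⊗ b)))).
rewrite -[RHS]/(counit (tunitl (tmap (frame_comp mu i) idfun (a ⊗ b)))).
by rewrite !tmapE tunitrE tunitlE !linearZ; apply: mulrC.
Qed.

Lemma frame_comp_act (mu : {linear J -> k^o}) (f : dual C) i :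
  frame_comp (mu \o comod_act f) i = frame_comp mu i * f.
Proof.
apply: linear_ext => c; rewrite -[LHS]/(mu (comod_act f (c ⊗ e i : J))) cofree_act.
rewrite -[RHS]/(fpair (frame_comp mu i) f (comul c)).
apply: (tensor_ext (f := frame_comp mu i \o (@tunitl _ C \o tmap f idfun))
  (g := fpair (frame_comp mu i) f)) => a b.
transitivity (frame_comp mu i b * f a); last first.
  exact: esym (fpairE (frame_comp mu i : {linear C -> k^o}) (f : {linear C -> k^o}) a b).
rewrite -[LHS]/(frame_comp mu i (tunitl (tmap f idfun (a ⊗ b)))).
by rewrite tmapE tunitlE linearZ; apply: mulrC.
Qed.

Lemma frame_compP a mu nu i : frame_comp (a *: mu + nu) i = a *: frame_comp mu i + frame_comp nu i.
Proof. exact: linear_ext. Qed.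

Lemma bidual_sum (xi : bidual J) (mu : {linear J -> k^o}) :
  xi mu = \sum_(i < r) (frame_comp mu i *: xi : bidual J) (frame_fun i).
Proof. by rewrite {1}(frame_decomp mu) linear_sum; apply: eq_bigr. Qed.

(** By [bidual_sum] a map to the double dual is recovered from its values at the [frame_fun i].
    These are functionals over k and extend from [B] to [X]; the formula that recovers the map makes
    the extension linear over [dual C]. *)
Lemma bidual_cofree_injective : @injective_object (modcat (dual C)) (bidual J).
Proof.
move=> A B S u; pose X : lmodType (dual C) := ses_mid S.
pose inc : {linear B -> X} := ses_inj S.
have incI : injective inc := @ses_injI _ _ _ S.
have inc_lin : linear (inc : restricted B -> restricted X).
  by move=> a x y; rewrite -[LHS]/(inc (_ *: _ + _)) linearP.
have ul i : linear (fun b : restricted B => (u : {linear B -> bidual J}) b (frame_fun i)).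
  move=> a x y; rewrite -[(a *: x + y)%R]/((a *: (1 : dual C)) *: (x : B) + (y : B)) linearP.
  rewrite -[LHS]/((u : {linear B -> bidual J}) x (frame_fun i \o comod_act (a *: (1 : dual C))) +
    (u : {linear B -> bidual J}) y (frame_fun i)).
  congr (_ + _); rewrite -linearZ; congr ((_ : bidual J) _); apply: linear_ext => z.
  rewrite -[LHS]/(frame_fun i (comod_act (a *: (1 : dual C)) z)) -[RHS]/(a *: frame_fun i z).
  by rewrite comod_actZ comod_act1 linearZ.
have /choice[ubar ubarE] (i : 'I_r) : exists ub : {linear restricted X -> k^o},
    forall b, ub (inc b) = (u : {linear B -> bidual J}) b (frame_fun i).
  have [ub ubE] := linear_extension (i := mklin inc_lin) (mklin (ul i)) incI.
  by exists ub => b; apply: ubE.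
have vl (x : X) : linear (fun mu : {linear J -> k^o} =>
    \sum_(i < r) ubar i (frame_comp mu i *: x) : k^o).
  move=> a mu nu; rewrite scaler_sumr -big_split; apply: eq_bigr => i _ /=.
  by rewrite -linearP frame_compP scalerDl restricted_scaleE.
pose v (x : X) : bidual J := mklin (vl x).
have vlin : linear v.
  move=> f x y; apply: linear_ext => mu.
  rewrite -[RHS]/(v x (mu \o comod_act f) + v y mu) -big_split; apply: eq_bigr => i _ /=.
  by rewrite frame_comp_act -linearD scalerDr scalerA.
exists (mklin vlin); apply/compP => b; apply: linear_ext => mu.
rewrite [RHS](bidual_sum (u b)); apply: eq_bigr => i _.
by rewrite -[_ *: _]linearZ [LHS]ubarE linearZ.
Qed.

End CofreeBidual.

(** * The product of a functional on a comodule with a map from C to T *)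

Section Star.
Variables (k : fieldType) (C : coalgebra k) (T : lmodType k).
Implicit Types (X Y : comodule C) (h : {linear C -> T}).

(* (mu * h)(x) = mu (x_(0)) h (x_(-1)) *)
Definition star X (mu : {linear X -> k^o}) h : {linear X -> T} :=
  @tunitr _ T \o (tmap h mu \o coact).

Lemma starE X (mu : {linear X -> k^o}) h x : star mu h x = tunitr (tmap h mu (coact x)).
Proof. by []. Qed.

Lemma star_hom X Y (q : comod_hom X Y) (la : {linear Y -> k^o}) h :
  star (la \o q) h = star la h \o q.
Proof.
apply: linear_ext => x; rewrite [RHS](starE la h (q x)) starE comod_funE tmap_comp.
by congr tunitr; apply: tmap_ext.
Qed.

Lemma tmapP_l (U V U' V' : lmodType k) a (f f' : {linear U -> U'}) (g : {linear V -> V'}) z :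
  tmap (a *: f + f') g z = a *: tmap f g z + tmap f' g z.
Proof.
apply: (tensor_ext (f := tmap (a *: f + f') g) 
  (g := a *: (tmap f g : {linear _ -> _}) + tmap f' g)) => u v.
rewrite -[RHS]/(a *: tmap f g (u ⊗ v) + tmap f' g (u ⊗ v)) !tmapE.
apply: etrans (tmapE _ _ _ _) _.
by rewrite -[LHS]/((a *: f u + f' u) ⊗ g v) (linearPl (@tpure k U' V')).
Qed.
Lemma tmapP_r (U V U' V' : lmodType k) a (f : {linear U -> U'}) (g g' : {linear V -> V'}) z :
  tmap f (a *: g + g') z = a *: tmap f g z + tmap f g' z.
Proof.
apply: (tensor_ext (f := tmap f (a *: g + g')) 
  (g := a *: (tmap f g : {linear _ -> _}) + tmap f g')) => u v.
rewrite -[RHS]/(a *: tmap f g (u ⊗ v) + tmap f g' (u ⊗ v)) !tmapE.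
apply: etrans (tmapE _ _ _ _) _.
by rewrite -[LHS]/(f u ⊗ (a *: g v + g' v)) (linearPr (@tpure k U' V')).
Qed.

Lemma star_linearl X h : linear (fun mu : {linear X -> k^o} => star mu h).
Proof. by move=> a mu nu; apply: linear_ext => x; rewrite linDE linZE !starE tmapP_r linearP. Qed.
Lemma star_linearr X (mu : {linear X -> k^o}) : linear (fun h => star mu h).
Proof. by move=> a g h; apply: linear_ext => x; rewrite linDE linZE !starE tmapP_l linearP. Qed.

Definition dual_star (f : dual C) h : {linear C -> T} :=
  @star (regular_comodule C) f h.

(** The action moves from the functional to the map. Together with [cofree_one_act] this makes the
    obstruction map linear over [dual C]. *)
Lemma star_act X (mu : {linear X -> k^o}) (f : dual C) h :
  star (mu \o comod_act f) h = star mu (dual_star f h).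
Proof.
apply: linear_ext => x; rewrite !starE.
transitivity (tunitr (tmap h mu (tmap idfun (@tunitl _ X \o tmap f idfun)
    (tassoc (tmap comul idfun (coact x)))))).
  by rewrite coactA -tmap_compr tmap_comp; congr tunitr.
apply: (tensor_ext (f := @tunitr _ T \o (tmap h mu \o (tmap idfun (@tunitl _ X \o tmap f idfun) \o
    (@tassoc _ C C X \o tmap comul idfun)))) (g := @tunitr _ T \o tmap (dual_star f h) mu)) => c m.
rewrite -[RHS]/(tunitr (tmap (dual_star f h) mu (c ⊗ m))) tmapE tunitrE starE.
rewrite -[LHS]/(tunitr (tmap h mu (tmap idfun (@tunitl _ X \o tmap f idfun)
  (tassoc (tmap comul idfun (c ⊗ m)))))) tmapE -[coact _]/(comul c).
have l : linear (fun y : tensor C C =>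
    tunitr (tmap h mu (tmap idfun (@tunitl _ X \o tmap f idfun) (tassoc (y ⊗ m))))).
  by move=> a y y'; rewrite (linearPl (@tpure k _ X)) !linearP.
pose F := lin_scale (mu m : k) (@tunitr _ T \o tmap h (f : {linear C -> k^o})).
transitivity (mklin l (comul c)) => //; transitivity (F (comul c)) => //.
apply: tensor_ext => a b.
rewrite /= /lin_of tassocE !tmapE /= tmapE !tunitrE tunitlE linearZ /=.
by rewrite scalerA mulrC.
Qed.

Lemma star_socle (gamma : coaugmentation C) X (mu : {linear X -> k^o}) h x :
  socle_mem gamma x -> star mu h x = mu x *: h (gamma 1).
Proof. by rewrite starE => ->; rewrite tmapE tunitrE. Qed.

Section Cofree.
Variables (V : lmodType k) (r : nat) (e : 'I_r -> V) (phi : 'I_r -> {linear V -> k^o}).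

Lemma star_cofree (nu : {linear cofree_comodule C V -> k^o}) h c i :
  star nu h (c ⊗ e i) = dual_star (frame_comp e nu i) h c.
Proof.
by rewrite starE [coact _]cofree_coactE tmap_comp [RHS]starE; congr tunitr.
Qed.

Lemma star_frame_fun i h c v :
  star (frame_fun C phi i) h (c ⊗ v : cofree_comodule C V) = phi i v *: h c.
Proof.
have -> : h c = tunitr (tmap h counit (comul c)).
  by rewrite -[in LHS](counitr c) -(tunitr_nat h) tmap_comp; congr tunitr.
rewrite starE [coact _]cofree_coactE tmap_comp.
pose F := lin_scale (phi i v : k) (@tunitr _ T \o tmap h (@counit k C)).
transitivity (F (comul c)) => //.
apply: (tensor_ext (f := @tunitr _ T \o tmap (h \o idfun) (frame_fun C phi i \o tensor_right C v)))
  => a b.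
transitivity ((counit b * phi i v) *: h a).
  rewrite -[LHS]/(tunitr (tmap (h \o idfun) (frame_fun C phi i \o tensor_right C v) (a ⊗ b))).
  by rewrite tmapE tunitrE; congr (_ *: _); apply: frame_funE.
rewrite -[RHS]/(phi i v *: tunitr (tmap h counit (a ⊗ b))) !tmapE !tunitrE.
by rewrite scalerA mulrC.
Qed.

End Cofree.

Let P := hom_contra (rcofree C k^o) T.

Definition cofree_one (h : P) : {linear C -> T} := h \o tensor_left C (1 : k^o).

Lemma cofree_one_linear : linear cofree_one.
Proof. by move=> a g h; apply: linear_ext. Qed.

Lemma cofree_one_act (f : dual C) (h : Theta_obj P) :
  cofree_one (f *: h) = dual_star f (cofree_one h).
Proof.
apply: linear_ext => c.
rewrite -[LHS]/((contract (lin_scalar (h : P) \o f) : P) ((1 : k^o) ⊗ c)) hom_contract_free.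
rewrite [RHS]starE.
apply: (tensor_ext (f := uncurry (lin_scalar (h : P) \o f) \o tmap (tensor_left C (1 : k^o)) idfun)
  (g := @tunitr _ T \o tmap (cofree_one h) f)) => a b.
rewrite -[LHS]/(uncurry (lin_scalar (h : P) \o f) (tmap (tensor_left C (1 : k^o)) idfun (a ⊗ b))).
rewrite -[RHS]/(tunitr (tmap (cofree_one h) f (a ⊗ b))).
by rewrite !tmapE uncurryE tunitrE.
Qed.

Lemma cofree_one_surj (g : {linear C -> T}) : exists h : P, cofree_one h = g.
Proof.
exists (g \o @tunitl _ C : {linear tensor k^o C -> T}); apply: linear_ext => c.
by rewrite -[LHS]/(g (tunitl ((1 : k^o) ⊗ c))) tunitlE scale1r.
Qed.

End Star.

(** * The obstruction class, and the failure of surjectivity *)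

Section ObstructionClass.
Variables (k : fieldType) (C : coalgebra k) (gamma : coaugmentation C) (T : lmodType k).
Variables (M L : comodule C) (V : lmodType k).
Let J := cofree_comodule C V.
Variables (i : comod_hom M J) (p : comod_hom J L).
Hypothesis ip : @is_ses (comodcat C) M J L i p.
Variables (r : nat) (e : 'I_r -> V) (phi : 'I_r -> {linear V -> k^o}).
Hypothesis frame : forall v, v = \sum_(a < r) phi a v *: e a.
Variables (f : {linear {linear L -> T} -> k^o}) (g0 : {linear L -> T}).
Hypothesis f_finite : forall g : {linear L -> T},
  (exists e, forall x, socle_mem gamma x -> in_span e (g x)) -> f g = 0.
Hypothesis fg0 : f g0 = 1.
Let P := hom_contra (rcofree C k^o) T.

Lemma star_decomp (h : 'I_r -> P) : (forall a c, cofree_one (h a) c = g0 (p (c ⊗ e a))) ->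
  \sum_(a < r) star (frame_fun C phi a) (cofree_one (h a)) = g0 \o p :> {linear J -> T}.
Proof.
move=> hE; apply: linear_ext; apply: (tensor_ext (f := \sum_(a < r) _)) => c v.
have -> : (\sum_(a < r) star (frame_fun C phi a) (cofree_one (h a)) : {linear J -> T}) (c ⊗ v) =
    \sum_(a < r) phi a v *: cofree_one (h a) c.
  elim/big_rec2: _ => // a x y _ <-.
  by rewrite linDE star_frame_fun.
rewrite -[RHS]/((g0 \o p) (c ⊗ v)) [in RHS](frame v) (linear_sumr (@tpure k C V)) linear_sum.
apply: eq_bigr => a _; rewrite hE.
have E : c ⊗ (phi a v *: e a) = (phi a v : k) *: (c ⊗ e a) := tpureZr _ _ _.
by apply: esym; apply: etrans (congr1 (g0 \o p) E) _; rewrite linearZ.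
Qed.

(** The value [s h mu] is [B (star nu h)], with [B] extending [f] and [nu] extending [mu] to J. The
    sum in the conclusion is then [B (g0 \o p) = f g0]; it certifies that [s] is not trivial. *)
Lemma obstruction_class : exists s : {linear Theta_obj P -> bidual M},
  forall h : 'I_r -> P, (forall a c, cofree_one (h a) c = g0 (p (c ⊗ e a))) ->
  \sum_(a < r) s (h a) (frame_fun C phi a \o i) = 1.
Proof.
have [iI pS ex] := ip.
have pI : injective (precomp T (p : {linear J -> L})).
  move=> u v E; apply: linear_ext => l; have [x <-] := pS l.
  by rewrite -[LHS]/(precomp T (p : {linear J -> L}) u x) E.
have [B BE] := linear_extension f pI.
have [t tK] := linear_retraction (iI : injective (i : {linear M -> J})).
(* On the socle [star la h] takes values in the line of [h (gamma 1)], so [f] kills it. *)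
have kill (la : {linear L -> k^o}) h : B (star (la \o p) h) = 0.
  transitivity (B (precomp T (p : {linear J -> L}) (star la h))).
    by congr (B _); apply: star_hom.
  rewrite BE.
  apply: f_finite; exists [:: h (gamma 1)] => x sx; rewrite (star_socle _ _ sx).
  by exists (fun=> la x); rewrite big_ord_recl big_ord0 addr0.
(* Hence the extension of a functional from M to J may be chosen freely, and the linear retraction
   [t] behaves as if it were a comodule map. *)
have same (mu nu : {linear J -> k^o}) h : (forall x, mu (i x) = nu (i x)) ->
    B (star mu h) = B (star nu h).
  move=> E; have [||la laE] := linear_descent (p := p : {linear J -> L}) (h := mu - nu).
  - exact: pS.
  - by move=> x /ex[m <-]; rewrite -[LHS]/(mu (i m) - nu (i m)) E subrr.
  have {}laE : mu = 1 *: (la \o p : {linear J -> k^o}) + nu.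
    apply: linear_ext => x; rewrite -[RHS]/(1 * la (p x) + nu x) mul1r laE.
    by rewrite -[RHS]/(mu x - nu x + nu x) subrK.
  by rewrite laE (star_linearl h) linearP scale1r kill add0r.
have s1 (h : P) : linear (fun mu : {linear M -> k^o} =>
    B (star (mu \o t : {linear J -> k^o}) (cofree_one h)) : k^o).
  move=> a mu nu; rewrite -linearP -(star_linearl (cofree_one h)); congr (B (star _ _)).
  exact: linear_ext.
pose s (h : Theta_obj P) : bidual M := mklin (s1 h).
have sl : linear s.
  move=> g h h'; apply: linear_ext => mu.
  rewrite -[LHS]/(B (star (mu \o t) (cofree_one (g *: h + h')))).
  rewrite -[RHS]/(B (star ((mu \o comod_act g) \o t) (cofree_one h)) +
    B (star (mu \o t) (cofree_one h'))).
  have -> : cofree_one (g *: h + h') = 1 *: dual_star g (cofree_one h) + cofree_one h'.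
    by rewrite scale1r -cofree_one_act; apply: linear_ext.
  rewrite (star_linearr (mu \o t)) linearP scale1r -star_act; congr (_ + _).
  apply: same => x; rewrite -[RHS]/(mu (comod_act g (t (i x)))) tK.
  by rewrite -[LHS]/(mu (t (comod_act g (i x)))) comod_act_hom tK.
exists (mklin sl) => h hE.
transitivity (B (\sum_(a < r) star (frame_fun C phi a) (cofree_one (h a)))).
  rewrite linear_sum; apply: eq_bigr => a _.
  rewrite -[LHS]/(B (star ((frame_fun C phi a \o i) \o t) (cofree_one (h a)))).
  by apply: same => x; rewrite -[LHS]/(frame_fun C phi a (i (t (i x)))) tK.
rewrite -fg0 -BE; congr (B _).
exact: star_decomp.
Qed.

Variables (V' : lmodType k).
Let J' := cofree_comodule C V'.
Variable p' : comod_hom J' M.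
Variables (r' : nat) (e' : 'I_r' -> V') (phi' : 'I_r' -> {linear V' -> k^o}).
Hypothesis frame' : forall v, v = \sum_(a < r') phi' a v *: e' a.

(** Restricting maps to the finitely many C ⊗ e' b, the lift [sigma] yields an additive functional
    on Hom(J', T) that takes [star nu (cofree_one x)] to [sigma x nu]. The sum is its value at the
    composite of [g0] with [p \o i \o p'], which is zero. *)
Lemma obstruction_not_lift (s : {linear Theta_obj P -> bidual M})
    (sigma : {linear Theta_obj P -> bidual J'}) (h : 'I_r -> P) :
  (forall x, s x = bidual_map p' (sigma x)) ->
  (forall a c, cofree_one (h a) c = g0 (p (c ⊗ e a))) ->
  \sum_(a < r) s (h a) (frame_fun C phi a \o i) = 0.
Proof.
move=> sE hE.
have [u uE] : exists u : {linear {linear C -> T} -> P}, forall g, cofree_one (u g) = g.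
  have [u uE] := linear_section (f := mklin (@cofree_one_linear k C T)) (@cofree_one_surj k C T).
  by exists u.
pose comp (g : {linear J' -> T}) b : {linear C -> T} := g \o tensor_right C (e' b).
pose B g : k^o := \sum_(b < r') sigma (u (comp g b)) (frame_fun C phi' b).
have B_D g g' : B (g + g') = B g + B g'.
  rewrite /B -big_split; apply: eq_bigr => b _ /=.
  have -> : comp (g + g') b = comp g b + comp g' b by apply: linear_ext.
  rewrite (linearD u).
  exact: (congr1 (fun xi : bidual J' => xi (frame_fun C phi' b)) (linearD sigma _ _)).
have B0 : B 0 = 0 by have := B_D 0 0; rewrite addr0 => /eqP; rewrite -subr_eq subrr => /eqP <-.
have cone_inj (x y : P) : cofree_one x = cofree_one y -> x = y.
  move=> E; apply/linear_ext/tensor_ext => a c.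
  have xa (z : P) : z (a ⊗ c) = a *: cofree_one z c.
    by rewrite -[a in LHS]mulr1 -[a * 1]/(a *: (1 : k^o)) tpureZl linearZ.
  by rewrite !xa E.
have BE (nu : {linear J' -> k^o}) (x : P) : B (star nu (cofree_one x)) = sigma x nu.
  rewrite (bidual_sum frame' (sigma x) nu); apply: eq_bigr => b _.
  rewrite -linearZ; congr ((sigma _ : bidual J') _); apply: cone_inj.
  rewrite uE cofree_one_act; apply: linear_ext => c.
  exact: star_cofree.
transitivity (B (\sum_(a < r) star (frame_fun C phi a \o (i \o p')) (cofree_one (h a)))).
  rewrite (big_morph B B_D B0); apply: eq_bigr => a _.
  rewrite sE BE; congr ((sigma _ : bidual J') _).
  exact: linear_ext.
rewrite (_ : \sum_(a < r) _ = 0) //; apply: linear_ext => x.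
transitivity ((g0 \o p) (i (p' x))); last first.
  have [_ _ ex] := ip; have pi0 : p (i (p' x)) = 0 by apply/ex; exists (p' x).
  by rewrite /= pi0 linear0.
apply: etrans (congr1 (fun q : {linear J -> T} => q (i (p' x))) (star_decomp hE)).
transitivity (\sum_(a < r) star (frame_fun C phi a) (cofree_one (h a)) (i (p' x))).
  elim/big_rec2: _ => // a y z _ <-; rewrite linDE; congr (_ + _).
  have E := congr1 (fun q : {linear J' -> T} => q x)
    (star_hom p' (frame_fun C phi a \o i) (cofree_one (h a))).
  apply: etrans E _; rewrite -[LHS]/(star (frame_fun C phi a \o i) (cofree_one (h a)) (p' x)).
  exact: (congr1 (fun q : {linear M -> T} => q (p' x))
    (star_hom i (frame_fun C phi a) (cofree_one (h a)))).
by elim/big_rec2: _ => // a y z _ ->.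
Qed.

End ObstructionClass.

Section ProjectiveExt.
Variable K : addcat.

(** A lift of the identity of [A] gives, from [E] to any extension, a morphism that is zero on [B].
    By [exseq_split_mor] all extensions then receive a morphism from one and the same split
    extension. *)
Lemma projective_exseq_equiv n (A B : K) (E E' : exseq n A B) :
  has_descents K -> projective A -> @yext_equiv K n.+1 A B E E'.
Proof.
move=> desc PA.
have ses_case (B1 B2 : K) (S : ses A B1) (S' : ses A B2) : ses_mor S S' (idm A) (zerom B1 B2).
  have [s /compP sE] := PA _ _ (ses_sur S') (idm A) (ses_surS S').
  apply/ses_morP; exists (comp s (ses_sur S)); split=> x.
    by rewrite appM ses_sur_inj app_zerom !raddf0.
  by rewrite appM sE.
have mor (F : exseq n A B) : exseq_mor E F (idm A) (zerom B B).
  case: n E F => [|n] E F in E' *; first exact: ses_case.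
  by exists (zerom _ _); split; [apply: ses_case | apply: exseq_mor_zero].
have split_mor F := exseq_split_mor desc (mor F) (@app_zerom K B B).
apply: yext_equiv_trans (yext_equiv_sym _) _; apply: exseq_mor_equiv; exact: split_mor.
Qed.

Lemma yext0_equiv_eq (A B : K) (u v : yext 0 A B) : yext_equiv u v -> u = v.
Proof.
elim=> [{}u {}v uv|//|{}u {}v _ -> //|u1 u2 u3 _ -> _ -> //].
by move: uv; rewrite /= comp1m compm1.
Qed.

End ProjectiveExt.

(** * Coresolution of the trivial module k by double duals *)

Section BidualCoresolution.
Variables (k : fieldType) (C : coalgebra k) (gamma : coaugmentation C).
Hypothesis conil : conilpotent gamma.
Let K0 := triv_comodule gamma k^o.
Let M j := mcomod gamma K0 j.
Let J j := cofree_comodule C (socle gamma (M j)).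
Let iota j : comod_hom (M j) (J j) := ses_inj (mcomod_ses K0 conil j).
Let p j : comod_hom (J j) (M j.+1) := ses_sur (mcomod_ses K0 conil j).
Let Tk := Theta_obj (triv_contramodule gamma k^o).

Lemma triv_act (f : dual C) (a : K0) : comod_act f a = (f (gamma 1) : k) *: a.
Proof. by rewrite -[LHS]/(tunitl (tmap f idfun (gamma 1 ⊗ a))) tmapE tunitlE. Qed.

Lemma eval_bidual_linear1 (a : k^o) : linear (fun nu : {linear K0 -> k^o} => nu a : k^o).
Proof. by []. Qed.
Lemma eval_bidual_linear :
  linear (fun a : Tk => (mklin (eval_bidual_linear1 a) : bidual K0)).
Proof.
move=> f a b; apply: linear_ext => nu.
rewrite -[RHS]/(nu (comod_act f (a : K0)) + nu b) triv_act.
by rewrite -[LHS]/(nu ((f (gamma 1) : k) *: (a : K0) + b)) linearD.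
Qed.
Definition eval_bidual : {linear Tk -> bidual K0} := mklin eval_bidual_linear.

Lemma bidual_eval_linear : linear (fun xi : bidual K0 => (xi (idfun : {linear K0 -> k^o}) : Tk)).
Proof.
move=> f xi eta.
rewrite -[LHS]/(xi ((idfun : {linear K0 -> k^o}) \o comod_act f) +
  eta (idfun : {linear K0 -> k^o})).
congr (_ + _); rewrite -[RHS]/((f (gamma 1) : k) *: xi (idfun : {linear K0 -> k^o})) -linearZ.
by congr (xi _); apply: linear_ext => a; rewrite -[LHS]/(comod_act f (a : K0)) triv_act.
Qed.
Definition bidual_eval : {linear bidual K0 -> Tk} := mklin bidual_eval_linear.

Lemma bidual_trivE (xi : bidual K0) (nu : {linear K0 -> k^o}) :
  xi nu = nu 1 * (bidual_eval xi : k^o).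
Proof.
rewrite -[RHS]/((nu 1 : k) *: xi (idfun : {linear K0 -> k^o})) -linearZ; congr (xi _).
apply: linear_ext => a; rewrite -[RHS]/(nu 1 * a) mulrC.
by rewrite -[RHS]/((a : k) *: nu 1) -linearZ [a *: _]mulr1.
Qed.
Lemma bidual_evalK : cancel bidual_eval eval_bidual.
Proof.
move=> xi; apply: linear_ext => nu; rewrite [RHS]bidual_trivE.
rewrite -[LHS]/(nu (bidual_eval xi)) -[RHS]mulrC.
by rewrite -[RHS]/((bidual_eval xi : k) *: nu 1) -linearZ [_ *: _]mulr1.
Qed.
Lemma eval_bidual_inj : injective eval_bidual.
Proof. by move=> a b /(congr1 (fun xi : bidual K0 => xi (idfun : {linear K0 -> k^o}))). Qed.

(** Degree 0 is the image of the trivial contramodule under [Theta] instead of the isomorphic double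
    dual of k, so that extensions by it can be compared directly. *)
Definition bidual_cosyz j : lmodType (dual C) :=
  if j is j'.+1 then bidual (M j'.+1) else Tk.

Definition bidual_inj j : {linear bidual_cosyz j -> bidual (J j)} :=
  match j return {linear bidual_cosyz j -> bidual (J j)} with
  | 0 => bidual_map (iota 0) \o eval_bidual
  | j'.+1 => bidual_map (iota j'.+1)
  end.

Lemma bidual_cosyz_is_ses j : @is_ses (modcat (dual C)) (bidual_cosyz j) (bidual (J j))
  (bidual_cosyz j.+1) (bidual_inj j) (bidual_map (p j)).
Proof.
have [iI pS ex] := bidual_is_ses (ses_exact (mcomod_ses K0 conil j)).
case: j iI pS ex => [|j] iI pS ex //; split=> // [a b E|x].
  by apply: eval_bidual_inj; apply: iI.
apply: iff_trans (ex x) _; split=> -[y yE]; last by exists (eval_bidual y).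
by exists (bidual_eval y); rewrite -yE -[in RHS](bidual_evalK y).
Qed.

Definition bidual_ses j : @ses (modcat (dual C)) (bidual_cosyz j.+1) (bidual_cosyz j) :=
  Ses (bidual_cosyz_is_ses j).

Lemma bidual_ses_injective j : finite_dim (socle gamma (M j)) ->
  injective_object (ses_mid (bidual_ses j)).
Proof. by move=> /finite_dim_frame[r [e [phi frame]]]; apply: bidual_cofree_injective frame. Qed.

Lemma iota_socle j (u : socle gamma (M j)) : iota j (socle_incl u) = gamma 1 ⊗ u.
Proof.
rewrite -[LHS]/(socle_embed gamma (M j) (socle_incl u)) socle_embedE ?socle_inclK //.
by apply/socle_inclP; exists u.
Qed.

(** The surjection of [F] onto [P] splits already over contramodules, and [Theta] preserves the
    splitting. *)
Lemma projective_lift m (P Q : contramodule C) (F : @exseq (contracat C) m P Q)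
    (s : @hom (modcat (dual C)) (Theta C P) (bidual_cosyz m.+1)) v :
  @projective (contracat C) P ->
  exseq_mor (exseq_map (Theta C) F) (@coresolution (modcat (dual C)) _ bidual_ses m) s v ->
  exists w : @hom (modcat (dual C)) (Theta C P) (ses_mid (bidual_ses m)),
    comp (ses_sur (bidual_ses m)) w = s.
Proof.
move=> PP.
have lift (B : contracat C) (S : @ses (contracat C) P B) z :
    ses_mor (ses_map (Theta C) S) (bidual_ses m) s z ->
    exists w : @hom (modcat (dual C)) (Theta C P) (ses_mid (bidual_ses m)),
      comp (ses_sur (bidual_ses m)) w = s.
  move=> /ses_morP[q [_ qE]].
  have [t /compP tE] := PP _ _ (ses_sur S) (@idm (contracat C) P) (ses_surS S).
  exists (comp q (fmap (Theta C) t)); apply/compP => x; rewrite appM qE.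
  by congr (app s _); apply: tE.
case: m F s lift => [|m] F s lift; first exact: lift.
by move=> [z [M' _]]; apply: lift M'.
Qed.

Theorem Ext_Theta_not_surjective m (T : lmodType k) :
  (forall j, (j <= m)%N -> finite_dim (socle gamma (M j))) ->
  ~ finite_dim (socle gamma (M m.+1)) -> ~ finite_dim T ->
  exists P : contramodule C,
    @projective (contracat C) P /\
    injective (@Ext_Theta k C m P (triv_contramodule gamma k^o)) /\
    ~ (forall y, exists x, @Ext_Theta k C m P (triv_contramodule gamma k^o) x = y).
Proof.
move=> Vfin nV nT.
pose K := contracat C; pose L := modcat (dual C).
pose P := hom_contra (rcofree C k^o) T; pose Q := triv_contramodule gamma k^o.
have PP : @projective K P by apply: free_projective.
exists P; split=> //; split.
  case: m Vfin nV => [|m] Vfin nV x y.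
    have [f ->] := Ext_classK x; have [g ->] := Ext_classK y.
    rewrite /Ext_Theta !Ext_map_class => /Ext_classP/yext0_equiv_eq fg.
    congr Ext_class; apply: app_inj => z.
    exact: (congr1 (fun q : {linear Theta_obj P -> Theta_obj Q} => q z) fg).
  have [E ->] := Ext_classK x; have [F ->] := Ext_classK y => _.
  apply: (Ext_classP _ _).2.
  exact: projective_exseq_equiv (@contracat_descents k C) PP.
have [||f [g0 [f0 _ fg0]]] := @infinite_rank_functional k (M m.+1) T
  (socle_mem gamma (M := M m.+1)) (fun x => x = 0) _ _ nT.
- by split=> [|a x y -> ->] //; rewrite scaler0 addr0.
- move=> [e [eZ eP]]; apply/nV/finite_dimP; exists (map (@socle_retr k C gamma (M m.+1)) e) => v.
  rewrite -[v]socle_inclK; apply: in_span_map.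
  have [|y [ye /eqP]] := eP (socle_incl v); last by rewrite subr_eq0 => /eqP ->.
  by apply/socle_inclP; exists v.
have [r [e [phi frame]]] := finite_dim_frame (Vfin m (leqnn m)).
have ip := ses_exact (mcomod_ses K0 conil m).
have [s sP] := obstruction_class ip frame f0 fg0.
have /choice[h hE] (a : 'I_r) : exists h : P, forall c, cofree_one h c = g0 (p m (c ⊗ e a)).
  have [h hE] := cofree_one_surj (g0 \o (p m \o tensor_right C (e a))).
  by exists h => c; rewrite hE.
have s1 := sP h hE.
move=> surj.
case: m Vfin nV f g0 f0 fg0 e phi frame ip s sP h hE s1 surj => [|m]
  Vfin nV f g0 f0 fg0 e phi frame ip s sP h hE s1 surj.
  have [x] := surj (Ext_class (n := 0) (bidual_eval \o s : @hom L (Theta C P) (Theta C Q))).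
  have [F ->] := Ext_classK x; rewrite /Ext_Theta Ext_map_class => /Ext_classP/yext0_equiv_eq FE.
  have F0 a : bidual_eval (s (h a)) = 0.
    rewrite -[LHS]/(app (bidual_eval \o s : @hom L _ _) (h a)) -FE.
    (* A contramodule map sees [h a] only at [gamma 1], where its value is [g0] of the image under
       [p 0] of [gamma 1 ⊗ e a]; this tensor comes from [M 0], so the value is zero. *)
    apply: (@free_hom_trivial _ _ _ _ gamma k^o F) => b.
    transitivity (b *: cofree_one (h a) (gamma 1)).
      by rewrite -[b in LHS]mulr1 -[b * 1]/(b *: (1 : k^o)) tpureZl linearZ.
    rewrite hE -iota_socle.
    have -> : p 0 (iota 0 (socle_incl (e a))) = 0 := ses_sur_inj (mcomod_ses K0 conil 0) _.
    by rewrite linear0 scaler0.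
  move: s1; rewrite big1 => [/esym/eqP|a _]; first by rewrite oner_eq0.
  by rewrite [LHS]bidual_trivE F0 [LHS]mulr0.
have IS j : (j <= m)%N -> injective_object (ses_mid (bidual_ses j)).
  by move=> jm; apply: bidual_ses_injective; apply: Vfin; apply: leqW.
(* In positive degree the missed class is the pullback of the coresolution along [s]. If it came
   from contramodules, its comparison map would lift by projectivity, and [s], which differs from
   that map by a liftable one, would lift as well. *)
have [E [EM _]] := exseq_pull (@modcat_lifts (dual C)) (@modcat_kernels (dual C))
  (@modcat_negatives (dual C)) (@coresolution L _ bidual_ses m) (s : @hom L (Theta C P) _).
have [x] := surj (Ext_class (n := m.+1) E).
have [F ->] := Ext_classK x; rewrite /Ext_Theta Ext_map_class => /Ext_classP FE.
have [s' FM] := coresolution_mor (@modcat_descents (dual C)) (exseq_map (Theta C) F) (@idm L _) IS.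
have [w wE] := projective_lift PP FM.
have [d dE] := coresolution_equiv (@modcat_descents (dual C)) (@modcat_negatives (dual C))
  IS FE FM EM.
have [r' [e' [phi' frame']]] := finite_dim_frame (Vfin m (leqnSn m)).
have [l lE] := hom_sub (@modcat_negatives (dual C)) w d.
have sl z : s z = bidual_map (p m) (l z).
  rewrite -[RHS]/(app (ses_sur (bidual_ses m)) (app l z)) lE raddfB -dE -appM wE.
  by rewrite opprB addrC subrK.
have := obstruction_not_lift ip frame frame' sl hE.
by rewrite s1 => /eqP; rewrite oner_eq0.
Qed.

End BidualCoresolution.

Theorem theorem8p1 (k : fieldType) (C : coalgebra k) (gamma : coaugmentation C)
    (n : nat) (T : lmodType k) :
  conilpotent gamma ->
  (1 <= n)%N ->
  ~ comod_Ext_finite_dim n (triv_comodule gamma k^o) (triv_comodule gamma k^o) ->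
  (forall m, (1 <= m < n)%N ->
     comod_Ext_finite_dim m (triv_comodule gamma k^o) (triv_comodule gamma k^o)) ->
  ~ finite_dim T ->
  ~ injective (@Ext_Theta k C n (triv_contramodule gamma T)
                 (triv_contramodule gamma k^o)) /\
  exists P : contramodule C,
    @projective (contracat C) P /\
    injective (@Ext_Theta k C n.-1 P (triv_contramodule gamma k^o)) /\
    ~ (forall y, exists x,
         @Ext_Theta k C n.-1 P (triv_contramodule gamma k^o) x = y).
Proof.
move=> conil; case: n => // n _ nfin fin nT.
have nV : ~ finite_dim (socle gamma (mcomod gamma (triv_comodule gamma k^o) n.+1)).
  by move=> V; apply/nfin/(mcomod_Ext_finite_dim conil).
split; first exact: Ext_Theta_not_injective.
apply: (Ext_Theta_not_surjective conil) nV nT => -[|j] jn.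
  (* The hypothesis on Ext begins in degree 1; in degree 0 the socle of k is spanned by one
     vector. *)
  apply/finite_dimP; exists [:: socle_retr gamma (triv_comodule gamma k^o) (1 : k^o)] => v.
  exists (fun=> (socle_incl v : k^o)); rewrite big_ord_recl big_ord0 addr0 /=.
  by rewrite -linearZ [_ *: _]mulr1 socle_inclK.
exact/(mcomod_Ext_finite_dim conil)/fin.
Qed.
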